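(* Let $N\ge 1$, $q>N$ and $n>1$ be integers. Let $D_1,\dots,D_q$ be hypersurfaces of degree $n$ in $\mathbb{P}^N(\mathbb{C})$ in general position, defined by homogeneous polynomials $Q_1,\dots,Q_q$ of degree $n$ respectively, with $\sum_{j=1}^{q}Q_j\not\equiv0$, and let $D_{q+1}=\{z\in\mathbb{P}^N(\mathbb{C}):\sum_{j=1}^{q}Q_j(z)=0\}$ be the hypersurface of degree $n$ defined by $Q_{q+1}=\sum_{j=1}^{q}Q_j$. Let $l_1,\dots,l_{q+1}$ be positive integers and let $f:\mathbb{C}\to\mathbb{P}^N(\mathbb{C})$ be a holomorphic curve whose image intersects $D_j$ with multiplicity at least $l_j$ for each $j=1,\dots,q+1$. If $$\sum_{j=1}^{q+1}\frac{1}{l_j}<\frac{1}{q-1},$$ then $f$ is algebraically degenerate.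
   Context: A holomorphic curve $f:\mathbb{C}\to\mathbb{P}^N(\mathbb{C})$ is written in a reduced representation $f=(f_0:\dots:f_N)$, where the $f_i$ are entire functions without common zeros. The curve $f$ is algebraically degenerate if its image is contained in some proper algebraic subset of $\mathbb{P}^N(\mathbb{C})$. For a hypersurface $D$ defined by a homogeneous polynomial $Q$, the image of $f$ intersects $D$ with multiplicity at least $l$ if every zero of the entire function $Q(f)=Q(f_0,\dots,f_N)$ has order at least $l$ (the condition holds vacuously if $Q(f)$ has no zeros; a zero of the identically zero function is regarded as having infinite order). Hypersurfaces $D_1,\dots,D_q$ ($q>N$) in $\mathbb{P}^N(\mathbb{C})$ are in general position if for any distinct $i_1,\dots,i_{N+1}\in\{1,\dots,q\}$ one has $\bigcap_{k=1}^{N+1}\mathrm{supp}\,D_{i_k}=\varnothing$. *)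

(* Defs.v *)
From HB Require Import structures.
From mathcomp Require Import all_boot all_order all_algebra.
From mathcomp Require Import complex.
(* The notations of mpoly clash with those of MathComp-Analysis. *)
From mathcomp Require Import -(notations) mpoly.
From mathcomp Require Import boolp classical_sets reals topology normedtype.
From mathcomp Require Import derive.
Set Implicit Arguments.
Unset Strict Implicit.
Unset Printing Implicit Defensive.
Import Order.TTheory GRing.Theory Num.Theory numFieldNormedType.Exports.
Local Open Scope ring_scope.
Local Open Scope classical_set_scope.

(* Typing R[i] as a numFieldType makes it a normed module over itself, so
   that [derivable f z 1] below is complex differentiability. *)
Definition cplx (R : realType) : numFieldType := R[i].

Definition entire (R : realType) (h : cplx R -> cplx R) : Prop :=
  forall z : cplx R, derivable h z 1.

(* The order of h at z is the least k such that the k-th derivative of h does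
   not vanish at z; it is infinite when h is identically zero. *)
Definition order_at_least (R : realType) (h : cplx R -> cplx R)
    (z : cplx R) (m : nat) : Prop :=
  forall k : nat, (k < m)%N -> derive1n k h z = 0.

Definition coord_poly (R : realType) (N : nat) := mpoly N.+1 (cplx R).

Definition is_form (R : realType) (N : nat) (P : coord_poly R N) : Prop :=
  P \is ishomog mdeg.

Definition is_form_of_degree (R : realType) (N n : nat) (P : coord_poly R N) :
    Prop :=
  P \is ishomog1 n mdeg.

(* Points of P^N are given by homogeneous coordinates: a subset of P^N is
   represented by the cone over it in C^(N+1) with the origin removed. *)
Definition proj_space (R : realType) (N : nat) : set ('I_N.+1 -> cplx R) :=
  [set x | exists i, x i != 0].

Definition proj_zeros (R : realType) (N : nat) (S : set (coord_poly R N)) :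
    set ('I_N.+1 -> cplx R) :=
  [set x | proj_space x /\ forall P, S P -> meval x P = 0].

Definition algebraic_set (R : realType) (N : nat)
    (V : set ('I_N.+1 -> cplx R)) : Prop :=
  exists S : set (coord_poly R N),
    (forall P, S P -> is_form P) /\ V = proj_zeros S.

Definition hypersurface_form (R : realType) (N n : nat) (P : coord_poly R N) :
    Prop :=
  is_form_of_degree n P /\ P <> 0.

Definition supp (R : realType) (N : nat) (P : coord_poly R N) :
    set ('I_N.+1 -> cplx R) :=
  proj_zeros [set P].

Definition general_position (R : realType) (N q : nat)
    (Q : 'I_q -> coord_poly R N) : Prop :=
  forall i : 'I_N.+1 -> 'I_q, injective i ->
    \bigcap_(k in [set: 'I_N.+1]) supp (Q (i k)) = set0.

(* A holomorphic curve in P^N, given by a reduced representation. *)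
Definition holomorphic_curve (R : realType) (N : nat)
    (f : 'I_N.+1 -> cplx R -> cplx R) : Prop :=
  (forall i, entire (f i)) /\ (forall z, proj_space (fun i => f i z)).

Definition compose_form (R : realType) (N : nat) (P : coord_poly R N)
    (f : 'I_N.+1 -> cplx R -> cplx R) : cplx R -> cplx R :=
  fun z => meval (fun i => f i z) P.

Definition intersects_with_mult_at_least (R : realType) (N : nat)
    (f : 'I_N.+1 -> cplx R -> cplx R) (P : coord_poly R N) (l : nat) : Prop :=
  forall z : cplx R,
    compose_form P f z = 0 -> order_at_least (compose_form P f) z l.

Definition algebraically_degenerate (R : realType) (N : nat)
    (f : 'I_N.+1 -> cplx R -> cplx R) : Prop :=
  exists V : set ('I_N.+1 -> cplx R),
    [/\ algebraic_set V, V `<` @proj_space R N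
      & forall z, V (fun i => f i z)].

(* The family Q_1, ..., Q_q followed by Q_1 + ... + Q_q at index [ord_max]. *)
Definition with_sum (R : realType) (N q : nat) (Q : 'I_q -> coord_poly R N)
    (j : 'I_q.+1) : coord_poly R N :=
  if unlift ord_max j is Some i then Q i else \sum_(i < q) Q i.

(* Main.v *)
(** Suppose that [f] is nondegenerate. If the [Q_j] are linearly independent, let [g_j = Q_j(f)]
    for [j <= q] and let the last function be [- \sum_j Q_j(f)]; otherwise let the [g_j] be the
    terms [c_j Q_j(f)] of a linear relation of minimal support. This support has at least [N + 2]
    elements: a shorter relation would make one form vanish at a common zero of [N] other
    forms in [N + 1] variables, and such a zero always exists. In both cases [g_0, ..., g_k] are
    entire functions of sum [0] without common zeros, any zero of [g_i] has order at least [l_i],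
    [(k - 1) \sum_i 1 / l_i < 1], and [g_0, ..., g_(k-1)] are independent.

    Put [b = \prod_i l_i], [a_i = b / l_i], [d = b - (k - 1) \sum_i a_i > 0], and let [W] be the
    Wronskian of [g_0, ..., g_(k-1)]. Then [Psi = W^b / \prod_i g_i^(b - (k - 1) a_i)] is entire.
    With [kap = b k (k - 1) / 2], let [(j, z)] nearly maximize
    [|Psi(z) g_j(z)^d| (r - |z - p|)^kap] over the disc [|z - p| < r]. Near [z], on a disc of radius
    comparable to [r - |z - p|], a [d]-th root [h] of [Psi] freed of its zeros makes every [h g_i]
    bounded by a multiple of [|h(z) g_j(z)|]. Cauchy estimates adapted to functions with multiple
    zeros then bound [W], and the quantity above is at most a constant independent of [r]. Since
    it is at least half of [|Psi(p) g_0(p)^d| r^kap], letting [r] tend to infinity is a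
    contradiction. *)

From HB Require Import structures.
From mathcomp Require Import all_boot all_order all_algebra perm.
From mathcomp Require Import complex.
From mathcomp Require Import -(notations) mpoly.
From mathcomp Require Import boolp classical_sets reals topology normedtype.
From mathcomp Require Import sequences derive exp trigo.
From mathcomp Require Import ring lra zify.
Require Import Defs.
Set Implicit Arguments.
Unset Strict Implicit.
Unset Printing Implicit Defensive.
Import Order.TTheory GRing.Theory Num.Theory numFieldNormedType.Exports.
Local Open Scope ring_scope.

(** * Modulus, continuity and complex differentiability *)

(** The exponents come from homogeneity. Replacing every [g_i] by [h g_i] multiplies [W^b] by
    [h^(k b)] and the denominator of [Psi] by [h^(k b + d)]. Hence [Psi g_j^d] depends only on the
    projective curve, and a local estimate may be made after multiplication by any zero-free [h]. A
    [d]-th root of [Psi] is the right factor, since [|h g_i|^d = |Psi g_i^d|]; the obstacle is that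
    [Psi] may vanish near [z], and Blaschke factors remove its zeros without changing the modulus on
    a circle. The power [b - (k - 1) a_i] is sharp: at a zero of order [m >= l_i] of [g_i], at most
    [k - 1] differentiations leave order [b (m - k + 1) >= m (b - (k - 1) a_i)], with equality at
    [m = l_i]. The weight [kap] is [b] times the total order [0 + ... + (k - 1)] of the derivatives
    in a term of [W]. The bound [1 / (q - 1)] is the condition on [k] for [k = q]. A relation among
    the [Q_j] alone has [k < q] and fewer multiplicities, so the same bound covers it. *)

Definition cabs (R : realType) (z : cplx R) : R := Normc.normc z.
Definition creal (R : realType) (x : R) : cplx R := real_complex R x.

Local Notation cre := complex.Re.
Local Notation cim := complex.Im.

Section Cabs.
Variable R : realType.
Local Notation C := (cplx R).
Implicit Types z w : C.

(** The norm of [cplx R] takes its values in [cplx R]; the real-valued [cabs] puts estimates within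
    reach of [lra] and [nra]. *)
Lemma normE z : `|z| = creal (cabs z).
Proof. by case: z. Qed.

Lemma cabs0 : cabs (0 : C) = 0. Proof. exact: Normc.normc0. Qed.
Lemma cabs1 : cabs (1 : C) = 1. Proof. exact: Normc.normc1. Qed.
Lemma cabsM z w : cabs (z * w) = cabs z * cabs w.
Proof. exact: Normc.normcM. Qed.
Lemma cabsV z : cabs z^-1 = (cabs z)^-1. Proof. exact: Normc.normcV. Qed.
Lemma cabsN z : cabs (- z) = cabs z. Proof. exact: normcN. Qed.
Lemma cabs_ge0 z : 0 <= cabs z.
Proof. by rewrite /cabs; case: z => a b /=; exact: sqrtr_ge0. Qed.
Lemma cabsD z w : cabs (z + w) <= cabs z + cabs w. Proof. exact: le_normcD. Qed.
Lemma cabsB z w : cabs (z - w) <= cabs z + cabs w.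
Proof. by rewrite -(cabsN w) cabsD. Qed.
Lemma cabsC z w : cabs (z - w) = cabs (w - z).
Proof. by rewrite -opprB cabsN. Qed.
Lemma cabs_eq0 z : (cabs z == 0) = (z == 0).
Proof.
by apply/eqP/eqP => [/(@Normc.eq0_normc R)|->]; last exact: cabs0.
Qed.
Lemma cabs_gt0 z : (0 < cabs z) = (z != 0).
Proof. by rewrite lt_def cabs_ge0 andbT cabs_eq0. Qed.
Lemma cabsX z n : cabs (z ^+ n) = cabs z ^+ n.
Proof. by elim: n => [|n IH]; rewrite ?expr0 ?cabs1 // !exprS cabsM IH. Qed.
Lemma cabs_nat n : cabs (n%:R : C) = n%:R.
Proof.
have -> : (n%:R : C) = (creal n%:R) by rewrite /creal rmorph_nat.
by rewrite /cabs /= expr0n /= addr0 sqrtr_sqr ger0_norm ?ler0n.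
Qed.
Lemma cabs_creal (x : R) : cabs (creal x) = `|x|.
Proof. by rewrite /cabs /= expr0n /= addr0 sqrtr_sqr. Qed.
Lemma cabs_triangle z w x : cabs (z - w) <= cabs (z - x) + cabs (x - w).
Proof.
have -> : z - w = (z - x) + (x - w) by ring.
exact: cabsD.
Qed.
Lemma cabs_sum (I : Type) (r : seq I) (P : pred I) (F : I -> C) :
  cabs (\sum_(i <- r | P i) F i) <= \sum_(i <- r | P i) cabs (F i).
Proof.
elim/big_rec2: _ => [|i x y _ IH]; first by rewrite cabs0.
by rewrite (le_trans (cabsD _ _)) // lerD2l.
Qed.
Lemma cabs_prod (I : Type) (r : seq I) (P : pred I) (F : I -> C) :
  cabs (\prod_(i <- r | P i) F i) = \prod_(i <- r | P i) cabs (F i).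
Proof. exact: (big_morph (@cabs R) cabsM cabs1). Qed.
Lemma cabs_Re z : `|cre z| <= cabs z.
Proof. by rewrite -lecR; exact: normc_ge_Re. Qed.
Lemma cabs_Im z : `|cim z| <= cabs z.
Proof.
case: z => a b; rewrite /cabs /=.
by rewrite -sqrtr_sqr ler_wsqrtr // lerDr sqr_ge0.
Qed.
Lemma cabs_ReIm z : cabs z <= `|cre z| + `|cim z|.
Proof.
case: z => a b; rewrite /cabs /=.
rewrite -[leRHS]ger0_norm ?addr_ge0 // -sqrtr_sqr ler_wsqrtr //.
rewrite sqrrD !real_normK ?num_real //.
by have := normr_ge0 a; have := normr_ge0 b; nra.
Qed.

Lemma cabs_half z : cabs (z / 2) = cabs z / 2.
Proof. by rewrite cabsM cabsV cabs_nat. Qed.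

Definition cconv (u : nat -> C) (l : C) : Prop :=
  forall e : R, 0 < e -> exists N, forall n, (N <= n)%N -> cabs (u n - l) <= e.

Lemma real_cauchy (u : nat -> R) :
  (forall e : R, 0 < e -> exists N, forall m n, (N <= m)%N -> (N <= n)%N ->
     `|u m - u n| <= e) ->
  exists l, forall e : R, 0 < e -> exists N, forall n, (N <= n)%N ->
     `|u n - l| <= e.
Proof.
move=> cu.
pose A : set R := fun x => exists N, forall n, (N <= n)%N -> x <= u n.
have [N0 hN0] := cu 1 ltr01.
have hsup : has_sup A.
  split.
    exists (u N0 - 1), N0 => n hn; have := hN0 _ _ (leqnn _) hn.
    by rewrite ler_norml => /andP[]; lra.
  exists (u N0 + 1) => x [N hN].
  have := hN _ (leq_maxl N N0); have := hN0 _ _ (leqnn _) (leq_maxr N N0).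
  by rewrite ler_norml => /andP[]; lra.
exists (sup A) => e e0; have [N hN] := cu (e / 2) (ltac:(by lra)).
exists N => n hn.
have h1 : u n - e / 2 <= sup A.
  apply: ub_le_sup; first by case: hsup.
  exists N => m hm; have := hN _ _ hn hm.
  by rewrite ler_norml => /andP[]; lra.
have h2 : sup A <= u n + e / 2.
  apply: ge_sup; first by case: hsup.
  move=> x [M hM]; have := hM _ (leq_maxl M N).
  have := hN _ _ hn (leq_maxr M N).
  by rewrite ler_norml => /andP[]; lra.
by rewrite ler_norml; apply/andP; split; lra.
Qed.

Lemma cauchy_cconv (u : nat -> C) :
  (forall e : R, 0 < e -> exists N, forall m n, (N <= m)%N -> (N <= n)%N ->
     cabs (u m - u n) <= e) ->
  exists l, cconv u l.
Proof.
move=> cu.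
have [|x hx] := @real_cauchy (fun n => cre (u n)).
  move=> e e0; have [N hN] := cu e e0; exists N => m n hm hn.
  apply: le_trans (hN m n hm hn); rewrite -raddfB; exact: cabs_Re.
have [|y hy] := @real_cauchy (fun n => cim (u n)).
  move=> e e0; have [N hN] := cu e e0; exists N => m n hm hn.
  apply: le_trans (hN m n hm hn); rewrite -raddfB; exact: cabs_Im.
exists (x +i* y)%C => e e0.
have e2 : 0 < e / 2 by lra.
have [N1 h1] := hx _ e2; have [N2 h2] := hy _ e2.
exists (maxn N1 N2) => n; rewrite geq_max => /andP[/h1 {}h1 /h2 {}h2].
apply: le_trans (cabs_ReIm _) _; move: h1 h2; case: (u n) => a b /=; lra.
Qed.

Lemma cconv_unique u (l l' : C) : cconv u l -> cconv u l' -> l = l'.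
Proof.
move=> h h'; apply/eqP; rewrite -subr_eq0 -cabs_eq0 eq_le cabs_ge0 andbT.
rewrite leNgt; apply/negP => p0.
have p3 : 0 < cabs (l - l') / 3 by lra.
have [N hN] := h _ p3; have [N' hN'] := h' _ p3.
have := hN _ (leq_maxl N N'); have := hN' _ (leq_maxr N N').
have := cabs_triangle l l' (u (maxn N N')).
rewrite (cabsC l (u _)); lra.
Qed.

Lemma cconvD u v (l m : C) : cconv u l -> cconv v m ->
  cconv (fun n => u n + v n) (l + m).
Proof.
move=> hu hv e e0.
have e2 : 0 < e / 2 by lra.
have [N1 h1] := hu _ e2; have [N2 h2] := hv _ e2.
exists (maxn N1 N2) => n; rewrite geq_max => /andP[/h1 {}h1 /h2 {}h2].
have -> : u n + v n - (l + m) = (u n - l) + (v n - m) by ring.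
have := cabsD (u n - l) (v n - m); lra.
Qed.

Lemma cconvN u (l : C) : cconv u l -> cconv (fun n => - u n) (- l).
Proof.
move=> hu e /hu[N hN]; exists N => n /hN.
by rewrite -opprD cabsN.
Qed.

Lemma cconv_shift u (l : C) k : cconv u l -> cconv (fun n => u (n + k)%N) l.
Proof.
by move=> hu e /hu[N hN]; exists N => n hn; apply: hN; rewrite (leq_trans hn) ?leq_addr.
Qed.

Lemma cconv_le u (l m : C) (M : R) : cconv u l ->
  (forall n, cabs (u n - m) <= M) -> cabs (l - m) <= M.
Proof.
move=> hu hM; apply/ler_addgt0Pr => e e0.
have [N /(_ _ (leqnn N))] := hu e e0; have := hM N.
have := cabs_triangle l m (u N); rewrite (cabsC l (u _)); lra.
Qed.

Lemma exists_half_lt (x : R) : 0 < x -> exists N, forall n, (N <= n)%N -> (2 ^+ n)^-1 <= x.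
Proof.
move=> x0; have [N hN] : exists N : nat, x^-1 < N%:R.
  exists (Num.truncn x^-1).+1; exact: truncnS_gt.
exists N => n hn; rewrite -[x]invrK lef_pV2 ?posrE ?invr_gt0 ?exprn_gt0 //.
apply: (le_trans (ltW hN)); apply: (@le_trans _ _ (n%:R)); first by rewrite ler_nat.
by rewrite -natrX ler_nat ltnW // ltn_expl.
Qed.

Lemma geom_cauchy (u : nat -> C) (L : R) :
  (forall n, cabs (u n.+1 - u n) <= L / 2 ^+ n) ->
  exists l, cconv u l /\ forall n, cabs (u n - l) <= 2 * L / 2 ^+ n.
Proof.
move=> hu.
have L0 : 0 <= L.
  by have := le_trans (cabs_ge0 _) (hu 0%N); rewrite expr0 divr1.
have hd n k : cabs (u (n + k)%N - u n) <= 2 * L / 2 ^+ n - 2 * L / 2 ^+ (n + k).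
  elim: k => [|k IH]; first by rewrite addn0 !subrr cabs0.
  rewrite addnS; have := cabs_triangle (u (n + k).+1) (u n) (u (n + k)%N).
  have := hu (n + k)%N.
  have -> : 2 * L / 2 ^+ (n + k).+1 = L / 2 ^+ (n + k).
    by rewrite exprS -mulf_div divff ?mul1r // pnatr_eq0.
  move: IH; have -> : 2 * L / 2 ^+ (n + k) = L / 2 ^+ (n + k) + L / 2 ^+ (n + k).
    by rewrite -mulrA mulr_natl mulr2n.
  lra.
have hd' n k : cabs (u (n + k)%N - u n) <= 2 * L / 2 ^+ n.
  apply: le_trans (hd n k) _; rewrite gerBl.
  by rewrite divr_ge0 ?mulr_ge0 // exprn_ge0.
have [l hl] : exists l, cconv u l.
  apply: cauchy_cconv => e e0.
  have q0 : 0 < e / (4 * L + 1) by rewrite divr_gt0 //; lra.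
  have [N hN] := exists_half_lt q0; exists N => m n hm hn.
  have := hd' N (m - N)%N; have := hd' N (n - N)%N; rewrite !subnKC //.
  have := cabs_triangle (u m) (u n) (u N); rewrite (cabsC (u N)).
  have h := hN N (leqnn N).
  have : 4 * L / 2 ^+ N <= e.
    apply: le_trans (_ : (4 * L + 1) / 2 ^+ N <= _).
      by rewrite ler_pM2r ?invr_gt0 ?exprn_gt0 //; lra.
    by rewrite mulrC -ler_pdivlMr //; lra.
  have -> : 4 * L / 2 ^+ N = 2 * L / 2 ^+ N + 2 * L / 2 ^+ N.
    by rewrite -!mulrDl; congr (_ / _); ring.
  lra.
exists l; split=> // n; rewrite cabsC.
apply: (cconv_le (cconv_shift n hl)) => m; rewrite addnC; exact: hd'.
Qed.

(** Compactness of the closed disc as an induction principle on sets: a property that is hereditary,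
    stable under unions and locally true holds for the whole disc. It yields boundedness, attained
    maxima and uniform continuity below. *)
Lemma cabs_disc_ind (c : C) (s : R) (P : (C -> Prop) -> Prop) : 0 <= s ->
  (forall A B : C -> Prop, (forall z, A z -> B z) -> P B -> P A) ->
  (forall A B : C -> Prop, P A -> P B -> P (fun z => A z \/ B z)) ->
  (forall z, cabs (z - c) <= s ->
     exists d : R, 0 < d /\ P (fun w => cabs (w - z) < d)) ->
  P (fun z => cabs (z - c) <= s).
Proof.
move=> s0 mono union loc; apply: contrapT => nP.
have P0 : P (fun=> False).
  have [|d [_ hd]] := loc c; first by rewrite subrr cabs0.
  exact: mono hd.
(* The sets whose complement in the disc satisfies [P]. If [P] fails on the disc this filter is
   proper, and a cluster point of it in a square contradicts local truth. *)
pose F : set_system (R * R)%type := fun B =>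
  P (fun z => cabs (z - c) <= s /\ ~ B (cre z, cim z)).
have FF : ProperFilter F.
  split; first by move=> h; apply: nP; apply: mono h => z hz; split.
  split.
  - by apply: mono P0 => z [_ []].
  - move=> A B hA hB; apply: mono (union _ _ hA hB) => z [hz /not_andP[] h].
      by left.
    by right.
  - move=> A B AB; apply: mono => z [hz nB]; split=> // hA.
    by apply: nB; exact: AB.
pose K := (`[(cre c - s), (cre c + s)] `*` `[(cim c - s), (cim c + s)])%classic.
have cK : compact K by apply: compact_setX; exact: segment_compact.
have FK : F K.
  apply: mono P0 => z [hz []]; split; rewrite /= in_itv /=.
    have := le_trans (cabs_Re (z - c)) hz; rewrite raddfB ler_norml => /andP[/= h1 h2].
    by apply/andP; split; lra.
  have := le_trans (cabs_Im (z - c)) hz; rewrite raddfB ler_norml => /andP[/= h1 h2].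
  by apply/andP; split; lra.
have [[x y] [_ clp]] := cK F FF FK.
pose z : C := (x +i* y)%C.
have [d [d0 hd]] : exists d : R, 0 < d /\
    P (fun w => cabs (w - c) <= s /\ cabs (w - z) < d).
  have [hz|hz] := leP (cabs (z - c)) s.
    have [d [d0 hd]] := loc z hz; exists d; split=> //.
    by apply: mono hd => w [].
  exists (cabs (z - c) - s); split; first by rewrite subr_gt0.
  apply: mono P0 => w [h1 h2]; have := cabs_triangle z c w.
  rewrite (cabsC z w); lra.
pose U : set (R * R)%type := fun p => cabs ((p.1 +i* p.2)%C - z : C) < d.
have FU : F (~` U)%classic.
  apply: mono hd => w [h1 h2]; split=> //; move/contrapT: h2.
  by rewrite /U /=; case: (w).
have nU : nbhs (x, y) U.
  apply/nbhs_ballP; exists (d / 2) => /=; first by lra.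
  move=> [a b] [/= h1 h2]; rewrite /U /=.
  apply: (le_lt_trans (cabs_ReIm ((a +i* b)%C - z))) => /=.
  move: h1 h2; rewrite /ball /= (distrC x) (distrC y); lra.
by have [p []] := clp _ _ FU nU.
Qed.

Definition ccont (f : C -> C) (z : C) : Prop :=
  forall e : R, 0 < e ->
    exists d : R, 0 < d /\ forall w, cabs (w - z) < d -> cabs (f w - f z) <= e.

Lemma ccont_ext f g z (d : R) : 0 < d ->
  (forall w, cabs (w - z) < d -> f w = g w) -> ccont f z -> ccont g z.
Proof.
move=> d0 fg cf e /cf[d' [d'0 h]]; exists (Num.min d d'); split.
  by rewrite lt_min d0.
move=> w; rewrite lt_min => /andP[h1 h2].
by rewrite -!fg ?h // subrr cabs0.
Qed.

Lemma ccont_cst (k : C) z : ccont (fun=> k) z.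
Proof. by move=> e e0; exists 1; split=> // w _; rewrite subrr cabs0 ltW. Qed.

Lemma ccont_id z : ccont id z.
Proof. by move=> e e0; exists e; split=> // w /ltW. Qed.

Lemma ccontD f g z : ccont f z -> ccont g z -> ccont (fun w => f w + g w) z.
Proof.
move=> cf cg e e0; have e2 : 0 < e / 2 by lra.
have [d1 [d10 h1]] := cf _ e2; have [d2 [d20 h2]] := cg _ e2.
exists (Num.min d1 d2); split; first by rewrite lt_min d10.
move=> w; rewrite lt_min => /andP[/h1 {}h1 /h2 {}h2].
have -> : f w + g w - (f z + g z) = (f w - f z) + (g w - g z) by ring.
by have := cabsD (f w - f z) (g w - g z); lra.
Qed.

Lemma ccontM f g z : ccont f z -> ccont g z -> ccont (fun w => f w * g w) z.
Proof.
move=> cf cg e e0.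
pose M := cabs (f z) + cabs (g z) + 1.
have M0 : 0 < M by rewrite /M; have := cabs_ge0 (f z); have := cabs_ge0 (g z); lra.
pose e1 := Num.min 1 (e / (2 * M)).
have e10 : 0 < e1 by rewrite lt_min ltr01 divr_gt0 // mulr_gt0.
have [d1 [d10 h1]] := cf _ e10; have [d2 [d20 h2]] := cg _ e10.
exists (Num.min d1 d2); split; first by rewrite lt_min d10.
move=> w; rewrite lt_min => /andP[/h1 {}h1 /h2 {}h2].
have -> : f w * g w - f z * g z =
  (f w - f z) * (g w - g z) + ((f w - f z) * g z + f z * (g w - g z)) by ring.
apply: le_trans (cabsD _ _) _.
apply: (@le_trans _ _ (e1 * 1 + (e1 * cabs (g z) + cabs (f z) * e1))).
  apply: lerD.
    rewrite cabsM ler_pM ?cabs_ge0 //; apply: le_trans h2 _.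
    by rewrite /e1 ge_min lexx.
  apply: le_trans (cabsD _ _) _; rewrite !cabsM.
  by rewrite lerD // ?ler_wpM2r ?ler_wpM2l ?cabs_ge0.
have -> : e1 * 1 + (e1 * cabs (g z) + cabs (f z) * e1) = e1 * M.
  by rewrite /M; ring.
rewrite -ler_pdivlMr //; apply: (@le_trans _ _ (e / (2 * M))).
  by rewrite /e1 ge_min lexx orbT.
rewrite ler_pM2l // lef_pV2 ?posrE ?mulr_gt0 //; lra.
Qed.

Lemma ccont_neq0 f z : ccont f z -> f z != 0 ->
  exists d : R, 0 < d /\ forall w, cabs (w - z) < d -> cabs (f z) / 2 <= cabs (f w).
Proof.
move=> cf fz; have e0 : 0 < cabs (f z) / 2 by rewrite divr_gt0 // cabs_gt0.
have [d [d0 h]] := cf _ e0; exists d; split=> // w /h.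
by have := cabs_triangle (f z) 0 (f w); rewrite !subr0 (cabsC (f z)); lra.
Qed.

Lemma ccontV f z : ccont f z -> f z != 0 -> ccont (fun w => (f w)^-1) z.
Proof.
move=> cf fz e e0; have [d1 [d10 h1]] := ccont_neq0 cf fz.
have p0 : 0 < cabs (f z) by rewrite cabs_gt0.
have e1 : 0 < e * (cabs (f z) ^+ 2 / 2) by rewrite mulr_gt0 // divr_gt0 // exprn_gt0.
have [d2 [d20 h2]] := cf _ e1.
exists (Num.min d1 d2); split; first by rewrite lt_min d10.
move=> w; rewrite lt_min => /andP[/h1 {}h1 /h2 {}h2].
have pw : 0 < cabs (f w) by lra.
have fw : f w != 0 by rewrite -cabs_gt0.
have -> : (f w)^-1 - (f z)^-1 = (f z - f w) / (f w * f z).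
  by field; rewrite fw fz.
rewrite !cabsM cabsV cabsM cabsC ler_pdivrMr ?mulr_gt0 //.
apply: le_trans h2 _; rewrite ler_wpM2l ?(ltW e0) //; nra.
Qed.

Lemma ccont_comp f g z : ccont g z -> ccont f (g z) -> ccont (fun w => f (g w)) z.
Proof.
move=> cg cf e /cf[d [d0 h]]; have d2 : 0 < d / 2 by lra.
have [d' [d'0 h']] := cg _ d2; exists d'; split=> // w /h' {}h'.
by apply: h; lra.
Qed.

Lemma ccontN f z : ccont f z -> ccont (fun w => - f w) z.
Proof.
move=> cf; apply: (@ccont_ext (fun w => -1 * f w) _ _ 1) => //.
  by move=> w _; rewrite mulN1r.
by apply: ccontM => //; exact: ccont_cst.
Qed.

Lemma ccontB f g z : ccont f z -> ccont g z -> ccont (fun w => f w - g w) z.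
Proof. by move=> cf cg; apply: ccontD => //; exact: ccontN. Qed.

Lemma ccont_limit f z l : ccont f z ->
  (forall d, 0 < d -> exists w, [/\ cabs (w - z) < d & cabs (f w) <= l]) ->
  cabs (f z) <= l.
Proof.
move=> cf h; apply/ler_addgt0Pr => e e0; have [d [d0 hd]] := cf e e0.
have [w [/hd {}hd hw]] := h d d0.
by have := cabs_triangle (f z) 0 (f w); rewrite !subr0 (cabsC (f z)); lra.
Qed.

Definition dquot (f : C -> C) (z d w : C) : C :=
  if w == z then d else (f w - f z) / (w - z).

Lemma dquotE f z d w : f w = f z + dquot f z d w * (w - z).
Proof.
rewrite /dquot; case: eqVneq => [->|h]; first by rewrite subrr mulr0 addr0.
by field; rewrite subr_eq0.
Qed.

Lemma dquot_diag f z d : dquot f z d z = d. Proof. by rewrite /dquot eqxx. Qed.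

Lemma dquot_neq f z d w : w != z -> dquot f z d w = (f w - f z) / (w - z).
Proof. by rewrite /dquot => /negPf ->. Qed.

(** Differentiability in the form of Caratheodory: the quotient completed by [d] is continuous. Sum,
    product, inverse and chain rules then reduce to algebraic identities between quotients. *)
Definition cdiff (f : C -> C) (z d : C) : Prop := ccont (dquot f z d) z.

Lemma cdiffP f z d : cdiff f z d <-> forall e : R, 0 < e -> exists r : R, 0 < r /\
  forall w, cabs (w - z) < r -> cabs (f w - f z - d * (w - z)) <= e * cabs (w - z).
Proof.
split=> h e e0; have [r [r0 hr]] := h e e0; exists r; split=> // w /hr.
  rewrite dquot_diag (dquotE f z d w) => {}hr.
  have -> : f z + dquot f z d w * (w - z) - f z - d * (w - z) =
    (dquot f z d w - d) * (w - z) by ring.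
  by rewrite cabsM ler_wpM2r ?cabs_ge0.
rewrite dquot_diag; have [->|wz] := eqVneq w z.
  by move=> _; rewrite dquot_diag subrr cabs0; exact: ltW.
rewrite dquot_neq // => {}hr.
have wz0 : 0 < cabs (w - z) by rewrite cabs_gt0 subr_eq0.
rewrite -(ler_pM2r wz0) -cabsM.
suff -> : ((f w - f z) / (w - z) - d) * (w - z) = f w - f z - d * (w - z) by [].
by field; rewrite subr_eq0.
Qed.

Lemma cdiff_cont f z d : cdiff f z d -> ccont f z.
Proof.
move=> h; apply: (@ccont_ext (fun w => f z + dquot f z d w * (w - z)) _ _ 1) => //.
  by move=> w _; rewrite -dquotE.
apply: ccontD; first exact: ccont_cst.
apply: ccontM => //; apply: ccontB; [exact: ccont_id|exact: ccont_cst].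
Qed.

Lemma cdiff_ext f g z d (r : R) : 0 < r ->
  (forall w, cabs (w - z) < r -> f w = g w) -> cdiff f z d -> cdiff g z d.
Proof.
move=> r0 fg; apply: (ccont_ext r0) => w hw; rewrite /dquot !fg //.
by rewrite subrr cabs0.
Qed.

Lemma cdiff_dquot f z d (r : R) (k : C -> C) : 0 < r -> ccont k z -> k z = d ->
  (forall w, cabs (w - z) < r -> f w = f z + k w * (w - z)) -> cdiff f z d.
Proof.
move=> r0 ck kz h; apply: (ccont_ext r0) ck => w /h hw; rewrite /dquot.
case: eqVneq => [->//|wz]; rewrite hw; field; by rewrite subr_eq0.
Qed.

Lemma cdiff_cst (k : C) z : cdiff (fun=> k) z 0.
Proof.
apply: (@cdiff_dquot _ _ _ 1 (fun=> 0)) => //; first exact: ccont_cst.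
by move=> w _; rewrite mul0r addr0.
Qed.

Lemma cdiff_id z : cdiff id z 1.
Proof.
apply: (@cdiff_dquot _ _ _ 1 (fun=> 1)) => //; first exact: ccont_cst.
by move=> w _ /=; ring.
Qed.

Lemma cdiffD f g z d e : cdiff f z d -> cdiff g z e ->
  cdiff (fun w => f w + g w) z (d + e).
Proof.
move=> hf hg.
apply: (@cdiff_dquot _ _ _ 1 (fun w => dquot f z d w + dquot g z e w)) => //.
- exact: ccontD.
- by rewrite !dquot_diag.
- by move=> w _; rewrite {1}(dquotE f z d w) {1}(dquotE g z e w); ring.
Qed.

Lemma cdiffM f g z d e : cdiff f z d -> cdiff g z e ->
  cdiff (fun w => f w * g w) z (d * g z + f z * e).
Proof.
move=> hf hg; apply: (@cdiff_dquot _ _ _ 1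
    (fun w => dquot f z d w * g w + f z * dquot g z e w)) => //.
- apply: ccontD; apply: ccontM => //; last exact: ccont_cst.
  exact: cdiff_cont hg.
- by rewrite !dquot_diag.
- move=> w _; rewrite {1}(dquotE f z d w) mulrDl.
  by rewrite {1}(dquotE g z e w); ring.
Qed.

Lemma cdiffZ (k : C) f z d : cdiff f z d -> cdiff (fun w => k * f w) z (k * d).
Proof.
by move=> hf; have := cdiffM (cdiff_cst k z) hf; rewrite mul0r add0r.
Qed.

Lemma cdiffN f z d : cdiff f z d -> cdiff (fun w => - f w) z (- d).
Proof.
move=> /(cdiffZ (-1)); rewrite mulN1r.
by apply: (@cdiff_ext _ _ _ _ 1) => // w _; rewrite mulN1r.
Qed.

Lemma cdiffB f g z d e : cdiff f z d -> cdiff g z e ->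
  cdiff (fun w => f w - g w) z (d - e).
Proof. by move=> hf /cdiffN; exact: cdiffD. Qed.

Lemma cdiffV f z d : cdiff f z d -> f z != 0 ->
  cdiff (fun w => (f w)^-1) z (- d / f z ^+ 2).
Proof.
move=> hf fz; have cf := cdiff_cont hf; have [r [r0 hr]] := ccont_neq0 cf fz.
apply: (@cdiff_dquot _ _ _ r (fun w => - dquot f z d w / (f w * f z))) => //.
- apply: ccontM; first exact: ccontN.
  apply: ccontV; last by rewrite mulf_neq0.
  by apply: ccontM => //; exact: ccont_cst.
- by rewrite dquot_diag expr2.
move=> w /hr hw; have fw : f w != 0.
  by rewrite -cabs_gt0 (lt_le_trans _ hw) // divr_gt0 // cabs_gt0.
have -> : - dquot f z d w / (f w * f z) * (w - z) =
   - (dquot f z d w * (w - z)) / (f w * f z) by ring.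
have -> : dquot f z d w * (w - z) = f w - f z by rewrite (dquotE f z d w); ring.
by field; rewrite fw fz.
Qed.

Lemma cdiff_comp f g z d e : cdiff g z e -> cdiff f (g z) d ->
  cdiff (fun w => f (g w)) z (d * e).
Proof.
move=> hg hf; apply: (@cdiff_dquot _ _ _ 1
    (fun w => dquot f (g z) d (g w) * dquot g z e w)) => //.
- by apply: ccontM => //; apply: ccont_comp hf; exact: cdiff_cont hg.
- by rewrite !dquot_diag.
- move=> w _; rewrite {1}(dquotE f (g z) d (g w)) -mulrA; congr (_ + _ * _).
  by rewrite {1}(dquotE g z e w); ring.
Qed.

Lemma derivable_cdiff (f : C -> C) (z : C) :
  derivable f z 1 -> cdiff f z (derive1 f z).
Proof.
move=> df; apply/cdiffP => e e0.
have cv : ((fun h : C => h^-1 *: (f (h + z) - f z)) @ 0^' --> derive1 f z)%classic.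
  rewrite /derive1; move: df; rewrite /derivable.
  suff -> : (fun h : C => h^-1 *: ((f \o shift z) (h *: 1) - f z)) =
    (fun h : C => h^-1 *: (f (h + z) - f z)) by [].
  by apply/funext => h /=; rewrite [h *: _]mulr1.
move/cvgrPdist_le : cv => /(_ (creal e)).
have -> : (0 < creal e :> C) by rewrite -[0]/(creal 0) ltcR.
move=> /(_ isT) /nbhs_ballP[r /= r0 hr].
(* A positive element of [cplx R] is real. *)
have [r' [r'0 hr']] : exists r' : R, 0 < r' /\ r = creal r'.
  move: r0; case: (r) => a b; rewrite ltcE /= => /andP[/eqP -> a0].
  by exists a.
exists r'; split=> // w hw; have [->|wz] := eqVneq w z.
  by rewrite !subrr mulr0 subr0 cabs0 mulr0.
have := hr (w - z); rewrite /ball /= sub0r normrN normE hr' ltcR => /(_ hw).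
rewrite subr_eq0 => /(_ wz).
rewrite subrK [X in (X <= _)%O]normE lecR => {}hr.
have -> : f w - f z - derive1 f z * (w - z) =
  - (derive1 f z - (w - z)^-1 * (f w - f z)) * (w - z).
  by field; rewrite subr_eq0.
by rewrite cabsM cabsN ler_wpM2r ?cabs_ge0.
Qed.

Lemma cdiff_derive1 (f : C -> C) (z d : C) : cdiff f z d -> derive1 f z = d.
Proof.
move=> hd; apply: cvg_lim => //; apply/cvgrPdist_le => /= e.
case: e => a b; rewrite ltcE /= => /andP[/eqP -> a0].
have [r [r0 hr]] := hd a a0.
apply/nbhs_ballP; exists (creal r) => /=; first by rewrite -[0]/(creal 0) ltcR.
move=> h; rewrite /ball /= sub0r normrN normE ltcR => hh h0.
have := hr (h + z); rewrite addrK => /(_ hh).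
rewrite dquot_diag dquot_neq; last by rewrite -subr_eq0 addrK.
rewrite addrK => hq; rewrite [X in (X <= _)%O]normE lecR cabsC; move: hq.
by rewrite /GRing.scale /= mulrC.
Qed.

End Cabs.

(** Serves the bisection arguments: [P n] is the invariant after [n] halvings, and [S n] controls
    how far the base point moves. *)
Lemma dependent_choice (T : Type) (P : nat -> T -> Prop)
    (S : nat -> T -> T -> Prop) (t0 : T) :
  P 0%N t0 -> (forall n t, P n t -> exists t', P n.+1 t' /\ S n t t') ->
  exists u : nat -> T, [/\ u 0%N = t0, forall n, P n (u n)
    & forall n, S n (u n) (u n.+1)].
Proof.
move=> P0 step.
have /choice[s hs] : forall x : nat * T, exists t',
    P x.1 x.2 -> P x.1.+1 t' /\ S x.1 x.2 t'.
  move=> [n t] /=; have [/step[t' ht']|h] := pselect (P n t); first by exists t'.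
  by exists t.
pose u := fix u n := if n is m.+1 then s (m, u m) else t0.
have Pu n : P n (u n) by elim: n => //= n IH; have [] := hs (n, u n) IH.
exists u; split=> // n; by have [] := hs (n, u n) (Pu n).
Qed.

(** * Dyadic integrals and the lemma of Goursat *)

Section Integral.
Variable R : realType.
Local Notation C := (cplx R).
Implicit Types (z w a b : C) (f : C -> C) (X : C -> Prop).

Definition mid a b : C := (a + b) / 2.

Fixpoint dsum f n a b : C :=
  if n is m.+1 then dsum f m a (mid a b) + dsum f m (mid a b) b
  else (b - a) * f (mid a b).

(* Limit of midpoint Riemann sums over dyadic subdivisions of the segment; [0] if they diverge. *)
Definition dint f a b : C := xget 0 (cconv (fun n => dsum f n a b)).

(** Midpoints are the only convex combinations formed by dyadic subdivision. *)
Definition mconvex X := forall a b, X a -> X b -> X (mid a b).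
Definition cclosed X := forall u l, (forall n : nat, X (u n)) -> cconv u l -> X l.
Definition ucont f X := forall e : R, 0 < e -> exists d : R, 0 < d /\
  forall w w', X w -> X w' -> cabs (w - w') <= d -> cabs (f w - f w') <= e.

Lemma ucont_sub f X Y : (forall w, Y w -> X w) -> ucont f X -> ucont f Y.
Proof.
by move=> YX h e /h[d [d0 hd]]; exists d; split=> // w w' /YX hw /YX; exact: hd.
Qed.

Lemma two_neq0 : (2 : C) != 0. Proof. by rewrite pnatr_eq0. Qed.

Lemma midC a b : mid a b = mid b a. Proof. by rewrite /mid addrC. Qed.

Lemma mid_subr a b : b - mid a b = (b - a) / 2.
Proof. by rewrite /mid; field. Qed.

Lemma mid_subl a b : mid a b - a = (b - a) / 2.
Proof. by rewrite /mid; field. Qed.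

Lemma mconvexI X Y : mconvex X -> mconvex Y -> mconvex (fun w => X w /\ Y w).
Proof. by move=> hX hY a b [? ?] [? ?]; split; [exact: hX|exact: hY]. Qed.

Lemma mconvex_disc z (r : R) : mconvex (fun w => cabs (w - z) <= r).
Proof.
move=> a b ha hb.
have -> : mid a b - z = (a - z) / 2 + (b - z) / 2 by rewrite /mid; field.
by have := cabsD ((a - z) / 2) ((b - z) / 2); rewrite !cabs_half; lra.
Qed.

Lemma cclosed_disc z (r : R) : cclosed (fun w => cabs (w - z) <= r).
Proof. by move=> u l hu cu; exact: cconv_le cu hu. Qed.

Lemma mconvex_half z u (r : R) : mconvex (fun w => r <= cre (u * (w - z))).
Proof.
move=> a b ha hb.
have -> : u * (mid a b - z) = creal (2^-1) * (u * (a - z)) + creal (2^-1) * (u * (b - z)).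
  by rewrite /creal fmorphV rmorph_nat /mid; field.
rewrite raddfD; move: ha hb; case: (u * _) => x y; case: (u * _) => x' y' /=.
by rewrite !mul0r !subr0 /=; lra.
Qed.

Lemma cclosed_half z u (r : R) : cclosed (fun w => r <= cre (u * (w - z))).
Proof.
move=> v l hv cv; apply/ler_addgt0Pr => e e0.
have e1 : 0 < e / (cabs u + 1) by rewrite divr_gt0 // ltr_wpDl ?cabs_ge0.
have [N /(_ _ (leqnn N)) hN] := cv _ e1.
have := hv N.
have -> : u * (v N - z) = u * (l - z) + u * (v N - l) by ring.
rewrite raddfD => h; apply: (le_trans h); rewrite lerD2l.
apply: (le_trans (ler_norm _)); apply: (le_trans (cabs_Re _)); rewrite cabsM.
move: hN; rewrite ler_pdivlMr ?ltr_wpDl ?cabs_ge0 //.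
have := cabs_ge0 u; have := cabs_ge0 (v N - l); nra.
Qed.

Lemma cclosedI X Y : cclosed X -> cclosed Y -> cclosed (fun w => X w /\ Y w).
Proof.
move=> hX hY u l h cu; split; [apply: (hX u)|apply: (hY u)] => // n; by case: (h n).
Qed.

Lemma ucont_disc f z (r : R) : 0 <= r -> (forall w, cabs (w - z) <= r -> ccont f w) ->
  ucont f (fun w => cabs (w - z) <= r).
Proof.
move=> r0 cf e e0.
suff [d [d0 hd]] : exists d : R, 0 < d /\ forall w w', cabs (w - z) <= r ->
    cabs (w' - w) <= d -> cabs (f w' - f w) <= e.
  by exists d; split=> // w w' _ hw' ww'; exact: hd.
pose P A := exists d : R, 0 < d /\ forall w w' : C, A w ->
    cabs (w' - w) <= d -> cabs (f w' - f w) <= e.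
apply: (@cabs_disc_ind _ z r P) => //.
- by move=> A B AB [d [d0 hd]]; exists d; split=> // w w' /AB; exact: hd.
- move=> A B [d [d0 hd]] [d' [d'0 hd']]; exists (Num.min d d').
  split; first by rewrite lt_min d0.
  by move=> w w' [h|h]; rewrite le_min => /andP[h1 h2]; [exact: hd|exact: hd'].
- move=> w hw; have e2 : 0 < e / 2 by lra.
  have [d [d0 hd]] := cf w hw _ e2; exists (d / 2); split; first by lra.
  exists (d / 4); split; first by lra.
  move=> v v' hv hv'; have := cabs_triangle (f v') (f v) (f w).
  rewrite (cabsC (f w)); have := hd v; have := hd v'.
  have := cabs_triangle v' w v => h1 h2 h3.
  have {}h2 := h2 ltac:(lra); have {}h3 := h3 ltac:(lra); lra.
Qed.

(** The midpoint rule is exact for affine functions, so the whole error comes from the distance of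
    [f] to [al + be * w]. *)
Lemma dsum_affine X f al be (e : R) : mconvex X ->
  (forall w, X w -> cabs (f w - (al + be * w)) <= e) -> forall n a b, X a -> X b ->
  cabs (dsum f n a b - (al * (b - a) + be * (b ^+ 2 - a ^+ 2) / 2)) <= e * cabs (b - a).
Proof.
move=> cX hf; elim=> [|n IH] a b Xa Xb /=.
  have -> : (b - a) * f (mid a b) - (al * (b - a) + be * (b ^+ 2 - a ^+ 2) / 2) =
    (b - a) * (f (mid a b) - (al + be * mid a b)) by rewrite {3}/mid; field.
  by rewrite cabsM mulrC ler_wpM2r ?cabs_ge0 ?hf //; exact: cX.
have Xm := cX _ _ Xa Xb; set m := mid a b in Xm *.
have -> : dsum f n a m + dsum f n m b - (al * (b - a) + be * (b ^+ 2 - a ^+ 2) / 2) =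
  (dsum f n a m - (al * (m - a) + be * (m ^+ 2 - a ^+ 2) / 2)) +
  (dsum f n m b - (al * (b - m) + be * (b ^+ 2 - m ^+ 2) / 2)) by field.
apply: le_trans (cabsD _ _) _; have := IH _ _ Xa Xm; have := IH _ _ Xm Xb.
rewrite mid_subr mid_subl cabs_half; lra.
Qed.

Lemma dsum_refine X f (d e : R) : mconvex X ->
  (forall w w', X w -> X w' -> cabs (w - w') <= d -> cabs (f w - f w') <= e) ->
  forall m n a b, X a -> X b -> cabs (b - a) <= d * 2 ^+ m ->
  cabs (dsum f (m + n) a b - dsum f m a b) <= e * cabs (b - a).
Proof.
move=> cX hf; elim=> [|m IH] n a b Xa Xb hab.
  rewrite add0n expr0 mulr1 in hab *.
  have := @dsum_affine (fun w => X w /\ cabs (w - mid a b) <= d) f (f (mid a b)) 0 e _ _ n a b.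
  rewrite mul0r mul0r addr0 /= [f _ * _]mulrC; apply.
  - by apply: mconvexI => //; exact: mconvex_disc.
  - by move=> w [Xw hw]; rewrite mul0r addr0; apply: hf => //; exact: cX.
  - split=> //; rewrite cabsC mid_subl cabs_half; have := cabs_ge0 (b - a); lra.
  - split=> //; rewrite mid_subr cabs_half; have := cabs_ge0 (b - a); lra.
have Xm := cX _ _ Xa Xb; rewrite addSn /=; set x := mid a b in Xm *.
have -> : forall p q r s : C, p + q - (r + s) = (p - r) + (q - s) by move=> *; ring.
have hh : cabs ((b - a) / 2) <= d * 2 ^+ m.
  by rewrite cabs_half; move: hab; rewrite exprS; lra.
apply: le_trans (cabsD _ _) _; have := IH n a x Xa Xm; have := IH n x b Xm Xb.
rewrite (mid_subr a b : b - x = _) (mid_subl a b : x - a = _).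
by move=> /(_ hh) + /(_ hh); rewrite cabs_half; lra.
Qed.

Lemma dint_conv X f a b : mconvex X -> ucont f X -> X a -> X b ->
  cconv (fun n => dsum f n a b) (dint f a b).
Proof.
move=> cX uf Xa Xb; apply: xgetPex; apply: cauchy_cconv => e e0.
have q0 : 0 < cabs (b - a) + 1 by rewrite ltr_wpDl ?cabs_ge0.
have e1 : 0 < e / (2 * (cabs (b - a) + 1)) by rewrite divr_gt0 // mulr_gt0.
have [d [d0 hd]] := uf _ e1.
have [N hN] := exists_half_lt (divr_gt0 d0 q0).
have hab : cabs (b - a) <= d * 2 ^+ N.
  apply: (@le_trans _ _ (cabs (b - a) + 1)); first by rewrite lerDl.
  have := hN N (leqnn N); rewrite ler_pdivlMr // => h.
  by rewrite -ler_pdivrMr ?exprn_gt0 // mulrC.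
have key n : (N <= n)%N -> cabs (dsum f n a b - dsum f N a b) <= e / 2.
  move=> hn; rewrite -(subnKC hn); apply: le_trans (dsum_refine cX hd _ Xa Xb hab) _.
  rewrite invfM mulrA -mulrA ler_piMr //; first by rewrite divr_ge0 // ltW.
  by rewrite mulrC ler_pdivrMr // mul1r lerDl.
exists N => m n /key hm /key hn.
have := cabs_triangle (dsum f m a b) (dsum f n a b) (dsum f N a b).
by rewrite (cabsC (dsum f N a b)); lra.
Qed.

(** Additivity at midpoints is immediate from the recursion of [dsum], and it is all that the
    subdivision of a triangle into four requires. *)
Lemma dint_mid X f a b : mconvex X -> ucont f X -> X a -> X b ->
  dint f a b = dint f a (mid a b) + dint f (mid a b) b.
Proof.
move=> cX uf Xa Xb; have Xm := cX _ _ Xa Xb.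
apply: (@cconv_unique _ (fun n => dsum f (n + 1) a b)).
  exact: cconv_shift (dint_conv cX uf Xa Xb).
have := cconvD (dint_conv cX uf Xa Xm) (dint_conv cX uf Xm Xb).
have -> : (fun n => dsum f (n + 1) a b) =
    (fun n => dsum f n a (mid a b) + dsum f n (mid a b) b).
  by apply/funext => n; rewrite addn1.
by [].
Qed.

Lemma dsum_rev f n a b : dsum f n b a = - dsum f n a b.
Proof.
elim: n a b => [|n IH] a b /=; rewrite midC; first by ring.
by rewrite IH [X in _ + X]IH; ring.
Qed.

Lemma dint_rev X f a b : mconvex X -> ucont f X -> X a -> X b ->
  dint f b a = - dint f a b.
Proof.
move=> cX uf Xa Xb; apply: (@cconv_unique _ (fun n => dsum f n b a)).
  exact: dint_conv cX uf Xb Xa.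
have := cconvN (dint_conv cX uf Xa Xb).
have -> : (fun n => dsum f n b a) = (fun n => - dsum f n a b).
  by apply/funext => n; rewrite dsum_rev.
by [].
Qed.

Lemma dint_affine X f al be (e : R) a b : mconvex X -> ucont f X ->
  (forall w, X w -> cabs (f w - (al + be * w)) <= e) -> X a -> X b ->
  cabs (dint f a b - (al * (b - a) + be * (b ^+ 2 - a ^+ 2) / 2)) <= e * cabs (b - a).
Proof.
move=> cX uf hf Xa Xb; apply: (cconv_le (dint_conv cX uf Xa Xb)) => n.
exact: dsum_affine cX hf _ _ _ Xa Xb.
Qed.

Definition dtri f a b c : C := dint f a b + dint f b c + dint f c a.

Lemma dtri_split X f a b c : mconvex X -> ucont f X -> X a -> X b -> X c ->
  dtri f a b c = dtri f a (mid a b) (mid c a) + dtri f (mid a b) b (mid b c)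
    + dtri f (mid c a) (mid b c) c + dtri f (mid a b) (mid b c) (mid c a).
Proof.
move=> cX uf Xa Xb Xc.
have Xab := cX _ _ Xa Xb; have Xbc := cX _ _ Xb Xc; have Xca := cX _ _ Xc Xa.
rewrite /dtri (dint_mid cX uf Xa Xb) (dint_mid cX uf Xb Xc) (dint_mid cX uf Xc Xa).
rewrite (dint_rev cX uf Xab Xca) (dint_rev cX uf Xab Xbc) (dint_rev cX uf Xbc Xca).
by ring.
Qed.

(** One of the four half-size triangles carries at least a quarter of the integral. Near the limit
    point [f] is affine up to a small multiple of the distance, affine functions integrate to 0
    around a triangle, and the error shrinks like [4 ^- n] times an arbitrarily small factor. *)
Lemma goursat X f a b c : mconvex X -> cclosed X -> ucont f X ->
  (forall z, X z -> exists d, cdiff f z d) -> X a -> X b -> X c ->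
  dtri f a b c = 0.
Proof.
move=> cX kX uf df Xa Xb Xc; apply/eqP; rewrite -cabs_eq0 eq_le cabs_ge0 andbT.
pose L := cabs (b - a) + cabs (c - b) + cabs (a - c).
have L0 : 0 <= L by rewrite /L !addr_ge0 ?cabs_ge0.
pose sz (t : C * C * C) (l : R) :=
  [/\ cabs (t.1.2 - t.1.1) <= l, cabs (t.2 - t.1.2) <= l & cabs (t.1.1 - t.2) <= l].
pose P n (t : C * C * C) := [/\ [/\ X t.1.1, X t.1.2 & X t.2], sz t (L / 2 ^+ n)
  & cabs (dtri f a b c) / 4 ^+ n <= cabs (dtri f t.1.1 t.1.2 t.2)].
pose S n (t t' : C * C * C) := cabs (t'.1.1 - t.1.1) <= L / 2 ^+ n.
have [|n [[x y] z] []|u [_ Pu Su]] := @dependent_choice _ P S (a, b, c).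
- split=> //; first split; rewrite /= expr0 divr1 /L;
    have := cabs_ge0 (b - a); have := cabs_ge0 (c - b); have := cabs_ge0 (a - c); lra.
- move=> [/= Xx Xy Xz] [/= s1 s2 s3] hJ.
  have Xxy := cX _ _ Xx Xy; have Xyz := cX _ _ Xy Xz; have Xzx := cX _ _ Xz Xx.
  have hL : L / 2 ^+ n.+1 = L / 2 ^+ n / 2 by rewrite exprSr invfM mulrA.
  have hL' : 0 <= L / 2 ^+ n by rewrite divr_ge0 // exprn_ge0.
  have h4 : cabs (dtri f a b c) / 4 ^+ n.+1 = cabs (dtri f a b c) / 4 ^+ n / 4.
    by rewrite exprSr invfM mulrA.
  have e1 : mid x y - mid z x = (y - z) / 2 by rewrite /mid; field.
  have e2 : mid y z - mid x y = (z - x) / 2 by rewrite /mid; field.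
  have e3 : mid z x - mid y z = (x - y) / 2 by rewrite /mid; field.
  have m1 p q : p - mid p q = (p - q) / 2 by rewrite /mid; field.
  have m2 p q : q - mid p q = (q - p) / 2 by rewrite /mid; field.
  have m3 p q : mid p q - p = (q - p) / 2 by rewrite /mid; field.
  have m4 p q : mid p q - q = (p - q) / 2 by rewrite /mid; field.
  have r1 := cabsC y x; have r2 := cabsC z y; have r3 := cabsC x z.
  move: hJ; rewrite (dtri_split cX uf Xx Xy Xz).
  set J1 := dtri f x _ _; set J2 := dtri f _ y _; set J3 := dtri f _ _ z.
  set J4 := dtri f (mid x y) (mid y z) (mid z x) => hJ.
  have [h|h1] := leP (cabs (dtri f a b c) / 4 ^+ n.+1) (cabs J1).
    exists (x, mid x y, mid z x); by split; [split; [by []|split|exact: h]|];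
      rewrite /S /= ?m1 ?m2 ?m3 ?m4 ?subrr ?cabs0 ?(cabsC (mid z x)) ?e1 ?cabs_half ?hL;
      clear - s1 s2 s3 r1 r2 r3 hL'; lra.
  have [h|h2] := leP (cabs (dtri f a b c) / 4 ^+ n.+1) (cabs J2).
    exists (mid x y, y, mid y z); by split; [split; [by []|split|exact: h]|];
      rewrite /S /= ?m1 ?m2 ?m3 ?m4 ?subrr ?cabs0 ?(cabsC (mid x y) (mid y z)) ?e2 ?cabs_half ?hL;
      clear - s1 s2 s3 r1 r2 r3 hL'; lra.
  have [h|h3] := leP (cabs (dtri f a b c) / 4 ^+ n.+1) (cabs J3).
    exists (mid z x, mid y z, z); by split; [split; [by []|split|exact: h]|];
      rewrite /S /= ?m1 ?m2 ?m3 ?m4 ?subrr ?cabs0 ?(cabsC (mid y z) (mid z x)) ?e3 ?cabs_half ?hL;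
      clear - s1 s2 s3 r1 r2 r3 hL'; lra.
  have [h|h4'] := leP (cabs (dtri f a b c) / 4 ^+ n.+1) (cabs J4).
    exists (mid x y, mid y z, mid z x); by split; [split; [by []|split|exact: h]|];
      rewrite /S /= ?m1 ?m2 ?m3 ?m4 ?subrr ?cabs0 ?e1 ?e2 ?e3 ?cabs_half ?hL;
      clear - s1 s2 s3 r1 r2 r3 hL'; lra.
  have := cabsD (J1 + J2 + J3) J4; have := cabsD (J1 + J2) J3; have := cabsD J1 J2.
  move: h1 h2 h3 h4' hJ; rewrite h4; lra.
have [p [cp hp]] := geom_cauchy Su.
have Xp : X p by apply: kX cp => n; have [[]] := Pu n.
have [d /cdiffP dp] := df p Xp.
apply/ler_addgt0Pr => e e0; rewrite add0r.
(* Each of three sides of length at most [l] contributes at most [3 * e' * l ^+ 2], which makes 9;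
   the 1 keeps the denominator positive when [L = 0]. *)
have q0 : 0 < 9 * L ^+ 2 + 1 by rewrite ltr_wpDl // mulr_ge0 // exprn_ge0.
have [r [r0 hr]] := dp _ (divr_gt0 e0 q0).
have q1 : 0 < 3 * L + 1 by lra.
have [n /(_ n (leqnn n)) hn] := exists_half_lt (divr_gt0 r0 q1).
have pn : 0 < (2 ^+ n)^-1 :> R by rewrite invr_gt0 exprn_gt0.
have hn' : 3 * (L / 2 ^+ n) < r.
  by move: hn; rewrite ler_pdivlMr //; lra.
have := hp n; have [[Xx Xy Xz] [s1 s2 s3] hJ] := Pu n.
move: Xx Xy Xz s1 s2 s3 hJ; case: (u n) => [[x y] z] /= Xx Xy Xz s1 s2 s3 hJ hxp.
set l := L / 2 ^+ n in s1 s2 s3 hxp hn' *.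
have l0 : 0 <= l by rewrite /l mulr_ge0 // ltW.
have {}hxp : cabs (x - p) <= 2 * l by rewrite /l mulrA.
pose Y w := X w /\ cabs (w - p) <= 3 * l.
have cY : mconvex Y by apply: mconvexI => //; exact: mconvex_disc.
have uY : ucont f Y by apply: ucont_sub uf => w [].
pose e' := e / (9 * L ^+ 2 + 1).
have hY w : Y w -> cabs (f w - (f p - d * p + d * w)) <= e' * (3 * l).
  move=> [_ hw]; have := hr w (le_lt_trans hw hn').
  have -> : f w - f p - d * (w - p) = f w - (f p - d * p + d * w) by ring.
  move/le_trans; apply; rewrite ler_wpM2l // divr_ge0 //; exact: ltW.
have Yx : Y x by split=> //; lra.
have Yy : Y y by split=> //; have := cabs_triangle y p x; lra.
have Yz : Y z.
  by split=> //; have := cabs_triangle z p x; rewrite (cabsC z x); lra.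
have b1 := dint_affine cY uY hY Yx Yy.
have b2 := dint_affine cY uY hY Yy Yz.
have b3 := dint_affine cY uY hY Yz Yx.
have e'0 : 0 <= e' * (3 * l) by rewrite mulr_ge0 ?divr_ge0 ?mulr_ge0 // ltW.
have {}b1 := le_trans b1 (ler_wpM2l e'0 s1).
have {}b2 := le_trans b2 (ler_wpM2l e'0 s2).
have {}b3 := le_trans b3 (ler_wpM2l e'0 s3).
move: b1 b2 b3; set i1 := _ - _; set i2 := _ - _; set i3 := _ - _ => b1 b2 b3.
(* The affine main terms cancel around the triangle. *)
have eJ : dtri f x y z = i1 + i2 + i3 by rewrite /dtri /i1 /i2 /i3; field.
have : cabs (dtri f a b c) / 4 ^+ n <= 9 * e' * l ^+ 2.
  apply: le_trans hJ _; rewrite eJ; have := cabsD (i1 + i2) i3; have := cabsD i1 i2.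
  rewrite expr2; lra.
have -> : 9 * e' * l ^+ 2 = 9 * e' * L ^+ 2 / 4 ^+ n.
  rewrite /l exprMn exprVn -exprM mulnC exprM mulrA; congr (_ / _ ^+ _).
  by rewrite expr2 -natrM.
rewrite ler_pM2r ?invr_gt0 ?exprn_gt0 // => /le_trans; apply.
rewrite /e' mulrAC mulrA ler_pdivrMr // mulrDr mulr1; nra.
Qed.

(** The exceptional point [e] is taken as base point of the integral, so that only triangles with
    vertex [e] have to be handled. *)
Lemma primitive_punctured f c e (r : R) : cabs (e - c) < r ->
  (forall z, cabs (z - c) < r -> ccont f z) ->
  (forall z, cabs (z - c) < r -> z != e -> exists d, cdiff f z d) ->
  exists F, forall z, cabs (z - c) < r -> cdiff F z (f z).
Proof.
move=> he cf df; exists (dint f e).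
have disc_u s : 0 <= s -> s < r -> ucont f (fun w => cabs (w - c) <= s).
  move=> s0 sr; apply: ucont_disc => // w hw; exact: cf (le_lt_trans hw sr).
(* Of the four subtriangles only the one at [e] contains the exceptional point; the others vanish by
   [goursat]. Iterating, the integral is at most [M] times a perimeter that is halved each time. The
   half-plane condition lets a convex set separate the other three triangles from [e]. *)
have tri0 s u : cabs (e - c) <= s -> s < r -> forall x y, cabs (x - c) <= s -> cabs (y - c) <= s ->
    0 < cre (u * (x - e)) -> 0 < cre (u * (y - e)) -> dtri f e x y = 0.
  move=> es sr; have s0 := le_trans (cabs_ge0 _) es.
  have uf := disc_u s s0 sr; have cs := @mconvex_disc c s.
  have [M [M0 hM]] : exists M : R, 0 <= M /\ forall w, cabs (w - c) <= s -> cabs (f w) <= M.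
    pose P A := exists M : R, 0 <= M /\ forall w : C, A w -> cabs (f w) <= M.
    apply: (@cabs_disc_ind _ c s P) => //.
    - by move=> A B AB [M [M0 hM]]; exists M; split=> // w /AB; exact: hM.
    - move=> A B [M [M0 hM]] [M' [M'0 hM']]; exists (M + M'); split; first by lra.
      by move=> w [/hM|/hM']; lra.
    - move=> w hw; have [d [d0 hd]] := cf w (le_lt_trans hw sr) 1 ltr01.
      exists d; split=> //; exists (cabs (f w) + 1); split; first by rewrite addr_ge0 ?cabs_ge0.
      by move=> v /hd; have := cabs_triangle (f v) 0 (f w); rewrite !subr0; lra.
  have main n x y : cabs (x - c) <= s -> cabs (y - c) <= s ->
      0 < cre (u * (x - e)) -> 0 < cre (u * (y - e)) ->
      cabs (dtri f e x y) <= M * (cabs (x - e) + cabs (y - x) + cabs (e - y)) / 2 ^+ n.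
    elim: n x y => [|n IH] x y hx hy ux uy.
      have hM' w : cabs (w - c) <= s -> cabs (f w - (0 + 0 * w)) <= M.
        by move=> /hM; rewrite mul0r addr0 subr0.
      have := dint_affine cs uf hM' es hx; have := dint_affine cs uf hM' hx hy.
      have := dint_affine cs uf hM' hy es; rewrite !mul0r !addr0 !subr0 expr0 divr1.
      have := cabsD (dint f e x + dint f x y) (dint f y e).
      have := cabsD (dint f e x) (dint f x y); rewrite /dtri; lra.
    pose dl := Num.min (cre (u * (x - e))) (cre (u * (y - e))) / 2.
    have dl0 : 0 < dl by rewrite divr_gt0 // lt_min ux.
    pose Y w := cabs (w - c) <= s /\ dl <= cre (u * (w - e)).
    have cY : mconvex Y by apply: mconvexI => //; exact: mconvex_half.
    have kY : cclosed Y by apply: cclosedI; [exact: cclosed_disc|exact: cclosed_half].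
    have uY : ucont f Y by apply: ucont_sub uf => w [].
    have dY z : Y z -> exists d, cdiff f z d.
      move=> [hz uz]; apply: df; first exact: le_lt_trans hz sr.
      apply/eqP => ze; move: uz; rewrite ze subrr mulr0 /=; lra.
    have half p : cre (u * (mid e p - e)) = cre (u * (p - e)) / 2.
      have -> : u * (mid e p - e) = creal (2^-1) * (u * (p - e)).
        by rewrite mid_subl /creal fmorphV rmorph_nat; field.
      by case: (u * _) => q t /=; rewrite mul0r subr0; lra.
    have := ge_min (cre (u * (x - e))) (cre (u * (x - e))) (cre (u * (y - e))).
    have := ge_min (cre (u * (y - e))) (cre (u * (x - e))) (cre (u * (y - e))).
    rewrite !lexx orbT /= => my0 mx0.
    have lx : dl <= cre (u * (x - e)) / 2 by rewrite /dl; lra.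
    have ly : dl <= cre (u * (y - e)) / 2 by rewrite /dl; lra.
    have Yx : Y x by split=> //; lra.
    have Yy : Y y by split=> //; lra.
    have mx := cs _ _ es hx; have my := cs _ _ es hy.
    have Ymx : Y (mid e x) by split; rewrite // half.
    have Ymy : Y (mid y e) by rewrite midC; split; rewrite // half.
    have Yxy := cY _ _ Yx Yy.
    rewrite (dtri_split cs uf es hx hy) (goursat cY kY uY dY Ymx Yx Yxy).
    rewrite (goursat cY kY uY dY Ymy Yxy Yy) (goursat cY kY uY dY Ymx Yxy Ymy) !addr0.
    rewrite (midC y e); have := IH _ _ mx my; rewrite !half => h.
    have {}h := h ltac:(lra) ltac:(lra); apply: le_trans h _.
    have -> : mid e y - mid e x = (y - x) / 2 by rewrite /mid; field.
    rewrite (cabsC e (mid e y)) !mid_subl (cabsC e y) !cabs_half.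
    rewrite exprS invfM mulrA ler_wpM2r ?invr_ge0 ?exprn_ge0 //; lra.
  move=> x y hx hy ux uy; apply/eqP; rewrite -cabs_eq0 eq_le cabs_ge0 andbT.
  have K0 : 0 <= M * (cabs (x - e) + cabs (y - x) + cabs (e - y)).
    by rewrite mulr_ge0 ?addr_ge0 ?cabs_ge0.
  apply/ler_addgt0Pr => t t0; rewrite add0r.
  have q0 : 0 < M * (cabs (x - e) + cabs (y - x) + cabs (e - y)) + 1 by lra.
  have [n /(_ n (leqnn n)) hn] := exists_half_lt (divr_gt0 t0 q0).
  apply: le_trans (main n x y hx hy ux uy) _; move: hn; rewrite ler_pdivlMr //.
  have : 0 < (2 ^+ n)^-1 :> R by rewrite invr_gt0 exprn_gt0.
  nra.
have incr z : cabs (z - c) < r -> exists d : R, 0 < d /\ forall w, cabs (w - z) < d ->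
    dint f e w - dint f e z = dint f z w.
  move=> hz; pose s := (Num.max (cabs (z - c)) (cabs (e - c)) + r) / 2.
  have hm : Num.max (cabs (z - c)) (cabs (e - c)) < r by rewrite gt_max hz.
  have zm : cabs (z - c) <= Num.max (cabs (z - c)) (cabs (e - c)) by rewrite le_max lexx.
  have em : cabs (e - c) <= Num.max (cabs (z - c)) (cabs (e - c)) by rewrite le_max lexx orbT.
  have sr : s < r by rewrite /s; lra.
  have s0 : 0 <= s by have := cabs_ge0 (z - c); rewrite /s; lra.
  have uf := disc_u s s0 sr; have cs := @mconvex_disc c s.
  have es : cabs (e - c) <= s by rewrite /s; lra.
  have zs : cabs (z - c) <= s by rewrite /s; lra.
  have zs' : 0 < s - cabs (z - c) by rewrite /s; lra.
  have [ze|ze] := eqVneq z e.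
    exists 1; split=> // w _; rewrite ze.
    have := dint_rev cs uf es es => h.
    suff -> : dint f e e = 0 by rewrite subr0.
    have h2 : 2 * dint f e e = 0 by rewrite mulr_natl mulr2n {1}h addNr.
    by move/eqP: h2; rewrite mulf_eq0 (negPf two_neq0) /= => /eqP.
  have ze0 : 0 < cabs (z - e) by rewrite cabs_gt0 subr_eq0.
  exists (Num.min (s - cabs (z - c)) (cabs (z - e))); split; first by rewrite lt_min zs'.
  move=> w; rewrite lt_min => /andP[h1 h2].
  have ws : cabs (w - c) <= s by have := cabs_triangle w c z; lra.
  have zeC : z - e != 0 by rewrite subr_eq0.
  (* This [u] turns [u * (z - e)] into 1, so every [w] with [|w - z| < |z - e|] lies in the
     half-plane. *)
  have := tri0 s (z - e)^-1 es sr z w zs ws.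
  rewrite mulVf //=.
  have -> : (z - e)^-1 * (w - e) = 1 + (z - e)^-1 * (w - z) by field.
  move=> /(_ ltr01) h.
  have : dtri f e z w = 0.
    apply: h; rewrite raddfD /=.
    have : `|cre ((z - e)^-1 * (w - z))| < 1.
      apply: le_lt_trans (cabs_Re _) _; rewrite cabsM cabsV mulrC ltr_pdivrMr //.
      by rewrite mul1r.
    by rewrite ltr_norml => /andP[]; lra.
  rewrite /dtri (dint_rev cs uf es ws) => h0.
  have -> : dint f z w = (dint f e z + dint f z w - dint f e w) + (dint f e w - dint f e z) by ring.
  by rewrite h0 add0r.
move=> z hz; apply/cdiffP => t t0.
have [d [d0 hd]] := incr z hz; have [d' [d'0 hd']] := cf z hz t t0.
pose q := (r - cabs (z - c)) / 2.
have q0 : 0 < q by rewrite /q; lra.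
exists (Num.min d (Num.min d' q)); split; first by rewrite !lt_min d0 d'0.
move=> w; rewrite !lt_min => /andP[/hd -> /andP[h2 h3]].
pose X v := cabs (v - z) <= cabs (w - z).
have cX : mconvex X by exact: mconvex_disc.
have uX : ucont f X.
  apply: ucont_disc; first exact: cabs_ge0.
  move=> v hv; apply: cf; have := cabs_triangle v c z; rewrite /q in h3; lra.
have := @dint_affine X f (f z) 0 t z w cX uX.
rewrite !mul0r addr0; apply; last by rewrite /X lexx.
- move=> v hv; rewrite mul0r addr0; apply: hd'; exact: le_lt_trans hv h2.
- by rewrite /X subrr cabs0 cabs_ge0.
Qed.

End Integral.

(** * Maximum principle and Cauchy estimates *)

Section Holomorphic.
Variable R : realType.
Local Notation C := (cplx R).
Implicit Types (z w a b : C) (f : C -> C) (X : C -> Prop).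

Lemma addr_subl z w : z + w - z = w.
Proof. by rewrite addrC addKr. Qed.

(** Bisection again: one half of the segment keeps at least half of the defect. At the limit point
    the derivative is within [eps] of [al], which bounds the ratio of defect to length. *)
Lemma mean_value X F f al (eps : R) a b : mconvex X -> cclosed X ->
  (forall z, X z -> cdiff F z (f z)) -> (forall z, X z -> cabs (f z - al) <= eps) ->
  X a -> X b -> cabs (F b - F a - al * (b - a)) <= eps * cabs (b - a).
Proof.
move=> cX kX dF hf Xa Xb.
pose L := cabs (b - a).
pose N x y := cabs (F y - F x - al * (y - x)).
pose P n (t : C * C) := [/\ X t.1, X t.2, cabs (t.2 - t.1) <= L / 2 ^+ n
  & N a b / 2 ^+ n <= N t.1 t.2].
pose S n (t t' : C * C) := cabs (t'.1 - t.1) <= L / 2 ^+ n.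
have L0 : 0 <= L by exact: cabs_ge0.
have [|n [x y] []|u [_ Pu Su]] := @dependent_choice _ P S (a, b).
- by split=> //=; rewrite expr0 divr1.
- move=> /= Xx Xy s1 hN; have Xm := cX _ _ Xx Xy.
  have hL : L / 2 ^+ n.+1 = L / 2 ^+ n / 2 by rewrite exprSr invfM mulrA.
  have hL' : 0 <= L / 2 ^+ n by rewrite divr_ge0 // exprn_ge0.
  have hN' : N a b / 2 ^+ n.+1 = N a b / 2 ^+ n / 2 by rewrite exprSr invfM mulrA.
  have hs : N x y <= N x (mid x y) + N (mid x y) y.
    rewrite /N; apply: le_trans (cabsD _ _); rewrite le_eqVlt; apply/orP; left.
    by apply/eqP; congr cabs; ring.
  have [h|h] := leP (N a b / 2 ^+ n.+1) (N x (mid x y)).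
    exists (x, mid x y); split; last by rewrite /S /= subrr cabs0.
    by split=> //=; rewrite mid_subl cabs_half hL; lra.
  exists (mid x y, y); split; last by rewrite /S /= mid_subl cabs_half; lra.
  by split=> //=; rewrite ?mid_subr ?cabs_half; lra.
have [p [cp hp]] := geom_cauchy Su.
have Xp : X p by apply: kX cp => n; have [] := Pu n.
have /cdiffP dp := dF p Xp.
apply/ler_addgt0Pr => e e0.
(* The ends of the small segment are within [2 * l] and [3 * l] of [p], and the two remainders add
   up to the factor 5. *)
have q0 : 0 < 5 * L + 1 by lra.
have [r [r0 hr]] := dp _ (divr_gt0 e0 q0).
have q1 : 0 < 3 * L + 1 by lra.
have [n /(_ n (leqnn n)) hn] := exists_half_lt (divr_gt0 r0 q1).
have pn : 0 < (2 ^+ n)^-1 :> R by rewrite invr_gt0 exprn_gt0.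
have hn' : 3 * (L / 2 ^+ n) < r.
  by move: hn; rewrite ler_pdivlMr //; lra.
have := hp n; have := Pu n; case: (u n) => [x y] [/= Xx Xy s1 hN] hxp.
set l := L / 2 ^+ n in s1 hxp hn' *.
have l0 : 0 <= l by rewrite /l mulr_ge0 // ltW.
have {}hxp : cabs (x - p) <= 2 * l by rewrite /l mulrA.
have hyp : cabs (y - p) <= 3 * l by have := cabs_triangle y p x; lra.
have hx := hr x ltac:(lra); have hy := hr y ltac:(lra).
have e' := divr_gt0 e0 q0; set e1 := e / (5 * L + 1) in hx hy e'.
have hfp := hf p Xp.
have : N x y <= eps * l + 5 * e1 * l.
  rewrite /N.
  have -> : F y - F x - al * (y - x) = (f p - al) * (y - x) +
     ((F y - F p - f p * (y - p)) - (F x - F p - f p * (x - p))) by ring.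
  apply: le_trans (cabsD _ _) _; apply: lerD.
    by rewrite cabsM ler_pM ?cabs_ge0.
  apply: le_trans (cabsB _ _) _; move: hx hy hxp hyp.
  have := cabs_ge0 (x - p); have := cabs_ge0 (y - p); nra.
move/(le_trans hN); rewrite /l !mulrA -mulrDl ler_pM2r // -/L => /le_trans; apply.
rewrite lerD2l /e1 mulrAC ler_pdivrMr //; nra.
Qed.

Definition hol f c (r : R) := forall z, cabs (z - c) < r -> exists d, cdiff f z d.

Lemma hol_cdiff f c (r : R) z : hol f c r -> cabs (z - c) < r -> cdiff f z (derive1 f z).
Proof. by move=> hf /hf[d hd]; rewrite (cdiff_derive1 hd). Qed.

Lemma hol_cont f c (r : R) z : hol f c r -> cabs (z - c) < r -> ccont f z.
Proof. by move=> hf /(hol_cdiff hf); exact: cdiff_cont. Qed.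

Lemma hol_sub f c (r : R) c' (r' : R) : hol f c r ->
  (forall z, cabs (z - c') < r' -> cabs (z - c) < r) -> hol f c' r'.
Proof. by move=> hf h z /h; exact: hf. Qed.

Lemma hol_ext f g c (r : R) : hol f c r -> (forall z, cabs (z - c) < r -> f z = g z) ->
  hol g c r.
Proof.
move=> hf fg z hz; have [d hd] := hf z hz; exists d.
apply: (@cdiff_ext _ f _ _ _ (r - cabs (z - c))) hd; first by lra.
by move=> w hw; apply: fg; have := cabs_triangle w c z; lra.
Qed.

Lemma hol_cst (k : C) c (r : R) : hol (fun=> k) c r.
Proof. by move=> z _; exists 0; exact: cdiff_cst. Qed.
Lemma hol_id c (r : R) : hol id c r.
Proof. by move=> z _; exists 1; exact: cdiff_id. Qed.
Lemma holD f g c (r : R) : hol f c r -> hol g c r -> hol (fun w => f w + g w) c r.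
Proof. by move=> hf hg z hz; eexists; apply: cdiffD; apply: hol_cdiff hz. Qed.
Lemma holB f g c (r : R) : hol f c r -> hol g c r -> hol (fun w => f w - g w) c r.
Proof. by move=> hf hg z hz; eexists; apply: cdiffB; apply: hol_cdiff hz. Qed.
Lemma holM f g c (r : R) : hol f c r -> hol g c r -> hol (fun w => f w * g w) c r.
Proof. by move=> hf hg z hz; eexists; apply: cdiffM; apply: hol_cdiff hz. Qed.
Lemma holV f c (r : R) : hol f c r -> (forall z, cabs (z - c) < r -> f z != 0) ->
  hol (fun w => (f w)^-1) c r.
Proof.
by move=> hf f0 z hz; eexists; apply: cdiffV (f0 z hz); apply: hol_cdiff hz.
Qed.
Lemma holX f c (r : R) n : hol f c r -> hol (fun w => f w ^+ n) c r.
Proof.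
move=> hf; elim: n => [|n IH].
  by apply: (@hol_ext (fun=> 1)); [exact: hol_cst|move=> z _; rewrite expr0].
by apply: hol_ext (holM hf IH) _ => z _; rewrite exprS.
Qed.
Lemma hol_shift f c (r : R) h : hol f c r -> hol (fun w => f (w + h)) c (r - cabs h).
Proof.
move=> hf z hz; have [|d hd] := hf (z + h).
  have -> : z + h - c = (z - c) + h by ring.
  by have := cabsD (z - c) h; lra.
exists (d * (1 + 0)); apply: (@cdiff_comp _ f (fun w => w + h)) hd.
exact: cdiffD (cdiff_id _) (cdiff_cst _ _).
Qed.

Lemma cdiff_shift f z d h : cdiff f (z + h) d -> cdiff (fun w => f (w + h)) z d.
Proof.
move=> hd; have := @cdiff_comp _ f (fun w => w + h) z d (1 + 0) _ hd.
rewrite addr0 mulr1; apply.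
by rewrite -[X in cdiff _ _ X]addr0; exact: cdiffD (cdiff_id _) (cdiff_cst _ _).
Qed.

Lemma bounded_on_disc f c (s : R) : 0 <= s -> (forall z, cabs (z - c) <= s -> ccont f z) ->
  exists M : R, 0 <= M /\ forall w, cabs (w - c) <= s -> cabs (f w) <= M.
Proof.
move=> s0 cf.
pose P A := exists M : R, 0 <= M /\ forall w : C, A w -> cabs (f w) <= M.
apply: (@cabs_disc_ind _ c s P) => //.
- by move=> A B AB [M [M0 hM]]; exists M; split=> // w /AB; exact: hM.
- move=> A B [M [M0 hM]] [M' [M'0 hM']]; exists (M + M'); split; first by lra.
  by move=> w [/hM|/hM']; lra.
- move=> w hw; have [d [d0 hd]] := cf w hw 1 ltr01.
  exists d; split=> //; exists (cabs (f w) + 1); split; first by rewrite addr_ge0 ?cabs_ge0.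
  by move=> v /hd; have := cabs_triangle (f v) 0 (f w); rewrite !subr0; lra.
Qed.

Lemma max_on_disc (u : C -> R) c (s : R) : 0 <= s ->
  (forall z, cabs (z - c) <= s -> forall e : R, 0 < e -> exists d : R, 0 < d /\
     forall w, cabs (w - z) < d -> `|u w - u z| <= e) ->
  exists p, cabs (p - c) <= s /\ forall w, cabs (w - c) <= s -> u w <= u p.
Proof.
move=> s0 cu.
have [M hM] : exists M : R, forall w, cabs (w - c) <= s -> u w <= M.
  pose P A := exists M : R, forall w : C, A w -> u w <= M.
  apply: (@cabs_disc_ind _ c s P) => //.
  - by move=> A B AB [M hM]; exists M => w /AB; exact: hM.
  - move=> A B [M hM] [M' hM']; exists (Num.max M M') => w [/hM|/hM'] h.
      by rewrite le_max h.
    by rewrite le_max h orbT.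
  - move=> w hw; have [d [d0 hd]] := cu w hw 1 ltr01.
    exists d; split=> //; exists (u w + 1) => v /hd.
    by rewrite ler_norml => /andP[]; lra.
pose E : set R := fun x => exists2 w, cabs (w - c) <= s & x = u w.
have hE : has_sup E.
  split; first by exists (u c), c => //; rewrite subrr cabs0.
  by exists M => x [w hw ->]; exact: hM.
apply: contrapT => np.
have lt_sup w : cabs (w - c) <= s -> u w < sup E.
  move=> hw; rewrite lt_neqAle; apply/andP; split; last first.
    by apply: ub_le_sup; [case: hE|exists w].
  apply/eqP => uw; apply: np; exists w; split=> // v hv; rewrite uw.
  by apply: ub_le_sup; [case: hE|exists v].
pose P A := exists y : R, 0 < y /\ forall w : C, A w -> cabs (w - c) <= s -> u w <= sup E - y.
have [y [y0 hy]] : P (fun z => cabs (z - c) <= s).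
  apply: (@cabs_disc_ind _ c s P) => //.
  - by move=> A B AB [M' [M0 hM']]; exists M'; split=> // w /AB; exact: hM'.
  - move=> A B [M1 [M10 h1]] [M2 [M20 h2]]; exists (Num.min M1 M2).
    split; first by rewrite lt_min M10.
    have m1 : Num.min M1 M2 <= M1 by rewrite ge_min lexx.
    have m2 : Num.min M1 M2 <= M2 by rewrite ge_min lexx orbT.
    by move=> w [/h1|/h2] h /h; lra.
  - move=> w hw; have y0 : 0 < (sup E - u w) / 2 by have := lt_sup w hw; lra.
    have [d [d0 hd]] := cu w hw _ y0; exists d; split=> //.
    exists ((sup E - u w) / 2); split=> // v /hd + _.
    by rewrite ler_norml => /andP[]; lra.
have : sup E <= sup E - y.
  by apply: ge_sup; [case: hE|move=> x [w hw ->]; exact: hy].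
by lra.
Qed.

(** The maximum principle is a predicate because it is obtained in stages: for functions with two
    known derivatives, then carried from increments to derivatives. *)
Definition maxp f c (r : R) := forall s M : R, 0 < s -> s < r ->
  (forall w, cabs (w - c) = s -> cabs (f w) <= M) ->
  forall z, cabs (z - c) <= s -> cabs (f z) <= M.

Lemma sqr_cabs z : cabs z ^+ 2 = cre z ^+ 2 + cim z ^+ 2.
Proof. by case: z => x y; rewrite /cabs /= sqr_sqrtr // addr_ge0 ?sqr_ge0. Qed.

(* Averaging F over the four points p + t, p - t, p + it, p - it kills the Taylor terms of
   order 1 and 2, while |z|^2 gains t^2; so Re F + eps |z|^2 has no interior maximum. *)
Lemma maxp_twice F G g c (r : R) :
  (forall z, cabs (z - c) < r -> cdiff F z (G z)) ->
  (forall z, cabs (z - c) < r -> cdiff G z (g z)) -> maxp F c r.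
Proof.
move=> dF dG s M s0 sr hM z0 hz0; rewrite leNgt; apply/negP => Mlt.
have M0 : 0 <= M.
  apply: le_trans (cabs_ge0 _) (hM (c + creal s) _).
  by rewrite addr_subl cabs_creal gtr0_norm.
pose F0 := cabs (F z0); have F00 : 0 < F0 by rewrite /F0; lra.
have Fz0 : F z0 != 0 by rewrite -cabs_gt0.
(* A rotation that makes [la * F z0] equal to its modulus, so that real parts suffice. *)
pose la : C := creal F0 / F z0.
have la1 : cabs la = 1.
  by rewrite /la cabsM cabsV cabs_creal gtr0_norm // mulfV // lt0r_neq0.
have laF : la * F z0 = creal F0 by rewrite /la mulfVK.
(* On the circle [u] is then at most [M + (F0 - M) / 2 < F0], so its maximum is attained inside. *)
pose ep := (F0 - M) / (2 * s ^+ 2).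
have ss : 0 < s ^+ 2 by rewrite exprn_gt0.
have ep0 : 0 < ep by rewrite divr_gt0 ?mulr_gt0 // subr_gt0.
pose u w := cre (la * F w) + ep * cabs (w - c) ^+ 2.
have Re_le w : cre (la * F w) <= cabs (F w).
  apply: le_trans (ler_norm _) _; apply: le_trans (cabs_Re _) _.
  by rewrite cabsM la1 mul1r.
have cu z : cabs (z - c) <= s -> forall e : R, 0 < e -> exists d : R, 0 < d /\
     forall w, cabs (w - z) < d -> `|u w - u z| <= e.
  move=> hz e e0; have cF := cdiff_cont (dF z (le_lt_trans hz sr)).
  have e2 : 0 < e / 2 by lra.
  have [d [d0 hd]] := cF _ e2.
  pose B := 2 * s + 1; have B0 : 0 < B by rewrite /B; lra.
  have e3 : 0 < e / (2 * ep * B) by rewrite divr_gt0 // mulr_gt0 // mulr_gt0.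
  exists (Num.min d (Num.min 1 (e / (2 * ep * B)))).
  split; first by rewrite !lt_min d0 ltr01.
  move=> w; rewrite !lt_min => /andP[/hd {}hd /andP[h1 h2]].
  have -> : u w - u z = cre (la * (F w - F z)) + ep * (cabs (w - c) ^+ 2 - cabs (z - c) ^+ 2).
    by rewrite mulrBr raddfB /u; ring.
  apply: le_trans (ler_normD _ _) _.
  have b1 : `|cre (la * (F w - F z))| <= e / 2.
    by apply: le_trans (cabs_Re _) _; rewrite cabsM la1 mul1r.
  suff : `|ep * (cabs (w - c) ^+ 2 - cabs (z - c) ^+ 2)| <= e / 2 by lra.
  rewrite normrM (gtr0_norm ep0) subr_sqr normrM.
  have b2 : `|cabs (w - c) - cabs (z - c)| <= cabs (w - z).
    have := cabs_triangle w c z; have := cabs_triangle z c w; rewrite (cabsC z w).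
    by rewrite ler_norml => ? ?; apply/andP; split; lra.
  have b3 : `|cabs (w - c) + cabs (z - c)| <= B.
    rewrite ger0_norm ?addr_ge0 ?cabs_ge0 // /B; have := cabs_triangle w c z; lra.
  apply: (@le_trans _ _ (ep * (e / (2 * ep * B) * B))).
    by apply: (ler_wpM2l (ltW ep0)); apply: ler_pM; rewrite ?normr_ge0 //; lra.
  by rewrite le_eqVlt; apply/orP; left; apply/eqP; field; rewrite !lt0r_neq0.
have [p [hp maxu]] := max_on_disc (ltW s0) cu.
have up : F0 <= u p.
  apply: le_trans (maxu _ hz0); rewrite /u laF /= lerDl.
  by apply: (mulr_ge0 (ltW ep0)); exact: exprn_ge0 (cabs_ge0 _).
have {}hp : cabs (p - c) < s.
  rewrite lt_neqAle hp andbT; apply/eqP => eps.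
  have := hM p eps; have := Re_le p; move: up; rewrite /u eps.
  have -> : ep * s ^+ 2 = (F0 - M) / 2 by rewrite /ep; field; rewrite lt0r_neq0.
  by move: Mlt; rewrite -/F0; lra.
have pr : cabs (p - c) < r by lra.
(* With this precision each of four Taylor remainders is at most [ep / 2 * t ^+ 2]: together
   [2 * ep * t ^+ 2], against a gain of [4 * ep * t ^+ 2] from the quadratic term. *)
have /cdiffP /(_ (ep / 2)) [|d [d0 hd]] := dG p pr; first by lra.
pose t := Num.min d (s - cabs (p - c)) / 2.
have t0 : 0 < t by rewrite divr_gt0 // lt_min d0 subr_gt0.
have [td ts] : t < d /\ t < s - cabs (p - c).
  have : t < Num.min d (s - cabs (p - c)) by rewrite /t in t0 *; lra.
  by rewrite lt_min => /andP[].
have taylor h : cabs h = t ->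
    cabs (F (p + h) - F p - (G p * h + g p * h ^+ 2 / 2)) <= ep / 2 * t ^+ 2.
  move=> ht.
  have := @mean_value (fun w => cabs (w - p) <= t)
    (fun w => F w - (G p * (w - p) + g p * ((w - p) * (w - p)) / 2))
    (fun w => G w - (G p + g p * (w - p))) 0 (ep / 2 * t) p (p + h)
    (@mconvex_disc _ p t) (@cclosed_disc _ p t).
  move=> H.
  have -> : F (p + h) - F p - (G p * h + g p * h ^+ 2 / 2) =
    F (p + h) - (G p * (p + h - p) + g p * ((p + h - p) * (p + h - p)) / 2) -
      (F p - (G p * (p - p) + g p * ((p - p) * (p - p)) / 2)) - 0 * (p + h - p) by ring.
  have -> : ep / 2 * t ^+ 2 = ep / 2 * t * cabs (p + h - p) by rewrite addr_subl ht; ring.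
  apply: H; rewrite ?addr_subl ?ht ?subrr ?cabs0 ?(ltW t0) //.
  - move=> w hw; apply: cdiffB; first by apply: dF; have := cabs_triangle w c p; lra.
    have d1 : cdiff (fun w => w - p) w 1.
      by have := cdiffB (cdiff_id w) (cdiff_cst p w); rewrite subr0.
    have d2 := cdiffZ (G p) d1; have d3 := cdiffZ (g p) (cdiffM d1 d1).
    have d4 := cdiffM d3 (cdiff_cst 2^-1 w).
    have := cdiffD d2 d4; congr (cdiff _ _ _).
    by rewrite mulr0 addr0 !mul1r !mulr1; field.
  - move=> w hw; rewrite subr0.
    have := hd w (le_lt_trans hw td).
    have -> : G w - G p - g p * (w - p) = G w - (G p + g p * (w - p)) by ring.
    move/le_trans; apply; rewrite ler_wpM2l //; lra.
pose h1 : C := creal t; pose h2 : C := ('i%C : C) * creal t.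
have i2 : ('i%C : C) ^+ 2 = -1 by rewrite sqr_i.
have n1 : cabs h1 = t by rewrite cabs_creal gtr0_norm.
have n2 : cabs h2 = t.
  by rewrite cabsM cabs_creal gtr0_norm // /cabs /= expr0n /= add0r expr1n sqrtr1 mul1r.
have hh2 : h2 ^+ 2 = - h1 ^+ 2 by rewrite exprMn i2 mulN1r.
have n1' : cabs (- h1) = t by rewrite cabsN.
have n2' : cabs (- h2) = t by rewrite cabsN.
have T1 := taylor _ n1; have T2 := taylor _ n1'.
have T3 := taylor _ n2; have T4 := taylor _ n2'.
have key h : cabs h = t -> u (p + h) <= u p.
  by move=> ht; apply: maxu; have := cabs_triangle (p + h) c p; rewrite addr_subl; lra.
have K1 := key _ n1; have K2 := key _ n1'; have K3 := key _ n2; have K4 := key _ n2'.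
move: T1 T2 T3 T4; set t1 := F (p + h1) - _ - _; set t2 := F (p - h1) - _ - _.
set t3 := F (p + h2) - _ - _; set t4 := F (p - h2) - _ - _.
move=> T1 T2 T3 T4.
have sumF : F (p + h1) + F (p - h1) + F (p + h2) + F (p - h2) =
    F p + F p + F p + F p + (t1 + t2 + t3 + t4).
  by rewrite /t1 /t2 /t3 /t4 !sqrrN hh2; field.
have bound : `|cre (la * (t1 + t2 + t3 + t4))| <= 2 * ep * t ^+ 2.
  apply: le_trans (cabs_Re _) _; rewrite cabsM la1 mul1r.
  have := cabsD (t1 + t2 + t3) t4; have := cabsD (t1 + t2) t3; have := cabsD t1 t2.
  by lra.
clearbody t1 t2 t3 t4.
have sumS : cabs (p + h1 - c) ^+ 2 + cabs (p - h1 - c) ^+ 2 + cabs (p + h2 - c) ^+ 2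
   + cabs (p - h2 - c) ^+ 2 = 4 * cabs (p - c) ^+ 2 + 4 * t ^+ 2.
  rewrite !sqr_cabs /h1 /h2 /creal; case: (p) => a b; case: (c) => a' b' /=.
  by ring.
have : u (p + h1) + u (p - h1) + u (p + h2) + u (p - h2) =
    4 * u p + cre (la * (t1 + t2 + t3 + t4)) + 4 * ep * t ^+ 2.
  have e1 : cre (la * F (p + h1)) + cre (la * F (p - h1)) + cre (la * F (p + h2)) +
     cre (la * F (p - h2)) = 4 * cre (la * F p) + cre (la * (t1 + t2 + t3 + t4)).
    rewrite -!raddfD -!mulrDr sumF !mulrDr !raddfD /=; ring.
  rewrite /u; have := congr1 (fun x => ep * x) sumS; move: e1; lra.
have tt : 0 < ep * t ^+ 2 by rewrite mulr_gt0 // exprn_gt0.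
move: bound; rewrite ler_norml => /andP[bb _]; lra.
Qed.

(* The increments of [F] approximate [f] uniformly after division by [h]. *)
Lemma maxp_deriv F f c (r : R) :
  (forall z, cabs (z - c) < r -> cdiff F z (f z)) ->
  (forall z, cabs (z - c) < r -> ccont f z) ->
  (forall h, maxp (fun w => F (w + h) - F w) c (r - cabs h)) -> maxp f c r.
Proof.
move=> dF cf mF s M s0 sr hM z hz; apply/ler_addgt0Pr => e e0.
pose s' := (s + r) / 2; have s'r : s' < r by rewrite /s'; lra.
have s'0 : 0 <= s' by rewrite /s'; lra.
have uf : ucont f (fun w => cabs (w - c) <= s').
  by apply: ucont_disc => // w hw; apply: cf; lra.
have e2 : 0 < e / 2 by lra.
have [d [d0 hd]] := uf _ e2.
pose t := Num.min d ((r - s) / 4).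
have t0 : 0 < t by rewrite lt_min d0 /=; lra.
have td : t <= d by rewrite /t ge_min lexx.
have tr : t <= (r - s) / 4 by rewrite /t ge_min lexx orbT.
pose h : C := creal t; have ht : cabs h = t by rewrite cabs_creal gtr0_norm.
have incr w : cabs (w - c) <= s -> cabs (F (w + h) - F w - f w * h) <= e / 2 * t.
  move=> hw; have := @mean_value (fun v => cabs (v - w) <= t) F f (f w) (e / 2) w (w + h)
    (@mconvex_disc _ w t) (@cclosed_disc _ w t).
  rewrite (addrC w h) addrK subrr cabs0 ht; apply; rewrite ?lexx ?(ltW t0) //.
    by move=> v hv; apply: dF; have := cabs_triangle v c w; rewrite /s' in s'r; lra.
  move=> v hv; apply: hd; rewrite /s'; last by lra.
    by have := cabs_triangle v c w; lra.
  by lra.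
have hh : cabs (F (z + h) - F z) <= (M + e / 2) * t.
  apply: (mF h s ((M + e / 2) * t) s0 _ _ z hz); first by rewrite ht; lra.
  move=> w hw; have := incr w; rewrite hw lexx => /(_ isT).
  have := cabs_triangle (F (w + h) - F w) 0 (f w * h); rewrite !subr0 cabsM ht.
  have := ler_wpM2r (ltW t0) (hM w hw); lra.
have := incr z hz; have := cabs_triangle (f z * h) 0 (F (z + h) - F z).
rewrite !subr0 (cabsC (f z * h)) cabsM ht => i1 i2.
rewrite -(ler_pM2r t0); lra.
Qed.

(** A difference quotient is known to have a primitive before it is known to be differentiable at
    its centre; the maximum principle is needed for it already at that stage. *)
Definition has_primitive f c (r : R) := (forall z, cabs (z - c) < r -> ccont f z) /\
  exists F, forall z, cabs (z - c) < r -> cdiff F z (f z).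

Lemma hol_primitive f c (r : R) : hol f c r -> has_primitive f c r.
Proof.
move=> hf; split; first by move=> z; exact: hol_cont.
have [r0|r0] := ltP 0 r; last first.
  by exists f => z hz; have := cabs_ge0 (z - c); lra.
apply: (@primitive_punctured _ f c c r); first by rewrite subrr cabs0.
  by move=> z; exact: hol_cont.
by move=> z hz _; exact: hf.
Qed.

(** Take a primitive [F1] of [f] and a primitive [F2] of [F1]. Second increments of [F2] satisfy
    [maxp_twice]; two uses of [maxp_deriv] pass from them to first increments of [F1] and then to
    [f]. No integral formula is involved. *)
Lemma maxp_primitive f c (r : R) : has_primitive f c r -> maxp f c r.
Proof.
move=> [cf [F1 dF1]].
have [_ [F2 dF2]] : has_primitive F1 c r.
  by apply: hol_primitive => z hz; exists (f z); exact: dF1.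
have shift G g h r' : r' <= r -> (forall z, cabs (z - c) < r' -> cdiff G z (g z)) ->
   forall z, cabs (z - c) < r' - cabs h -> cdiff (fun w => G (w + h) - G w) z (g (z + h) - g z).
  move=> r'r dG z hz; apply: cdiffB.
    apply: cdiff_shift; apply: dG.
    have -> : z + h - c = (z - c) + h by ring.
    by have := cabsD (z - c) h; lra.
  by apply: dG; have := cabs_ge0 h; lra.
apply: (maxp_deriv dF1 cf) => h; have h0 := cabs_ge0 h.
have rr : r - cabs h <= r by lra.
apply: (@maxp_deriv (fun w => F2 (w + h) - F2 w)).
- exact: shift dF2.
- by move=> z hz; apply: cdiff_cont; apply: (shift _ f) hz.
- move=> k; apply: (@maxp_twice _ (fun w => (F1 (w + k + h) - F1 (w + k)) - (F1 (w + h) - F1 w))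
    (fun w => (f (w + k + h) - f (w + k)) - (f (w + h) - f w))).
    exact: (shift (fun w => F2 (w + h) - F2 w) (fun w => F1 (w + h) - F1 w) k _ rr (shift _ _ h r (lexx r) dF2)).
  exact: (shift (fun w => F1 (w + h) - F1 w) (fun w => f (w + h) - f w) k _ rr (shift _ _ h r (lexx r) dF1)).
Qed.

Lemma has_primitiveB f g c (r : R) : has_primitive f c r -> has_primitive g c r ->
  has_primitive (fun w => f w - g w) c r.
Proof.
move=> [cf [F dF]] [cg [G dG]]; split; first by move=> z hz; apply: ccontB; auto.
by exists (fun w => F w - G w) => z hz; apply: cdiffB; auto.
Qed.

Local Notation dq f a := (dquot f a (derive1 f a)).

Lemma dquot_primitive f c (r : R) a : hol f c r -> cabs (a - c) < r ->
  (forall z, cabs (z - c) < r -> ccont (dq f a) z) /\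
  (forall z, cabs (z - c) < r -> z != a -> exists d, cdiff (dq f a) z d).
Proof.
move=> hf ha.
have dd z : cabs (z - c) < r -> z != a -> exists d, cdiff (dq f a) z d.
  move=> hz za.
  have za0 : 0 < cabs (z - a) by rewrite cabs_gt0 subr_eq0.
  have := cdiffM (cdiffB (hol_cdiff hf hz) (cdiff_cst (f a) z))
    (cdiffV (cdiffB (cdiff_id z) (cdiff_cst a z)) (_ : z - a != 0)).
  rewrite subr_eq0 => /(_ za) hd; eexists; apply: cdiff_ext hd; first exact: za0.
  move=> w hw; rewrite dquot_neq //; apply/eqP => wa; move: hw.
  by rewrite wa cabsC ltxx.
split=> // z hz; have [->|za] := eqVneq z a; first exact: hol_cdiff hf ha.
by have [d /cdiff_cont] := dd z hz za.
Qed.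

Lemma maxp_dquot f c (r : R) a : hol f c r -> cabs (a - c) < r ->
  has_primitive (dq f a) c r.
Proof.
move=> hf ha; have [c1 c2] := dquot_primitive hf ha; split=> //.
exact: primitive_punctured ha c1 c2.
Qed.

(** On the circle the denominator is at least [s / 2] and the numerator at most [2 * M]; the maximum
    principle for the quotient carries the bound inside. At [w = a] this is the Cauchy estimate. *)
Lemma dquot_bound f c (r s M : R) a w : hol f c r -> 0 < s -> s < r ->
  (forall z, cabs (z - c) <= s -> cabs (f z) <= M) ->
  cabs (a - c) <= s / 2 -> cabs (w - c) <= s -> cabs (dq f a w) <= 4 * M / s.
Proof.
move=> hf s0 sr hM ha hw.
apply: (maxp_primitive (maxp_dquot hf _) s0 sr _ hw); first by lra.
move=> v hv.
have va : s / 2 <= cabs (v - a) by have := cabs_triangle v c a; lra.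
rewrite dquot_neq; last by rewrite -subr_eq0 -cabs_gt0; lra.
rewrite cabsM cabsV ler_pdivrMr; last by lra.
have := hM v; rewrite hv lexx => /(_ isT) hv1; have := hM a => /(_ ltac:(lra)) ha1.
have := cabsB (f v) (f a) => h1.
have M0 : 0 <= M by have := cabs_ge0 (f v); lra.
apply: (@le_trans _ _ (4 * M / s * (s / 2))).
  have -> : 4 * M / s * (s / 2) = 2 * M by field; rewrite lt0r_neq0.
  by lra.
by rewrite ler_wpM2l // divr_ge0 ?(ltW s0) // mulr_ge0.
Qed.

(** On the circle the difference of the two quotients is [(a - b) / (v - b)] times a difference of
    values of one quotient, each bounded by [dquot_bound]; the maximum principle does the rest. *)
Lemma dquot_lip f c (r s M : R) a b w : hol f c r -> 0 < s -> s < r ->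
  (forall z, cabs (z - c) <= s -> cabs (f z) <= M) ->
  cabs (a - c) <= s / 2 -> cabs (b - c) <= s / 2 -> cabs (w - c) <= s ->
  cabs (dq f a w - dq f b w) <= 16 * M / s ^+ 2 * cabs (a - b).
Proof.
move=> hf s0 sr hM ha hb hw.
have ar : cabs (a - c) < r by lra.
have br : cabs (b - c) < r by lra.
apply: (maxp_primitive (has_primitiveB (maxp_dquot hf ar) (maxp_dquot hf br)) s0 sr _ hw).
move=> v hv.
have va : s / 2 <= cabs (v - a) by have := cabs_triangle v c a; lra.
have vb : s / 2 <= cabs (v - b) by have := cabs_triangle v c b; lra.
have vaN : v - a != 0 by rewrite -cabs_gt0; lra.
have vbN : v - b != 0 by rewrite -cabs_gt0; lra.
have -> : dq f a v - dq f b v = (a - b) * (dq f a v - dq f a b) / (v - b).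
  have fb := dquotE f a (derive1 f a) b.
  have ea : dq f a v = (f v - f a) / (v - a) by rewrite dquot_neq // -subr_eq0.
  have eb : dq f b v = (f v - f b) / (v - b) by rewrite dquot_neq // -subr_eq0.
  rewrite ea eb fb.
  by field; rewrite vaN vbN.
have vs : cabs (v - c) <= s by rewrite hv.
have b1 := dquot_bound hf s0 sr hM ha vs.
have b2 : cabs (dq f a b) <= 4 * M / s by apply: (dquot_bound hf s0 sr hM ha); lra.
have b3 := cabsB (dq f a v) (dq f a b).
rewrite !cabsM cabsV mulrAC [X in _ <= X]mulrC -mulrA ler_wpM2l ?cabs_ge0 //.
have M0 : 0 <= M by apply: le_trans (cabs_ge0 (f v)) (hM v vs).
apply: (@le_trans _ _ ((s / 2)^-1 * (8 * M / s))).
  apply: ler_pM; rewrite ?invr_ge0 ?cabs_ge0 //; last by lra.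
  by rewrite lef_pV2 ?posrE; lra.
by rewrite le_eqVlt; apply/orP; left; apply/eqP; field; rewrite lt0r_neq0.
Qed.

Lemma cauchy_estimate f c (r s M : R) a : hol f c r -> 0 < s -> s < r ->
  (forall z, cabs (z - c) <= s -> cabs (f z) <= M) ->
  cabs (a - c) <= s / 2 -> cabs (derive1 f a) <= 4 * M / s.
Proof.
move=> hf s0 sr hM ha; have := @dquot_bound f c r s M a a hf s0 sr hM ha.
by rewrite dquot_diag; apply; lra.
Qed.

Lemma dquotC f a d b d' : a != b -> dquot f a d b = dquot f b d' a.
Proof.
move=> ab; rewrite !dquot_neq // 1?eq_sym // -[f b - _]opprB -[b - a]opprB.
by rewrite invrN mulrNN.
Qed.

(** The quotients [g h] converge uniformly to the derivative as [h] tends to 0. By [dquot_lip] their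
    own difference quotients at [c] are Lipschitz in the increment, with a constant independent of
    [h]. The difference quotient [Q] of the derivative inherits this bound, hence has a limit at
    0. *)
Lemma deriv_diff_center f c (r : R) : 0 < r -> hol f c r -> exists d, cdiff (derive1 f) c d.
Proof.
move=> r0 hf; pose s := r / 2.
have s0 : 0 < s by rewrite /s; lra.
have sr : s < r by rewrite /s; lra.
have [M [M0 hM]] : exists M : R, 0 <= M /\ forall w, cabs (w - c) <= s -> cabs (f w) <= M.
  by apply: bounded_on_disc; [lra|move=> z hz; apply: hol_cont hf _; lra].
pose K1 := 16 * M / s ^+ 2.
have K10 : 0 <= K1 by apply: divr_ge0; [exact: mulr_ge0|exact: exprn_ge0 (ltW s0)].
pose g h w := (f (w + h) - f w) / h.
have g_lim h w : h != 0 -> cabs h <= s / 4 -> cabs (w - c) <= s / 4 ->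
    cabs (derive1 f w - g h w) <= K1 * cabs h.
  move=> h0 hh hw.
  have wh : w + h != w by rewrite -subr_eq0 addr_subl.
  have -> : g h w = dq f (w + h) w.
    by rewrite (@dquotC f _ _ _ (derive1 f w)) // dquot_neq // /g addr_subl.
  have whc : cabs (w + h - c) <= s / 2.
    by have := cabs_triangle (w + h) c w; rewrite addr_subl; lra.
  have := @dquot_lip f c r s M w (w + h) w hf s0 sr hM.
  rewrite dquot_diag opprD addrA subrr add0r cabsN; apply; lra.
pose s1 := s / 4; have s10 : 0 < s1 by rewrite /s1; lra.
pose K := 16 * (4 * M / s) / s1 ^+ 2.
have K0 : 0 <= K.
  apply: divr_ge0; last exact: exprn_ge0 (ltW s10).
  by apply: mulr_ge0 => //; apply: divr_ge0 (ltW s0); exact: mulr_ge0.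
pose Q k := (derive1 f (c + k) - derive1 f c) / k.
have g_lip h k k' : h != 0 -> cabs h <= s / 4 -> k != 0 -> k' != 0 ->
    cabs k <= s1 / 2 -> cabs k' <= s1 / 2 ->
    cabs ((g h (c + k) - g h c) / k - (g h (c + k') - g h c) / k') <= K * cabs (k - k').
  move=> h0 hh k0 k'0 hk hk'.
  have hg : hol (g h) c (r - cabs h).
    apply: holM; last exact: hol_cst.
    apply: holB; first exact: hol_shift.
    by apply: hol_sub hf _ => z; have := cabs_ge0 h; lra.
  have gb w : cabs (w - c) <= s1 -> cabs (g h w) <= 4 * M / s.
    move=> hw; have wh : w + h != w by rewrite -subr_eq0 addr_subl.
    have -> : g h w = dq f w (w + h) by rewrite dquot_neq // /g addr_subl.
    rewrite /s1 in hw; apply: (dquot_bound hf s0 sr hM); first by lra.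
    by have := cabs_triangle (w + h) c w; rewrite addr_subl; lra.
  have Qe q : q != 0 -> (g h (c + q) - g h c) / q = dq (g h) (c + q) c.
    move=> q0; have cq : c + q != c by rewrite -subr_eq0 addr_subl.
    by rewrite (dquotC _ _ (derive1 (g h) c)) // dquot_neq // addr_subl.
  rewrite !Qe //; have -> : k - k' = (c + k) - (c + k') by ring.
  have cc q : c + q - c = q by ring.
  apply: (dquot_lip hg s10 _ gb); rewrite ?cc //; last by rewrite subrr cabs0 ltW.
  by rewrite /s1 /s; rewrite /s1 /s in hh; lra.
have Q_lip k k' : k != 0 -> k' != 0 -> cabs k <= s1 / 2 -> cabs k' <= s1 / 2 ->
    cabs (Q k - Q k') <= K * cabs (k - k').
  move=> k0 k'0 hk hk'; apply/ler_addgt0Pr => e e0.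
  have pk : 0 < cabs k by rewrite cabs_gt0.
  have pk' : 0 < cabs k' by rewrite cabs_gt0.
  pose B := 2 * K1 * ((cabs k)^-1 + (cabs k')^-1) + 1.
  have B0 : 0 < B.
    apply: ltr_wpDl => //; apply: mulr_ge0; first exact: mulr_ge0.
    by apply: addr_ge0; rewrite invr_ge0 cabs_ge0.
  pose t := Num.min (s / 4) (e / B).
  have t0 : 0 < t by rewrite lt_min; apply/andP; split; [lra|exact: divr_gt0].
  have ht : cabs (creal t) = t by rewrite cabs_creal gtr0_norm.
  have h0 : creal t != 0 by rewrite -cabs_gt0 ht.
  have h4 : cabs (creal t) <= s / 4 by rewrite ht ge_min lexx.
  have L := g_lip _ k k' h0 h4 k0 k'0 hk hk'.
  have cc q : c + q - c = q by ring.
  have e1 q : q != 0 -> cabs q <= s1 / 2 ->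
      cabs (Q q - (g (creal t) (c + q) - g (creal t) c) / q) <= 2 * K1 * t / cabs q.
    move=> q0 hq; rewrite /Q -mulrBl cabsM cabsV ler_wpM2r ?invr_ge0 ?cabs_ge0 //.
    have -> : forall x y x' y' : C, x - y - (x' - y') = (x - x') - (y - y').
      by move=> *; ring.
    apply: le_trans (cabsB _ _) _.
    have := g_lim _ (c + q) h0 h4; rewrite cc ht => /(_ ltac:(rewrite /s1 in hq; lra)).
    have := g_lim _ c h0 h4; rewrite subrr cabs0 ht => /(_ ltac:(lra)); lra.
  have E1 := e1 _ k0 hk; have E2 := e1 _ k'0 hk'.
  have te : t * B <= e by rewrite -ler_pdivlMr // /t ge_min lexx orbT.
  move: L E1 E2; set x := (_ - _) / k; set y := (_ - _) / k' => L E1 E2.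
  have : 2 * K1 * t / cabs k + 2 * K1 * t / cabs k' <= e.
    by apply: le_trans te; rewrite /B; lra.
  have := cabs_triangle (Q k) (Q k') x; have := cabs_triangle x (Q k') y.
  rewrite (cabsC y); lra.
have s12 : 0 < s1 / 2 by lra.
pose k n : C := creal (s1 / 2 / 2 ^+ n).
have kn n : cabs (k n) = s1 / 2 / 2 ^+ n.
  by rewrite cabs_creal gtr0_norm // divr_gt0 // exprn_gt0.
have kn0 n : k n != 0 by rewrite -cabs_gt0 kn divr_gt0 // exprn_gt0.
have kn1 n : cabs (k n) <= s1 / 2.
  rewrite kn ler_pdivrMr ?exprn_gt0 // ler_pMr //.
  by rewrite exprn_ege1 // ler1n.
have [l hl] : exists l, cconv (fun n => Q (k n)) l.
  apply: cauchy_cconv => e e0.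
  have q0 : 0 < e / (K * s1 + 1) by rewrite divr_gt0 // ltr_wpDl // mulr_ge0 // ltW.
  have [N hN] := exists_half_lt q0; exists N => m n hm hn.
  apply: le_trans (Q_lip _ _ (kn0 _) (kn0 _) (kn1 _) (kn1 _)) _.
  apply: (@le_trans _ _ (K * s1 * (e / (K * s1 + 1)))).
    rewrite -mulrA ler_wpM2l //; apply: le_trans (cabsB _ _) _; rewrite !kn.
    have := ler_wpM2l (ltW s10) (hN m hm); have := ler_wpM2l (ltW s10) (hN n hn); lra.
  have B0 : 0 < K * s1 + 1 by apply: ltr_wpDl => //; exact: mulr_ge0 (ltW s10).
  by rewrite mulrCA ger_pMr // ler_pdivrMr // mul1r lerDl.
exists l => e e0.
pose d := Num.min (s1 / 2) (e / (2 * K + 1)).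
have B0 : 0 < 2 * K + 1 by lra.
exists d; split; first by rewrite lt_min s12 divr_gt0.
move=> w; rewrite lt_min => /andP[h1 h2]; rewrite dquot_diag.
have [->|wc] := eqVneq w c; first by rewrite dquot_diag subrr cabs0 ltW.
have wc0 : w - c != 0 by rewrite subr_eq0.
have pw : 0 < cabs (w - c) by rewrite cabs_gt0.
have -> : dquot (derive1 f) c l w = Q (w - c).
  have e1 : c + (w - c) = w by ring.
  by rewrite /Q e1 dquot_neq.
rewrite cabsC; apply: (@le_trans _ _ (2 * K * cabs (w - c))).
  have [N hN] := exists_half_lt (divr_gt0 pw s12).
  apply: (cconv_le (cconv_shift N hl)) => n.
  apply: le_trans (Q_lip _ _ (kn0 _) wc0 (kn1 _) (ltW h1)) _.
  suff h3 : cabs (k (n + N)%N - (w - c)) <= 2 * cabs (w - c).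
    by have := ler_wpM2l K0 h3; lra.
  apply: le_trans (cabsB _ _) _.
  suff : cabs (k (n + N)%N) <= cabs (w - c) by lra.
  have := hN _ (leq_addl n N); rewrite kn ler_pdivlMr // mulrC; lra.
by move: h2; rewrite ltr_pdivlMr //; lra.
Qed.

Lemma hol_deriv f c (r : R) : hol f c r -> hol (derive1 f) c r.
Proof.
move=> hf z hz; apply: (@deriv_diff_center _ _ (r - cabs (z - c))); first by lra.
by apply: hol_sub hf _ => w; have := cabs_triangle w c z; lra.
Qed.

Lemma hol_derivn f c (r : R) n : hol f c r -> hol (derive1n n f) c r.
Proof. by move=> hf; elim: n => //= n; exact: hol_deriv. Qed.

(** The theorem of Morera: [f] has a primitive, and the derivative of a holomorphic function is
    holomorphic. *)
Lemma removable f c (r : R) e : cabs (e - c) < r ->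
  (forall z, cabs (z - c) < r -> ccont f z) ->
  (forall z, cabs (z - c) < r -> z != e -> exists d, cdiff f z d) -> hol f c r.
Proof.
move=> he cf df; have [F dF] := primitive_punctured he cf df.
have hF : hol F c r by move=> z hz; exists (f z); exact: dF.
apply: hol_ext (hol_deriv hF) _ => z hz; exact: cdiff_derive1 (dF z hz).
Qed.

Lemma hol_dquot f c (r : R) a : hol f c r -> cabs (a - c) < r -> hol (dq f a) c r.
Proof. by move=> hf ha; have [] := dquot_primitive hf ha; exact: removable. Qed.

Lemma hol_maxp f c (r : R) : hol f c r -> maxp f c r.
Proof. by move=> /hol_primitive /maxp_primitive. Qed.

End Holomorphic.

(** * Zeros and roots of entire functions *)

Section Orders.
Variable R : realType.
Local Notation C := (cplx R).
Implicit Types (z w a b : C) (f : C -> C).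

Lemma derive1_ext f g c (r : R) z : hol f c r -> (forall w, cabs (w - c) < r -> f w = g w) ->
  cabs (z - c) < r -> derive1 f z = derive1 g z.
Proof.
move=> hf fg hz; apply/esym/cdiff_derive1.
apply: (@cdiff_ext _ f _ _ _ (r - cabs (z - c))) (hol_cdiff hf hz); first by lra.
by move=> w hw; apply: fg; have := cabs_triangle w c z; lra.
Qed.

Lemma derive1n_ext f g c (r : R) n z : hol f c r ->
  (forall w, cabs (w - c) < r -> f w = g w) ->
  cabs (z - c) < r -> derive1n n f z = derive1n n g z.
Proof.
move=> hf fg; elim: n z => [|n IH] z hz; first exact: fg.
by rewrite !derive1nS; apply: derive1_ext (hol_derivn n hf) IH hz.
Qed.

Lemma derive1n_mulX f q c (r : R) a : hol q c r ->
  (forall z, cabs (z - c) < r -> f z = (z - a) * q z) -> forall n z, cabs (z - c) < r ->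
  derive1n n f z = (z - a) * derive1n n q z + n%:R * derive1n n.-1 q z.
Proof.
move=> hq fq.
have hf : hol f c r.
  apply: (@hol_ext _ (fun z => (z - a) * q z)); last by move=> z /fq.
  by apply: holM => //; apply: holB; [exact: hol_id|exact: hol_cst].
elim=> [|n IH] z hz; first by rewrite mul0r addr0 /=; exact: fq.
rewrite derive1nS (derive1_ext (hol_derivn n hf) IH hz).
apply: cdiff_derive1.
have h1 := hol_cdiff (hol_derivn n hq) hz.
have h2 := hol_cdiff (hol_derivn n.-1 hq) hz.
have h3 := cdiffB (cdiff_id z) (cdiff_cst a z).
have := cdiffD (cdiffM h3 h1) (cdiffZ n%:R h2); congr (cdiff _ _ _).
rewrite -!derive1nS; case: n {IH h1 h2} => [|n] /=; first by rewrite !mul0r; ring.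
rewrite -[n.+2%:R]natr1.
by move: (derive1 (derive1n n q) z) (derive1 _ z) (n.+1%:R : C) => u v k; ring.
Qed.

(** Turns vanishing derivatives into divisibility by a power, the form in which the maximum
    principle exploits a zero. *)
Lemma order_factor f c (r : R) a l : hol f c r -> cabs (a - c) < r ->
  (forall m, (m < l)%N -> derive1n m f a = 0) ->
  exists g, hol g c r /\ forall z, cabs (z - c) < r -> f z = (z - a) ^+ l * g z.
Proof.
move=> + ha; elim: l f => [|l IH] f hf h0.
  by exists f; split=> // z _; rewrite expr0 mul1r.
pose q := dquot f a (derive1 f a); have hq : hol q c r by exact: hol_dquot.
have fa : f a = 0 by exact: (h0 0%N).
have fq z : cabs (z - c) < r -> f z = (z - a) * q z.
  by move=> _; rewrite (dquotE f a (derive1 f a) z) fa add0r mulrC.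
have [m hm|g [hg gq]] := IH q hq.
  have := derive1n_mulX hq fq m.+1 ha; rewrite h0 // subrr mul0r add0r /=.
  by move/esym/eqP; rewrite mulf_eq0 pnatr_eq0 /= => /eqP.
by exists g; split=> // z hz; rewrite fq // gq // exprS mulrA.
Qed.

Lemma factor_order f g c (r : R) a l : hol g c r -> cabs (a - c) < r ->
  (forall z, cabs (z - c) < r -> f z = (z - a) ^+ l * g z) ->
  forall m, (m < l)%N -> derive1n m f a = 0.
Proof.
move=> hg ha; elim: l f => // l IH f fg m ml.
pose q z := (z - a) ^+ l * g z.
have hq : hol q c r.
  by apply: holM => //; apply: holX; apply: holB; [exact: hol_id|exact: hol_cst].
rewrite (@derive1n_mulX f q c r a) //; last by move=> z /fg ->; rewrite exprS mulrA.
rewrite subrr mul0r add0r; case: m ml => [|m] ml; first by rewrite mul0r.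
by rewrite (IH q) ?mulr0.
Qed.

Definition centire f := forall z, exists d, cdiff f z d.

Lemma entire_hol f c (r : R) : centire f -> hol f c r.
Proof. by move=> hf z _; exact: hf. Qed.

Lemma entire_cdiff f z : centire f -> cdiff f z (derive1 f z).
Proof. by move=> /(_ z)[d hd]; rewrite (cdiff_derive1 hd). Qed.

Lemma entire_cont f z : centire f -> ccont f z.
Proof. by move/entire_cdiff => h; exact: cdiff_cont (h z). Qed.

Lemma hol_entire f : (forall r : R, hol f 0 r) -> centire f.
Proof.
move=> hf z; apply: (hf (cabs z + 1)); rewrite subr0; lra.
Qed.

Lemma exp_half_small (M e : R) : 0 <= M -> 0 < e -> exists n, M / 2 ^+ n <= e.
Proof.
move=> M0 e0; have M1 : 0 < M + 1 by lra.
have [n /(_ n (leqnn n)) hn] := exists_half_lt (divr_gt0 e0 M1).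
exists n; apply: le_trans (_ : (M + 1) / 2 ^+ n <= _).
  by rewrite ler_wpM2r ?invr_ge0 ?exprn_ge0 //; lra.
by move: hn; rewrite ler_pdivlMr // mulrC.
Qed.

(** Dividing by [(z - a) ^+ n] and applying the maximum principle on a circle of radius
    [s >= 2 * |z - a|] gives [|f z| <= M / 2 ^+ n] for every [n]. *)
Lemma identity_theorem f a : centire f -> (forall m, derive1n m f a = 0) -> forall z, f z = 0.
Proof.
move=> hf h0 z; apply/eqP; rewrite -cabs_eq0 eq_le cabs_ge0 andbT.
pose s := 2 * cabs (z - a) + 1.
have za := cabs_ge0 (z - a); have s0 : 0 < s by rewrite /s; lra.
have [M [M0 hM]] : exists M : R, 0 <= M /\ forall w, cabs (w - a) <= s -> cabs (f w) <= M.
  by apply: bounded_on_disc => [|w _]; [lra|exact: entire_cont].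
apply/ler_addgt0Pr => e e0; rewrite add0r.
have [n hn] := exp_half_small M0 e0; apply: le_trans hn.
have [|g [hg gq]] := @order_factor f a (s + 1) a n (@entire_hol _ _ _ hf) _ (fun m _ => h0 m).
  by rewrite subrr cabs0; lra.
have gz : cabs (g z) <= M / s ^+ n.
  apply: (hol_maxp hg s0); [by lra| |by rewrite /s; lra].
  move=> w hw; rewrite ler_pdivlMr ?exprn_gt0 // mulrC.
  have ws : cabs (w - a) < s + 1 by lra.
  by have := hM w; rewrite hw lexx => /(_ isT); rewrite gq // cabsM cabsX hw.
rewrite gq; last by rewrite /s; lra.
rewrite cabsM cabsX.
apply: le_trans (_ : (s / 2) ^+ n * (M / s ^+ n) <= _).
  apply: ler_pM; rewrite ?cabs_ge0 ?exprn_ge0 ?cabs_ge0 //.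
  by rewrite lerXn2r ?nnegrE ?cabs_ge0 //; rewrite /s; lra.
rewrite expr_div_n mulrACA [_ ^+ n * M]mulrC -mulrA [_ ^- n * _]mulrC mulVKf //.
by rewrite expf_neq0 // lt0r_neq0.
Qed.

Lemma isolated_zeros f a : centire f -> (exists z, f z != 0) ->
  exists d : R, 0 < d /\ forall w, w != a -> cabs (w - a) < d -> f w != 0.
Proof.
move=> hf [z0 fz0].
have /existsNP[m0 /eqP hm0] : ~ forall m, derive1n m f a = 0.
  by move=> h; move: fz0; rewrite (identity_theorem hf h) eqxx.
have ex : exists m, derive1n m f a != 0 by exists m0.
case: (ex_minnP ex) => m hm hmin.
have a1 : cabs (a - a) < 1 by rewrite subrr cabs0.
have [|g [hg gq]] := @order_factor f a 1 a m (@entire_hol _ _ _ hf) a1.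
  by move=> j jm; apply/eqP; apply/negPn/negP => /hmin; rewrite leqNgt jm.
have ga : g a != 0.
  apply/eqP => ga; move/eqP: hm; apply.
  pose q := dquot g a (derive1 g a).
  apply: (@factor_order f q a 1 a m.+1) => //; first exact: hol_dquot.
  move=> z hz; rewrite gq // (dquotE g a (derive1 g a) z) ga add0r exprS /q; ring.
have [d [d0 hd]] := ccont_neq0 (hol_cont hg a1) ga.
exists (Num.min 1 d); split; first by rewrite lt_min ltr01.
move=> w wa; rewrite lt_min => /andP[w1 /hd wd]; rewrite gq // mulf_neq0 //.
  by rewrite expf_neq0 // subr_eq0.
by rewrite -cabs_gt0 (lt_le_trans _ wd) // divr_gt0 // cabs_gt0.
Qed.

Lemma const_of_deriv0 f c (r : R) : (forall z, cabs (z - c) < r -> cdiff f z 0) ->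
  forall z, cabs (z - c) < r -> f z = f c.
Proof.
move=> df z hz; pose s := cabs (z - c).
have s0 : 0 <= s by exact: cabs_ge0.
have := @mean_value _ (fun w => cabs (w - c) <= s) f (fun=> 0) 0 0 c z
  (@mconvex_disc _ c s) (@cclosed_disc _ c s).
rewrite !mul0r !subr0 cabs0 subrr cabs0 => h.
apply/eqP; rewrite -subr_eq0 -cabs_eq0 eq_le cabs_ge0 andbT.
by apply: h => // w hw; apply: df; exact: le_lt_trans hw hz.
Qed.

End Orders.

(** * Complex exponential and holomorphic roots *)

Section Exponential.
Variable R : realType.
Local Notation C := (cplx R).
Implicit Types (z w a b : C) (f : C -> C).

Lemma is_derive_eps (f : R -> R) (x d : R) : is_derive x 1 f d ->
  forall e : R, 0 < e -> exists r : R, 0 < r /\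
  forall h, `|h| < r -> `|f (x + h) - f x - d * h| <= e * `|h|.
Proof.
move=> [df fd] e e0.
have cv : ((fun h : R => h^-1 *: (f (h + x) - f x)) @ 0^' --> d)%classic.
  move: df; rewrite -fd /derivable /derive.
  suff -> : (fun h : R => h^-1 *: ((f \o shift x) (h *: 1) - f x)) =
    (fun h : R => h^-1 *: (f (h + x) - f x)) by [].
  by apply/funext => h /=; rewrite [h *: _]mulr1.
move/cvgrPdist_le : cv => /(_ e e0) /nbhs_ballP[r /= r0 hr].
exists r; split=> // h hh; have [->|h0] := eqVneq h 0.
  by rewrite addr0 subrr mulr0 subr0 normr0 mulr0.
have := hr h; rewrite /ball /= sub0r normrN => /(_ hh h0) {}hr.
have -> : f (x + h) - f x - d * h = - (d - h^-1 * (f (h + x) - f x)) * h.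
  by rewrite (addrC h); field.
by rewrite normrM normrN ler_wpM2r ?normr_ge0.
Qed.

Definition cexp z : C :=
  (expR (cre z) * cos (cim z) +i* (expR (cre z) * sin (cim z)))%C.

Lemma cexpD z w : cexp (z + w) = cexp z * cexp w.
Proof.
case: z => a b; case: w => a' b'; rewrite /cexp /= expRD cosD sinD.
by apply/eqP; rewrite eq_complex /=; apply/andP; split; apply/eqP; ring.
Qed.

Lemma cexp0 : cexp 0 = 1.
Proof. by rewrite /cexp /= expR0 cos0 sin0 mul1r mulr0. Qed.

Lemma cexp_mulN z : cexp (- z) * cexp z = 1.
Proof. by rewrite -cexpD addNr cexp0. Qed.

Lemma cexpX z n : cexp z ^+ n = cexp (n%:R * z).
Proof.
elim: n => [|n IH]; first by rewrite expr0 mul0r cexp0.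
by rewrite exprS IH -cexpD -[in n.+1%:R]addn1 natrD mulrDl mul1r addrC.
Qed.

Lemma cdiff_cexp0 : cdiff cexp 0 1.
Proof.
apply/cdiffP => e e0.
(* The real and imaginary parts will contribute [3 * t] and [5 * t], together less than [10 * t]. *)
have [t [t0 te t1]] : exists t : R, [/\ 0 < t, t <= e / 10 & t <= 1].
  exists (Num.min (e / 10) 1); rewrite lt_min !ge_min !lexx orbT ltr01 andbT.
  by split=> //; lra.
have [r1 [r10 h1]] := is_derive_eps (is_derive_expR (0 : R)) t0.
have [r2 [r20 h2]] := is_derive_eps (is_derive_cos (0 : R)) t0.
have [r3 [r30 h3]] := is_derive_eps (is_derive_sin (0 : R)) t0.
exists (Num.min t (Num.min r1 (Num.min r2 r3))).
split; first by rewrite !lt_min t0 r10 r20.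
move=> w; rewrite subr0 !lt_min => /and4P[wt w1 w2 w3].
have bx := cabs_Re w; have by_ := cabs_Im w.
have W0 := cabs_ge0 w.
rewrite cexp0 mul1r.
apply: (le_trans (cabs_ReIm _)); rewrite !raddfB /=.
move: bx by_ w1 w2 w3 wt W0; set W := cabs w; set x := cre w; set y := cim w.
move=> bx by_ w1 w2 w3 wt W0.
have := h1 x (le_lt_trans bx w1); have := h2 y (le_lt_trans by_ w2).
have := h3 y (le_lt_trans by_ w3).
rewrite !add0r expR0 cos0 sin0 oppr0 mul0r !mul1r !subr0.
rewrite !ler_norml => s3 s2 s1.
have {}s1 : `|expR x - 1 - x| <= t * W.
  by rewrite ler_norml; have := ler_wpM2l (ltW t0) bx; lra.
have {}s2 : `|cos y - 1| <= t * W.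
  by rewrite ler_norml; have := ler_wpM2l (ltW t0) by_; lra.
have {}s3 : `|sin y - y| <= t * W.
  by rewrite ler_norml; have := ler_wpM2l (ltW t0) by_; lra.
have cy : `|cos y| <= 1 by rewrite ler_norml cos_geN1 cos_le1.
have x1 : `|1 + x| <= 2.
  by rewrite ler_norml; move: bx; rewrite ler_norml; lra.
have e1 : `|expR x - 1| <= 2 * W.
  move: s1 bx; rewrite !ler_norml => s1 bx; have := ler_wpM2r W0 t1; lra.
have y1 : `|sin y| <= 2 * t.
  move: s3 by_; rewrite !ler_norml => s3 by_; have := ler_wpM2r W0 t1; lra.
have p1 : `|expR x * cos y - 1 - x| <= 3 * t * W.
  have -> : expR x * cos y - 1 - x = (expR x - 1 - x) * cos y + (cos y - 1) * (1 + x) by ring.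
  apply: le_trans (ler_normD _ _) _; rewrite !normrM.
  have := ler_pM (normr_ge0 _) (normr_ge0 _) s1 cy.
  have := ler_pM (normr_ge0 _) (normr_ge0 _) s2 x1; lra.
have p2 : `|expR x * sin y - y| <= 5 * t * W.
  have -> : expR x * sin y - y = (expR x - 1) * sin y + (sin y - y) by ring.
  apply: le_trans (ler_normD _ _) _; rewrite normrM.
  have := ler_pM (normr_ge0 _) (normr_ge0 _) e1 y1; lra.
set q := (X in _ + `|X|).
have -> : q = expR x * sin y - y by rewrite /q; ring.
have := ler_wpM2r W0 te; have := mulr_ge0 (ltW e0) W0; lra.
Qed.

Lemma cdiff_cexp z : cdiff cexp z (cexp z).
Proof.
have h : cdiff (fun w => cexp (w + - z)) z 1.
  by apply: cdiff_shift; rewrite subrr; exact: cdiff_cexp0.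
have := cdiffZ (cexp z) h; rewrite mulr1; apply: (@cdiff_ext _ _ _ _ _ 1) => // w _.
by rewrite -cexpD; congr cexp; ring.
Qed.

Lemma complex_root (x : C) l : (0 < l)%N -> exists y : C, y ^+ l = x.
Proof. by move=> l0; exists (nthroot l (x : R[i])); exact: rootCK. Qed.

(** With [phi] a primitive of the logarithmic derivative, [f] is a constant times [cexp phi]; the
    root is a constant times the exponential of [phi] divided by [l]. *)
Lemma hol_root f c (r : R) l : (0 < l)%N -> hol f c r ->
  (forall z, cabs (z - c) < r -> f z != 0) ->
  exists H, hol H c r /\ forall z, cabs (z - c) < r -> H z ^+ l = f z.
Proof.
move=> l0 hf f0.
have hq : hol (fun z => derive1 f z / f z) c r.
  by apply: holM; [exact: hol_deriv|exact: holV].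
have [_ [phi dphi]] := hol_primitive hq.
have dE (k : C) z : cabs (z - c) < r ->
    cdiff (fun w => cexp (k * phi w)) z (cexp (k * phi z) * (k * (derive1 f z / f z))).
  by move=> hz; apply: (@cdiff_comp _ cexp); [apply: cdiffZ; exact: dphi|exact: cdiff_cexp].
have cst z : cabs (z - c) < r -> f z * cexp (-1 * phi z) = f c * cexp (-1 * phi c).
  apply: (@const_of_deriv0 _ (fun z => f z * cexp (-1 * phi z))) => {}z hz.
  have := cdiffM (hol_cdiff hf hz) (dE (-1) z hz); congr (cdiff _ _ _).
  by field; exact: f0.
have [k hk] := complex_root (f c * cexp (-1 * phi c)) l0.
have lN : (l%:R : C) != 0 by rewrite pnatr_eq0 -lt0n.
exists (fun z => k * cexp (l%:R^-1 * phi z)); split.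
  by apply: holM; [exact: hol_cst|move=> z /(dE l%:R^-1) h; eexists; exact: h].
move=> z hz; rewrite exprMn hk cexpX mulrA mulfV // mul1r -(cst z hz) mulN1r.
by rewrite -mulrA cexp_mulN mulr1.
Qed.

End Exponential.

(** * Cauchy estimates for functions with multiple zeros *)

Section LocalBounds.
Variable R : realType.
Local Notation C := (cplx R).
Implicit Types (z w a b : C) (f : C -> C).

Lemma cauchy_estimate_n m : exists K : R, 0 <= K /\ forall f z (t M : R), 0 < t ->
  hol f z t -> (forall w, cabs (w - z) < t -> cabs (f w) <= M) ->
  t ^+ m * cabs (derive1n m f z) <= K * M.
Proof.
elim: m => [|m [K [K0 IH]]].
  exists 1; split=> // f z t M t0 _ hM; rewrite expr0 !mul1r; apply: hM.
  by rewrite subrr cabs0.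
exists (K * (16 * 2 ^+ m)); split; first by rewrite mulr_ge0 // mulr_ge0 // exprn_ge0.
move=> f z t M t0 hf hM; rewrite derive1Sn.
have t2 : 0 < t / 2 by lra.
have := IH (derive1 f) z (t / 2) (16 * M / t) t2.
rewrite expr_div_n => h.
have {}h : t ^+ m / 2 ^+ m * cabs (derive1n m (derive1 f) z) <= K * (16 * M / t).
  apply: h; first by apply: hol_deriv; apply: hol_sub hf _ => w; lra.
  move=> w hw.
  have -> : 16 * M / t = 4 * M / (t / 4) by field; rewrite lt0r_neq0.
  have hfw : hol f w (t / 2).
    by apply: hol_sub hf _ => v hv; have := cabs_triangle v z w; lra.
  apply: (cauchy_estimate hfw); [by lra|by lra| |by rewrite subrr cabs0; lra].
  by move=> v hv; apply: hM; have := cabs_triangle v z w; lra.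
have p2 : 0 < 2 ^+ m :> R by rewrite exprn_gt0.
have -> : t ^+ m.+1 * cabs (derive1n m (derive1 f) z) =
  (t ^+ m / 2 ^+ m * cabs (derive1n m (derive1 f) z)) * (t * 2 ^+ m).
  by rewrite exprS; field; rewrite lt0r_neq0.
have -> : K * (16 * 2 ^+ m) * M = K * (16 * M / t) * (t * 2 ^+ m).
  by field; rewrite lt0r_neq0.
by rewrite ler_wpM2r // mulr_ge0 ?ltW.
Qed.

(** Write [f = H ^+ l] with [|H| <= mu]. Since [H] has Lipschitz constant [8 * mu / s] near [z], it
    stays below [2 * |H z|] on a disc of radius proportional to [s * |H z| / mu]. The Cauchy
    estimate on that disc gains the power [l - m] of [|H z|]. The [l]-th power in the statement
    avoids fractional exponents of [|f z|]. *)
Lemma zero_free_bound l m : (0 < l)%N -> (m <= l)%N -> exists K : R, 0 <= K /\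
  forall f z (s mu : R), 0 < s -> 0 < mu -> hol f z s ->
  (forall w, cabs (w - z) < s -> f w != 0) ->
  (forall w, cabs (w - z) < s -> cabs (f w) <= mu ^+ l) ->
  (s ^+ m * cabs (derive1n m f z)) ^+ l <= K * cabs (f z) ^+ (l - m) * mu ^+ (m * l).
Proof.
move=> l0 ml; have [K [K0 hK]] := cauchy_estimate_n m.
pose K' := K * 2 ^+ l * 8 ^+ m.
have K'0 : 0 <= K' by rewrite !mulr_ge0 ?exprn_ge0.
exists (K' ^+ l); split; first by rewrite exprn_ge0.
move=> f z s mu s0 mu0 hf f0 fmu.
have [H [hH Hl]] := hol_root l0 hf f0.
have z_s : cabs (z - z) < s by rewrite subrr cabs0.
have Hmu w : cabs (w - z) < s -> cabs (H w) <= mu.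
  move=> hw; rewrite -(@ler_pXn2r _ l) ?nnegrE ?cabs_ge0 ?(ltW mu0) //.
  by rewrite -cabsX Hl // fmu.
pose x := cabs (H z).
have x0 : 0 < x.
  rewrite cabs_gt0; apply: contra_neq (f0 z z_s) => Hz.
  by rewrite -Hl // Hz expr0n; case: (l) l0.
have xmu : x <= mu by exact: Hmu.
have lip w : cabs (w - z) <= s / 2 -> cabs (H w - H z) <= 8 * mu / s * cabs (w - z).
  move=> hw; rewrite (dquotE H z (derive1 H z) w) addr_subl cabsM ler_wpM2r ?cabs_ge0 //.
  have -> : 8 * mu / s = 4 * mu / (s / 2) by field; rewrite lt0r_neq0.
  apply: (dquot_bound hH) => //; [by lra|by lra| |by rewrite subrr cabs0; lra].
  by move=> v hv; apply: Hmu; lra.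
pose t := s * x / (8 * mu).
have t0 : 0 < t by rewrite /t divr_gt0 ?mulr_gt0.
have ts : t <= s / 8.
  rewrite /t ler_pdivrMr ?mulr_gt0 //.
  have -> : s / 8 * (8 * mu) = s * mu by field.
  by rewrite ler_wpM2l ?(ltW s0).
have f2x w : cabs (w - z) < t -> cabs (f w) <= (2 * x) ^+ l.
  move=> hw; rewrite -Hl; last by lra.
  rewrite cabsX lerXn2r ?nnegrE ?cabs_ge0 ?mulr_ge0 ?(ltW x0) //.
  have := lip w ltac:(lra); have := cabs_triangle (H w) 0 (H z); rewrite !subr0 -/x.
  suff : 8 * mu / s * cabs (w - z) <= x by lra.
  rewrite -ler_pdivlMl ?divr_gt0 ?mulr_gt0 //.
  apply: le_trans (ltW hw) _; rewrite /t le_eqVlt; apply/orP; left; apply/eqP.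
  by field; rewrite !lt0r_neq0.
have hft : hol f z t by apply: hol_sub hf _ => w; lra.
have := hK f z t _ t0 hft f2x; set D := cabs _ => hD.
have D0 : 0 <= D by exact: cabs_ge0.
have key : s ^+ m * D <= K' * mu ^+ m * x ^+ (l - m).
  have xm : 0 < x ^+ m by rewrite exprn_gt0.
  rewrite -(ler_pM2r xm).
  have -> : K' * mu ^+ m * x ^+ (l - m) * x ^+ m = K * (2 * x) ^+ l * (8 * mu) ^+ m.
    by rewrite -mulrA -exprD subnK // /K' !exprMn; ring.
  have -> : s ^+ m * D * x ^+ m = t ^+ m * D * (8 * mu) ^+ m.
    rewrite /t expr_div_n exprMn.
    have h8 : (8 * mu) ^+ m != 0 by rewrite expf_neq0 // lt0r_neq0 // mulr_gt0.
    by rewrite mulrAC (mulrAC _ D) mulfVK.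
  by rewrite ler_wpM2r // exprn_ge0 // mulr_ge0 // ltW.
apply: le_trans (_ : (K' * mu ^+ m * x ^+ (l - m)) ^+ l <= _).
  rewrite lerXn2r // nnegrE ?mulr_ge0 ?exprn_ge0 ?(ltW s0) ?(ltW mu0) ?(ltW x0) //.
rewrite -Hl // cabsX -/x !exprMn -!exprM (mulnC (l - m)%N) le_eqVlt; apply/orP; left.
by apply/eqP; rewrite mulrAC.
Qed.

(* The disc from z up to the nearest zero a of f is zero-free; when a is close, f is
   small of order l there by the Schwarz lemma, which compensates the small radius. *)
Lemma ramified_bound l m : (0 < l)%N -> (m <= l)%N -> exists K : R, 0 <= K /\
  forall f z (rho T : R), 0 < rho -> 0 < T -> hol f z rho ->
  (forall w, cabs (w - z) < rho -> cabs (f w) <= T) -> f z != 0 ->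
  (forall a, cabs (a - z) < rho -> f a = 0 ->
     forall j, (j < l)%N -> derive1n j f a = 0) ->
  (rho ^+ m * cabs (derive1n m f z)) ^+ l <= K * cabs (f z) ^+ (l - m) * T ^+ m.
Proof.
move=> l0 ml; have [K [K0 hK]] := zero_free_bound l0 ml.
exists (K * 8 ^+ (m * l)); split; first by rewrite mulr_ge0 ?exprn_ge0.
move=> f z rho T rho0 T0 hf fT fz ram.
have [tau [tau0 tauT]] : exists tau : R, 0 < tau /\ tau ^+ l = T.
  have [y hy] := complex_root (creal T) l0; exists (cabs y).
  have yT : cabs y ^+ l = T by rewrite -cabsX hy cabs_creal gtr0_norm.
  split=> //; rewrite lt_neqAle cabs_ge0 andbT eq_sym; apply/eqP => y0.
  by move: T0; rewrite -yT y0 expr0n (gtn_eqF l0) ltxx.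
(* Passing from radius [s] to [rho] costs [(rho / s) ^+ (m * l)], which the factor [s] inside
   [k * s * tau / rho] cancels exactly. The case without a close zero uses [k = 8], the other one
   [k = 6]. *)
have fin (s k : R) : 0 < s -> 0 < k -> k <= 8 ->
    (s ^+ m * cabs (derive1n m f z)) ^+ l <=
      K * cabs (f z) ^+ (l - m) * (k * s * tau / rho) ^+ (m * l) ->
    (rho ^+ m * cabs (derive1n m f z)) ^+ l <= K * 8 ^+ (m * l) * cabs (f z) ^+ (l - m) * T ^+ m.
  move=> s0 k0 k8 h.
  have -> : (rho ^+ m * cabs (derive1n m f z)) ^+ l =
      (s ^+ m * cabs (derive1n m f z)) ^+ l * (rho / s) ^+ (m * l).
    have : rho = s * (rho / s) by rewrite mulrC divfK // lt0r_neq0.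
    move: (rho / s) => q ->; rewrite !exprMn -!exprM; ring.
  apply: le_trans (ler_wpM2r _ h) _; first by rewrite exprn_ge0 // divr_ge0 // ltW.
  apply: (@le_trans _ _ (K * cabs (f z) ^+ (l - m) *
      (k * s * tau / rho * (rho / s)) ^+ (m * l))); first by move: (_ / rho) (_ / s) => A B; rewrite exprMn mulrA.
  have -> : k * s * tau / rho * (rho / s) = k * tau by field; rewrite !lt0r_neq0.
  rewrite exprMn (mulnC m l) (exprM tau) tauT mulrA ler_wpM2r ?exprn_ge0 ?(ltW T0) //.
  rewrite mulrAC ler_wpM2r ?exprn_ge0 ?cabs_ge0 // ler_wpM2l //.
  by rewrite lerXn2r ?nnegrE // ltW.
have [[a0 [ha0 fa0]]|noz] := pselect (exists a, cabs (a - z) < rho / 8 /\ f a = 0); last first.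
  have r8 : 0 < rho / 8 by lra.
  apply: (fin (rho / 8) 8) => //.
  have -> : 8 * (rho / 8) * tau / rho = tau by field; rewrite lt0r_neq0.
  apply: hK => //.
  - by apply: hol_sub hf _ => w; lra.
  - by move=> w hw; apply/eqP => fw; apply: noz; exists w.
  - by move=> w hw; rewrite tauT; apply: fT; lra.
pose E : set R := fun x => exists a, [/\ cabs (a - z) < rho / 8, f a = 0 & x = cabs (a - z)].
have E0 : (E !=set0)%classic by exists (cabs (a0 - z)), a0.
have lbE : has_lbound E by exists 0 => x [a [_ _ ->]]; exact: cabs_ge0.
have infE : has_inf E by [].
pose s := inf E.
have sE a : cabs (a - z) < rho / 8 -> f a = 0 -> s <= cabs (a - z).
  by move=> h1 h2; apply: ge_inf => //; exists a.
have s8 : s < rho / 8 by apply: le_lt_trans (sE _ ha0 fa0) ha0.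
have s0 : 0 < s.
  have z_r : cabs (z - z) < rho by rewrite subrr cabs0.
  have [d [d0 hd]] := ccont_neq0 (hol_cont hf z_r) fz.
  apply: lt_le_trans d0 _; apply: lb_le_inf => // x [a [_ fa ->]].
  rewrite leNgt; apply/negP => /hd; rewrite fa cabs0.
  have fz0 : 0 < cabs (f z) by rewrite cabs_gt0.
  by lra.
(* A zero within twice the infimum [s] of the distances replaces a nearest zero. *)
have [x [a [ha fa xa]] hx] : exists2 x, E x & x < inf E + s by exact: inf_adherent.
have {x xa hx}a2 : cabs (a - z) < 2 * s by move: hx; rewrite xa -/s; lra.
have hfa : hol f a (7 / 8 * rho).
  by apply: hol_sub hf _ => w hw; have := cabs_triangle w z a; lra.
have [||g [hg gq]] := @order_factor _ f a (7 / 8 * rho) a l hfa.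
- by rewrite subrr cabs0; lra.
- by apply: ram => //; lra.
have g_b w : cabs (w - a) <= rho / 2 -> cabs (g w) <= T / (rho / 2) ^+ l.
  apply: (hol_maxp hg); [by lra|by lra|] => {}w hw.
  rewrite ler_pdivlMr ?exprn_gt0 ?divr_gt0 // mulrC.
  have := gq w; rewrite hw => h; have {}h := h ltac:(lra).
  have := fT w; rewrite h cabsM cabsX hw; apply.
  by have := cabs_triangle w z a; lra.
(* For [|w - z| < s] one has [|w - a| <= 3 * s], and dividing by [(w - a) ^+ l] on the circle of
   radius [rho / 2] bounds [|f w|] by [(6 * s * tau / rho) ^+ l]. *)
apply: (fin s 6) => //; first by lra.
apply: hK => //.
- by rewrite !(divr_gt0, mulr_gt0).
- by apply: hol_sub hf _ => w; lra.
- move=> w hw; apply/eqP => fw; have := sE w; rewrite fw => h.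
  by have := h ltac:(lra) erefl; lra.
- move=> w hw.
  have wa : cabs (w - a) <= 3 * s.
    by have := cabs_triangle w a z; rewrite (cabsC z a); lra.
  rewrite gq; last by lra.
  rewrite cabsM cabsX.
  have gw := g_b w ltac:(lra).
  apply: le_trans (_ : (3 * s) ^+ l * (T / (rho / 2) ^+ l) <= _).
    apply: ler_pM => //; rewrite ?exprn_ge0 ?cabs_ge0 //.
    by rewrite lerXn2r ?nnegrE ?cabs_ge0 // mulr_ge0 // ltW.
  rewrite -tauT mulrA -exprMn -expr_div_n le_eqVlt; apply/orP; left; apply/eqP.
  by congr (_ ^+ _); field; rewrite lt0r_neq0.
Qed.

End LocalBounds.

(** * Wronskians *)

Section Wronskian.
Variable R : realType.
Local Notation C := (cplx R).
Implicit Types (z w a b : C) (f g h : C -> C).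

Lemma hol_sum (I : Type) (s : seq I) (F : I -> C -> C) c (r : R) :
  (forall i, hol (F i) c r) -> hol (fun z => \sum_(i <- s) F i z) c r.
Proof.
move=> hF; elim: s => [|i s IH].
  by apply: (@hol_ext _ (fun=> 0)); [exact: hol_cst|move=> z _; rewrite big_nil].
by apply: hol_ext (holD (hF i) IH) _ => z _; rewrite big_cons.
Qed.

Lemma hol_prod (I : Type) (s : seq I) (F : I -> C -> C) c (r : R) :
  (forall i, hol (F i) c r) -> hol (fun z => \prod_(i <- s) F i z) c r.
Proof.
move=> hF; elim: s => [|i s IH].
  by apply: (@hol_ext _ (fun=> 1)); [exact: hol_cst|move=> z _; rewrite big_nil].
by apply: hol_ext (holM (hF i) IH) _ => z _; rewrite big_cons.
Qed.

Lemma cdiff_sum (I : Type) (s : seq I) (F : I -> C -> C) (dF : I -> C) z :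
  (forall i, cdiff (F i) z (dF i)) ->
  cdiff (fun w => \sum_(i <- s) F i w) z (\sum_(i <- s) dF i).
Proof.
move=> hF; elim: s => [|i s IH].
  rewrite big_nil; apply: (@cdiff_ext _ (fun=> 0) _ _ _ 1) (cdiff_cst _ _) => //.
  by move=> w _; rewrite big_nil.
rewrite big_cons; apply: (@cdiff_ext _ _ _ _ _ 1) (cdiffD (hF i) IH) => //.
by move=> w _; rewrite big_cons.
Qed.

(* D^m (h g) = \sum_i (leibniz_coef h m i) * D^i g; the coefficients form a lower
   triangular array with h on the diagonal. *)
Fixpoint leibniz_coef h (m i : nat) : C -> C :=
  if m is m'.+1 then fun z => derive1 (leibniz_coef h m' i) z +
    (if i is j.+1 then leibniz_coef h m' j z else 0)
  else fun z => if i == 0%N then h z else 0.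

Lemma leibniz_coef_hol h c (r : R) m i : hol h c r -> hol (leibniz_coef h m i) c r.
Proof.
move=> hh; elim: m i => [|m IH] [|i] /=.
- exact: hol_ext hh _.
- exact: hol_cst.
- by apply: holD; [exact: hol_deriv|exact: hol_cst].
- by apply: holD => //; exact: hol_deriv.
Qed.

Lemma derive1_zero f z : (forall w, f w = 0) -> derive1 f z = 0.
Proof.
move=> f0; apply: cdiff_derive1; apply: (@cdiff_ext _ (fun=> 0) _ _ _ 1) (cdiff_cst _ _) => //.
Qed.

Lemma leibniz_coef_gt h m i z : (m < i)%N -> leibniz_coef h m i z = 0.
Proof.
elim: m i z => [|m IH] [|i] z //= mi.
rewrite derive1_zero ?add0r ?IH // => w; apply: IH; exact: ltnW.
Qed.

Lemma leibniz_coef_diag h m z : leibniz_coef h m m z = h z.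
Proof.
elim: m => //= m IH; rewrite derive1_zero ?add0r // => w.
exact: leibniz_coef_gt.
Qed.

Lemma leibniz h g c (r : R) k m z : hol h c r -> hol g c r -> (m < k)%N -> cabs (z - c) < r ->
  derive1n m (fun w => h w * g w) z =
  \sum_(i < k) leibniz_coef h m i z * derive1n i g z.
Proof.
case: k => // k hh hg; elim: m z => [|m IH] z mk hz.
  by rewrite big_ord_recl /= big1 ?addr0 // => i _; rewrite mul0r.
have hhg := derive1_ext (hol_derivn m (holM hh hg)) (fun w => IH w (ltnW mk)) hz.
rewrite derive1nS hhg.
have -> : derive1 (fun w => \sum_(i < k.+1) leibniz_coef h m i w * derive1n i g w) z =
   \sum_(i < k.+1) (derive1 (leibniz_coef h m i) z * derive1n i g z +
     leibniz_coef h m i z * derive1n i.+1 g z).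
  apply: cdiff_derive1; apply: cdiff_sum => i; apply: cdiffM.
    exact: hol_cdiff (leibniz_coef_hol m i hh) hz.
  exact: hol_cdiff (hol_derivn i hg) hz.
rewrite big_split /=.
have -> : \sum_(i < k.+1) leibniz_coef h m i z * derive1n i.+1 g z =
   \sum_(i < k.+1) (if nat_of_ord i is j.+1 then leibniz_coef h m j z else 0) * derive1n i g z.
  by rewrite big_ord_recr [RHS]big_ord_recl /= leibniz_coef_gt // !mul0r addr0 add0r.
by rewrite -big_split /=; apply: eq_bigr => i _; rewrite mulrDl.
Qed.

Lemma order_mul h g c (r : R) a l : hol h c r -> hol g c r -> cabs (a - c) < r ->
  (forall j, (j < l)%N -> derive1n j g a = 0) ->
  forall j, (j < l)%N -> derive1n j (fun w => h w * g w) a = 0.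
Proof.
move=> hh hg ha g0 j jl; rewrite (leibniz hh hg (ltnSn j) ha).
by rewrite big1 // => i _; rewrite g0 ?mulr0 // (leq_trans (ltn_ord i)).
Qed.

Definition wronskian k (u : 'I_k -> C -> C) z : C :=
  \det (\matrix_(i < k, m < k) derive1n m (u i) z).

Lemma wronskian_hol k (u : 'I_k -> C -> C) c (r : R) :
  (forall i, hol (u i) c r) -> hol (wronskian u) c r.
Proof.
move=> hu.
have -> : wronskian u = fun z => \sum_(s : 'S_k) (-1) ^+ s * \prod_i derive1n (s i) (u i) z.
  apply/funext => z; apply: eq_bigr => s _; congr (_ * _).
  by apply: eq_bigr => i _; rewrite mxE.
apply: hol_sum => s; apply: holM; first exact: hol_cst.
by apply: hol_prod => i; exact: hol_derivn.
Qed.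

Lemma wronskian_scale k (u : 'I_k -> C -> C) h c (r : R) z : hol h c r ->
  (forall i, hol (u i) c r) -> cabs (z - c) < r ->
  wronskian (fun i w => h w * u i w) z = h z ^+ k * wronskian u z.
Proof.
move=> hh hu hz.
pose L := \matrix_(m < k, i < k) leibniz_coef h m i z.
have -> : wronskian (fun i w => h w * u i w) z =
    \det ((\matrix_(i < k, m < k) derive1n m (u i) z) *m L^T).
  congr (\det _); apply/matrixP => i m; rewrite !mxE (leibniz hh (hu i) (ltn_ord m) hz).
  by apply: eq_bigr => j _; rewrite !mxE mulrC.
rewrite det_mulmx det_tr mulrC; congr (_ * _).
rewrite det_trig; last first.
  by apply/is_trig_mxP => i j ij; rewrite mxE leibniz_coef_gt.
rewrite (eq_bigr (fun=> h z)) => [|i _]; last by rewrite mxE leibniz_coef_diag.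
by rewrite prodr_const card_ord.
Qed.

(** Where [u ord0] has no zero, divide by it: the first function becomes 1, and the derivatives of
    the others have Wronskian 0. A relation between these derivatives integrates to one between the
    functions, with the constant of integration as first coefficient. The disc shrinks because zeros
    have to be avoided. *)
Lemma wronskian_dependent k (u : 'I_k -> C -> C) c (r : R) : 0 < r ->
  (forall i, hol (u i) c r) -> (forall z, cabs (z - c) < r -> wronskian u z = 0) ->
  exists c' (r' : R) (al : 'I_k -> C), [/\ 0 < r', forall z, cabs (z - c') < r' -> cabs (z - c) < r,
    exists i, al i != 0 & forall z, cabs (z - c') < r' -> \sum_(i < k) al i * u i z = 0].
Proof.
elim: k u c r => [|k IH] u c r r0 hu W0.
  have := W0 c; rewrite subrr cabs0 => /(_ r0); rewrite /wronskian det_mx00 => /eqP.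
  by rewrite oner_eq0.
have [u0|] := pselect (forall z, cabs (z - c) < r -> u ord0 z = 0).
  exists c, r, (fun i => (i == ord0)%:R); split=> //.
    by exists ord0; rewrite eqxx oner_eq0.
  move=> z hz; rewrite (bigD1 ord0) //= u0 // mulr0 add0r big1 // => i /negPf ->.
  by rewrite mul0r.
move=> /existsNP[c1 /not_implyP[hc1 /eqP u1]].
have [d [d0 hd]] := ccont_neq0 (hol_cont (hu ord0) hc1) u1.
pose r1 := Num.min d (r - cabs (c1 - c)).
have r10 : 0 < r1 by rewrite lt_min d0 subr_gt0.
have in1 z : cabs (z - c1) < r1 -> cabs (z - c) < r.
  by rewrite lt_min => /andP[_]; have := cabs_triangle z c c1; lra.
have nz z : cabs (z - c1) < r1 -> u ord0 z != 0.
  rewrite lt_min => /andP[/hd h _]; rewrite -cabs_gt0; apply: lt_le_trans h.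
  by rewrite divr_gt0 // cabs_gt0.
have hu1 i : hol (u i) c1 r1 by apply: hol_sub (hu i) in1.
pose h z := (u ord0 z)^-1; have hh : hol h c1 r1 by exact: holV.
pose v i z := h z * u i z; have hv i : hol (v i) c1 r1 by exact: holM.
have v0 z : cabs (z - c1) < r1 -> v ord0 z = 1 by move=> /nz; exact: mulVf.
pose v' i := derive1 (v (lift ord0 i)).
have hv' i : hol (v' i) c1 r1 by exact: hol_deriv.
have [z hz|c2 [r2 [al [r20 in2 [i0 ali0] al0]]]] := IH v' c1 r1 r10 hv'.
  have W : wronskian v z = 0.
    by rewrite (wronskian_scale hh hu1 hz) W0 ?mulr0 //; exact: in1.
  transitivity (wronskian v z) => //.
  rewrite [RHS]/wronskian (expand_det_row _ ord0) big_ord_recl big1 ?addr0 => [|i _].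
    rewrite mxE /= v0 // mul1r /cofactor /= addn0 expr0 mul1r.
    congr (\det _); apply/matrixP => i m; rewrite !mxE /= /v'.
    by rewrite -derive1Sn.
  rewrite mxE.
  rewrite (@derive1n_ext _ (v ord0) (fun=> 1) c1 r1) //.
  rewrite lift0 derive1Sn; set D := derive1 _.
  have D0 w : D w = 0 by apply: cdiff_derive1; exact: cdiff_cst.
  have -> : derive1n (val i) D z = 0; last by rewrite mul0r.
  elim: (val i) z {hz W} => [|m IHm] z; first exact: D0.
  by rewrite derive1nS; apply: derive1_zero.
pose s z := \sum_(i < k) al i * v (lift ord0 i) z.
have cs z : cabs (z - c2) < r2 -> s z = s c2.
  apply: const_of_deriv0 => {}z hz; rewrite -(al0 z hz).
  by apply: cdiff_sum => i; apply: cdiffZ; exact: hol_cdiff (hv _) (in2 _ hz).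
exists c2, r2, (fun i => if unlift ord0 i is Some j then al j else - s c2); split=> //.
- by move=> z /in2 /in1.
- by exists (lift ord0 i0); rewrite liftK.
- move=> z hz; have z1 := in2 z hz.
  have uv i : u i z = u ord0 z * v i z by rewrite /v /h mulVKf // nz.
  rewrite big_ord_recl unlift_none.
  under eq_bigr => i _ do rewrite liftK uv mulrCA.
  by rewrite -mulr_sumr -/(s z) cs // mulrC -mulrDr addNr mulr0.
Qed.

(** A relation found on a small disc is global by the identity theorem. *)
Lemma entire_wronskian k (u : 'I_k -> C -> C) : (forall i, centire (u i)) ->
  (forall al : 'I_k -> C, (forall z, \sum_(i < k) al i * u i z = 0) -> forall i, al i = 0) ->
  exists z, wronskian u z != 0.
Proof.
move=> hu indep; apply: contrapT => nW.
have [||c' [r' [al [r'0 _ [i0 /eqP ali0] al0]]]] := @wronskian_dependent k u 0 1 ltr01.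
- by move=> i; exact: entire_hol.
- by move=> z _; apply/eqP/negPn/negP => h; apply: nW; exists z.
apply: ali0; apply: indep.
have hs : centire (fun z => \sum_(i < k) al i * u i z).
  apply: hol_entire => r; apply: hol_sum => i.
  by apply: holM; [exact: hol_cst|exact: entire_hol].
apply: (@identity_theorem _ _ c' hs) => m.
rewrite (@derive1n_ext _ _ (fun=> 0) c' r' m c' (@entire_hol _ _ _ _ hs)) //; last first.
  by rewrite subrr cabs0.
by elim: m c' {al0} => // m IHm z; rewrite derive1nS; apply: derive1_zero.
Qed.

End Wronskian.

(** * Estimate of the Wronskian of a ramified system *)

Section WronskianBound.
Variable R : realType.
Local Notation C := (cplx R).

Lemma exists_root (Y : R) b : (0 < b)%N -> 0 <= Y -> exists y : R, 0 <= y /\ y ^+ b = Y.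
Proof.
move=> b0 Y0; have [x hx] := complex_root (creal Y) b0.
by exists (cabs x); rewrite cabs_ge0 -cabsX hx cabs_creal ger0_norm.
Qed.

Lemma sum_pow_le (I : finType) (F : I -> R) b (Y : R) : (0 < b)%N -> 0 <= Y ->
  (forall i, 0 <= F i) -> (forall i, F i ^+ b <= Y) ->
  (\sum_i F i) ^+ b <= #|I|%:R ^+ b * Y.
Proof.
move=> b0 Y0 F0 FY; have [y [y0 yY]] := exists_root b0 Y0.
have Fy i : F i <= y.
  by rewrite -(@ler_pXn2r _ b b0) ?nnegrE // yY.
rewrite -yY -exprMn lerXn2r ?nnegrE ?mulr_ge0 ?sumr_ge0 //.
apply: le_trans (ler_sum _ (fun i _ => Fy i)) _.
by rewrite sumr_const mulr_natl.
Qed.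

Lemma derive1n_sum (I : Type) (s : seq I) (F : I -> C -> C) c (r : R) m z :
  (forall i, hol (F i) c r) -> cabs (z - c) < r ->
  derive1n m (fun w => \sum_(i <- s) F i w) z = \sum_(i <- s) derive1n m (F i) z.
Proof.
move=> hF; elim: m z => // m IH z hz.
rewrite derive1nS (derive1_ext (hol_derivn m (hol_sum s hF)) IH hz).
by apply: cdiff_derive1; apply: cdiff_sum => i; exact: hol_cdiff (hol_derivn m (hF i)) hz.
Qed.

(** Since the [g_i] have sum 0, the family without [j0] is expressed in the family without [j]; the
    row of [g_j] is constantly -1. *)
Definition omit_mx k (j0 j : 'I_k.+1) : 'M[C]_k :=
  \matrix_(i, i') if lift j0 i == j then -1 else (lift j i' == lift j0 i)%:R.

Lemma wronskian_omit k (g : 'I_k.+1 -> C -> C) c (r : R) z j0 j :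
  (forall i, hol (g i) c r) -> (forall w, cabs (w - c) < r -> \sum_i g i w = 0) ->
  cabs (z - c) < r ->
  wronskian (fun i => g (lift j0 i)) z =
    \det (omit_mx j0 j) * wronskian (fun i => g (lift j i)) z.
Proof.
move=> hg g0 hz; rewrite -det_mulmx; congr (\det _); apply/matrixP => i m.
rewrite !mxE; under eq_bigr => i' _ do rewrite !mxE.
have S0 : \sum_i derive1n m (g i) z = 0.
  rewrite -(derive1n_sum _ _ hg hz).
  rewrite (@derive1n_ext _ _ (fun=> 0) c r m z (hol_sum _ hg) g0 hz).
  elim: (nat_of_ord m) z {hz} => // n IHn z; rewrite derive1nS; exact: derive1_zero.
case: eqP => [eij|/eqP nij].
  rewrite eij -mulr_sumr mulN1r; apply/eqP; rewrite -addr_eq0.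
  by rewrite -(bigD1_ord j (P := predT) (F := fun i => derive1n m (g i) z)) // S0.
rewrite eq_sym in nij; have [i' hi' _] := unlift_some nij.
rewrite (bigD1 i') //= -hi' eqxx mul1r big1 ?addr0 // => i2 h2.
by rewrite hi' (inj_eq lift_inj) (negPf h2) mul0r.
Qed.

Section Bound.
Variables (k : nat) (l a : 'I_k.+1 -> nat) (b : nat).
Hypothesis l0 : forall i, (0 < l i)%N.
Hypothesis b0 : (0 < b)%N.
Hypothesis ab : forall i, (a i * l i = b)%N.
Hypothesis kab : (k.-1 * (\sum_i a i) < b)%N.

Let e i := (b - k.-1 * a i)%N.
Let d := (b - k.-1 * (\sum_i a i))%N.
Let kap := (b * (\sum_(m < k) m))%N.

Let a_sum j : (\sum_i a i = a j + \sum_(i < k) a (lift j i))%N.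
Proof. by rewrite (bigD1_ord j). Qed.

Let ka_le i : (k.-1 * a i <= b)%N.
Proof.
apply: leq_trans (ltnW kab); rewrite leq_mul2l; apply/orP; right.
by rewrite (a_sum i) leq_addr.
Qed.

(** Makes every derivative order [m < k] admissible in [ramified_bound]. *)
Let k_le i : (k.-1 <= l i)%N.
Proof.
have a0 : (0 < a i)%N by move: b0; rewrite -(ab i) muln_gt0 => /andP[].
by rewrite -(leq_pmul2r a0) (mulnC (l i)) ab.
Qed.

(** The powers of [|G j z|] coming from the [k] rows other than [j], together with the extra factor
    of exponent [d], amount exactly to the exponent of [G j] in the denominator. *)
Let e_d j : (e j = k.-1 * (\sum_(i < k) a (lift j i)) + d)%N.
Proof.
move: kab; rewrite /e /d (a_sum j) mulnDr.
move: (k.-1 * a j)%N (k.-1 * \sum_(i < k) a (lift j i))%N => x y xyb.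
by rewrite subnDA subnKC // leq_subRL ?(ltnW xyb) // (leq_trans (leq_addr y x)) ?(ltnW xyb).
Qed.

(** The homogeneity count: a common factor [h] appears to the power [k * b] in the Wronskian, to the
    power [d] in the extra factor, and to their sum in the product. Hence it cancels in
    [wronskian_bound]. *)
Let sum_e : (\sum_i e i = k * b + d)%N.
Proof.
have : (\sum_i e i + k.-1 * (\sum_i a i) = k.+1 * b)%N.
  rewrite big_distrr /= -big_split /= (eq_bigr (fun=> b)) => [|i _].
    by rewrite sum_nat_const card_ord.
  by rewrite /e subnK.
by move: kab; rewrite /d mulSn; lia.
Qed.

(** The Wronskian omits the dominating function [G j]. Each entry is bounded by [ramified_bound],
    the bounds are multiplied along a permutation, and every [T] is turned back into a multiple of
    [|G j z|]. *)
Lemma local_wronskian_bound (K : R) : 1 <= K -> exists Kc : R, 0 <= Kc /\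
  forall (G : 'I_k.+1 -> C -> C) z (rho : R) j, 0 < rho ->
  (forall i, hol (G i) z rho) ->
  (forall i w, cabs (w - z) < rho -> cabs (G i w) <= K * cabs (G j z)) ->
  (forall i, G i z != 0) ->
  (forall i p, cabs (p - z) < rho -> G i p = 0 ->
     forall m, (m < l i)%N -> derive1n m (G i) p = 0) ->
  rho ^+ kap * cabs (wronskian (fun i => G (lift j i)) z) ^+ b * cabs (G j z) ^+ d <=
  Kc * \prod_i cabs (G i z) ^+ e i.
Proof.
move=> K1.
have mk (m : 'I_k) : (m <= k.-1)%N by have := ltn_ord m; lia.
have ml (p : 'I_k.+1 * 'I_k) : (p.2 <= l p.1)%N by exact: leq_trans (mk _) (k_le _).
have /choice[Kf hKf] := fun p : 'I_k.+1 * 'I_k => @ramified_bound R (l p.1) p.2 (l0 _) (ml p).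
have Kf0 p : 0 <= Kf p by case: (hKf p).
pose Kb := \sum_p Kf p ^+ a p.1.
have Kb0 : 0 <= Kb by apply: sumr_ge0 => p _; exact: exprn_ge0.
have Kfb p : Kf p ^+ a p.1 <= Kb.
  rewrite /Kb (bigD1 p) //= lerDl; apply: sumr_ge0 => q _; exact: exprn_ge0.
pose N : R := #|{perm 'I_k}|%:R ^+ b.
have N0 : 0 <= N by rewrite exprn_ge0.
have KS : 0 <= K ^+ (k.-1 * \sum_i a i) by rewrite exprn_ge0 //; lra.
exists (N * (Kb ^+ k * K ^+ (k.-1 * \sum_i a i))).
split; first by rewrite mulr_ge0 // mulr_ge0 // exprn_ge0.
move=> G z rho j rho0 hG GK Gz ram.
have Gp i : 0 < cabs (G i z) by rewrite cabs_gt0.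
set T := K * cabs (G j z) in GK.
have T0 : 0 < T by rewrite mulr_gt0 //; lra.
have TE : T = K * cabs (G j z) by [].
clearbody T.
have zz : cabs (z - z) < rho by rewrite subrr cabs0.
pose Y i := cabs (G i z) ^+ e i * T ^+ (k.-1 * a i).
have Y0 i : 0 <= Y i by rewrite mulr_ge0 ?exprn_ge0 ?cabs_ge0 ?(ltW T0).
(* One bound serves all orders [m]: raising to the power [a i] leaves [|G i z|] with exponent
   [e i + (k.-1 - m) * a i], and the surplus is absorbed by [|G i z| <= T]. *)
have entry i (m : 'I_k) : (rho ^+ m * cabs (derive1n m (G i) z)) ^+ b <= Kb * Y i.
  have [_ /(_ (G i) z rho T rho0 T0 (hG i) (GK i) (Gz i) (ram i)) /= H] := hKf (i, m).
  rewrite -(ab i) mulnC exprM.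
  apply: (@le_trans _ _ ((Kf (i, m) * cabs (G i z) ^+ (l i - m) * T ^+ m) ^+ a i)).
    rewrite lerXn2r ?nnegrE ?mulr_ge0 ?exprn_ge0 ?mulr_ge0 ?exprn_ge0 ?cabs_ge0 ?(ltW T0) ?(ltW rho0) //.
  rewrite !exprMn -!exprM -mulrA; apply: ler_pM.
  - exact: exprn_ge0.
  - by rewrite mulr_ge0 ?exprn_ge0 ?cabs_ge0 ?(ltW T0).
  - exact: (Kfb (i, m)).
  have mki := mk m.
  have -> : ((l i - m) * a i = e i + (k.-1 - m) * a i)%N.
    rewrite /e -(ab i) !mulnBl (mulnC (a i)).
    have := k_le i; have : (m * a i <= k.-1 * a i)%N by rewrite leq_mul2r mki orbT.
    have : (k.-1 * a i <= l i * a i)%N by rewrite leq_mul2r k_le orbT.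
    lia.
  rewrite /Y; have -> : (k.-1 * a i = (k.-1 - m) * a i + m * a i)%N by rewrite -mulnDl subnK.
  rewrite !exprD mulrA ler_wpM2r ?exprn_ge0 ?(ltW T0) // ler_wpM2l ?exprn_ge0 ?cabs_ge0 //.
  by rewrite lerXn2r ?nnegrE ?cabs_ge0 ?(ltW T0) //; exact: GK.
pose D := wronskian (fun i => G (lift j i)) z.
pose P (s : {perm 'I_k}) := \prod_i (rho ^+ s i * cabs (derive1n (s i) (G (lift j i)) z)).
have P0 s : 0 <= P s.
  by apply: prodr_ge0 => i _; rewrite mulr_ge0 ?exprn_ge0 ?cabs_ge0 ?(ltW rho0).
have PE s : P s = rho ^+ (\sum_(m < k) m) * \prod_i cabs (derive1n (s i) (G (lift j i)) z).
  rewrite /P big_split /= prodrXr; congr (rho ^+ _ * _).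
  by rewrite [RHS](reindex_inj (@perm_inj _ s)).
pose YY := \prod_(i < k) (Kb * Y (lift j i)).
have YY0 : 0 <= YY by apply: prodr_ge0 => i _; rewrite mulr_ge0.
have hP s : P s ^+ b <= YY.
  rewrite /P -prodrXl; apply: ler_prod => i _; apply/andP; split; last exact: entry.
  by rewrite exprn_ge0 // mulr_ge0 ?exprn_ge0 ?cabs_ge0 ?(ltW rho0).
have hD : rho ^+ (\sum_(m < k) m) * cabs D <= \sum_s P s.
  rewrite (eq_bigr _ (fun s _ => PE s)) -mulr_sumr ler_wpM2l ?exprn_ge0 ?(ltW rho0) //.
  rewrite /D /wronskian; apply: le_trans (cabs_sum _ _ _) _.
  apply: ler_sum => s _; rewrite cabsM cabsX cabsN cabs1 expr1n mul1r cabs_prod.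
  by apply: ler_prod => i _; rewrite mxE cabs_ge0 lexx.
have {}hD : rho ^+ kap * cabs D ^+ b <= N * YY.
  apply: le_trans (sum_pow_le b0 YY0 P0 hP).
  rewrite /kap mulnC exprM -exprMn lerXn2r ?nnegrE //.
    by rewrite mulr_ge0 ?cabs_ge0 // exprn_ge0 // ltW.
  exact: sumr_ge0.
apply: le_trans (ler_wpM2r _ hD) _; first by rewrite exprn_ge0 ?cabs_ge0.
rewrite -!mulrA; apply: ler_wpM2l => //.
rewrite (bigD1_ord j (P := predT) (F := fun i => cabs (G i z) ^+ e i)) //=.
rewrite /YY /Y !big_split /= prodr_const card_ord prodrXr -big_distrr /=.
rewrite -mulrA ler_wpM2l ?exprn_ge0 //.
rewrite [X in _ <= X]mulrCA [X in _ <= X]mulrA [X in _ <= X]mulrC -mulrA.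
rewrite ler_wpM2l; last first.
- rewrite [X in _ <= X]mulrC TE exprMn -mulrA e_d exprD.
  rewrite ler_wpM2r ?mulr_ge0 ?exprn_ge0 ?cabs_ge0 //.
  by apply: ler_weXn2l => //; rewrite leq_mul2l (a_sum j) leq_addl orbT.
- by apply: prodr_ge0 => i _; rewrite exprn_ge0 ?cabs_ge0.
by [].
Qed.

(** Frees the local bound from [h] by homogeneity and from the choice of [j]: omitting [ord_max]
    instead of [j] changes the Wronskian by a constant factor, and [S] dominates all these
    factors. *)
Lemma wronskian_bound (K : R) : 1 <= K -> exists Kc : R, 0 <= Kc /\
  forall (g : 'I_k.+1 -> C -> C) (h : C -> C) z (rho : R) j, 0 < rho ->
  hol h z rho -> (forall w, cabs (w - z) < rho -> h w != 0) ->
  (forall i, hol (g i) z rho) -> (forall w, cabs (w - z) < rho -> \sum_i g i w = 0) ->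
  (forall i w, cabs (w - z) < rho -> cabs (h w * g i w) <= K * cabs (h z * g j z)) ->
  (forall i, g i z != 0) ->
  (forall i p, cabs (p - z) < rho -> g i p = 0 ->
     forall m, (m < l i)%N -> derive1n m (g i) p = 0) ->
  rho ^+ kap * cabs (wronskian (fun i => g (lift ord_max i)) z) ^+ b * cabs (g j z) ^+ d <=
  Kc * \prod_i cabs (g i z) ^+ e i.
Proof.
move=> K1; have [Kc [Kc0 H]] := local_wronskian_bound K1.
pose S := \sum_j cabs (\det (omit_mx ord_max j : 'M[C]_k)) ^+ b.
have S0 : 0 <= S by apply: sumr_ge0 => j _; rewrite exprn_ge0 ?cabs_ge0.
exists (S * Kc); split; first exact: mulr_ge0.
move=> g h z rho j rho0 hh h0 hg g0 hK gz ram.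
have zz : cabs (z - z) < rho by rewrite subrr cabs0.
have hz := h0 z zz.
have ph : 0 < cabs (h z) by rewrite cabs_gt0.
have := H (fun i w => h w * g i w) z rho j rho0.
rewrite (wronskian_scale hh (fun i => hg (lift j i)) zz).
have -> : \prod_i cabs (h z * g i z) ^+ e i =
    cabs (h z) ^+ (k * b + d) * \prod_i cabs (g i z) ^+ e i.
  rewrite -sum_e -prodrXr -big_split /=; apply: eq_bigr => i _.
  by rewrite cabsM exprMn.
rewrite !cabsM cabsX !exprMn -exprM exprD => {}H.
have {}H : rho ^+ kap * cabs (wronskian (fun i => g (lift j i)) z) ^+ b * cabs (g j z) ^+ d <=
    Kc * \prod_i cabs (g i z) ^+ e i.
  have ph2 : 0 < cabs (h z) ^+ (k * b) * cabs (h z) ^+ d by rewrite mulr_gt0 // exprn_gt0.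
  rewrite -(ler_pM2r ph2).
  have {}H := H _ _ _ _.
  apply: le_trans (_ : _ <= _) (le_trans (H _ _ _ _) _).
  - by rewrite le_eqVlt; apply/orP; left; apply/eqP; ring.
  - by move=> i; exact: holM.
  - by move=> i w hw; rewrite -cabsM hK.
  - by move=> i; rewrite mulf_neq0.
  - move=> i p hp /eqP; rewrite mulf_eq0 (negPf (h0 p hp)) /= => /eqP gp.
    exact: order_mul hh (hg i) hp (ram i p hp gp).
  - by rewrite le_eqVlt; apply/orP; left; apply/eqP; ring.
rewrite (wronskian_omit ord_max j hg g0 zz) cabsM exprMn.
apply: le_trans (_ : cabs (\det (omit_mx ord_max j : 'M[C]_k)) ^+ b *
   (rho ^+ kap * cabs (wronskian (fun i => g (lift j i)) z) ^+ b * cabs (g j z) ^+ d) <= _).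
  by rewrite -!mulrA mulrCA.
rewrite -(mulrA S); apply: ler_pM => //.
- by rewrite exprn_ge0 ?cabs_ge0.
- by rewrite !mulr_ge0 ?exprn_ge0 ?cabs_ge0 ?(ltW rho0).
- by rewrite /S (bigD1 j) //= lerDl; apply: sumr_ge0 => i _; rewrite exprn_ge0 ?cabs_ge0.
Qed.

End Bound.
End WronskianBound.

(** * Entire functions with ramified zeros *)

Section Entire.
Variable R : realType.
Local Notation C := (cplx R).
Implicit Types (z w a c : C) (f g : C -> C).

Lemma entireM f g : centire f -> centire g -> centire (fun z => f z * g z).
Proof.
by move=> hf hg z; eexists; apply: cdiffM; exact: entire_cdiff.
Qed.

Lemma entireX f n : centire f -> centire (fun z => f z ^+ n).
Proof. by move=> hf; apply: hol_entire => r; apply: holX; exact: entire_hol. Qed.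

Lemma entire_prod (I : finType) (F : I -> C -> C) : (forall i, centire (F i)) ->
  centire (fun z => \prod_i F i z).
Proof. by move=> hF; apply: hol_entire => r; apply: hol_prod => i; exact: entire_hol. Qed.

Lemma entire_dquot f a : centire f -> centire (dquot f a (derive1 f a)).
Proof.
move=> hf z; apply: (@hol_dquot _ f a (cabs (z - a) + 1)); first exact: entire_hol.
  by rewrite subrr cabs0; have := cabs_ge0 (z - a); lra.
lra.
Qed.

Lemma exists_near a (d : R) : 0 < d -> exists w, w != a /\ cabs (w - a) < d.
Proof.
move=> d0; have h : cabs (a + creal (d / 2) - a) = d / 2.
  by rewrite addr_subl cabs_creal gtr0_norm //; lra.
exists (a + creal (d / 2)); rewrite h; split; last by lra.
by rewrite -subr_eq0 -cabs_gt0 h; lra.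
Qed.

Lemma ccont_eq f g a (d : R) : 0 < d -> ccont f a -> ccont g a ->
  (forall w, w != a -> cabs (w - a) < d -> f w = g w) -> f a = g a.
Proof.
move=> d0 cf cg fg; apply/eqP; rewrite -subr_eq0 -cabs_eq0 eq_le cabs_ge0 andbT.
apply: (@ccont_limit _ (fun w => f w - g w)); first exact: ccontB.
move=> e e0; have [|w [wa]] := @exists_near a (Num.min d e); first by rewrite lt_min d0.
by rewrite lt_min => /andP[h1 h2]; exists w; rewrite fg // subrr cabs0.
Qed.

(** The product of [w - a] with the bounded quotient extends continuously by 0, hence
    holomorphically; dividing by [w - a] again gives the extension. *)
Lemma removable_quotient A P a (d M : R) : centire A -> centire P -> 0 < d ->
  (forall w, w != a -> cabs (w - a) < d -> P w != 0 /\ cabs (A w) <= M * cabs (P w)) ->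
  exists q, hol q a d /\ forall w, w != a -> cabs (w - a) < d -> q w = A w / P w.
Proof.
move=> hA hP d0 hAP.
pose v w := (w - a) * (if w == a then 0 else A w / P w).
have aa : cabs (a - a) < d by rewrite subrr cabs0.
have va : v a = 0 by rewrite /v subrr mul0r.
have bound w : cabs (w - a) < d -> cabs (v w) <= (`|M| + 1) * cabs (w - a).
  move=> hw; rewrite /v; case: eqVneq => [->|wa].
    by rewrite subrr mul0r cabs0 mulr0.
  have [Pw Aw] := hAP w wa hw; rewrite cabsM mulrC ler_wpM2r ?cabs_ge0 //.
  rewrite cabsM cabsV ler_pdivrMr ?cabs_gt0 //; apply: le_trans Aw _.
  by rewrite ler_wpM2r ?cabs_ge0 //; have := ler_norm M; lra.
have dv z : cabs (z - a) < d -> z != a -> exists d, cdiff v z d.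
  move=> hz za; have [Pz _] := hAP z za hz.
  have za0 : 0 < cabs (z - a) by rewrite cabs_gt0 subr_eq0.
  have := cdiffM (cdiffB (cdiff_id z) (cdiff_cst a z))
    (cdiffM (entire_cdiff z hA) (cdiffV (entire_cdiff z hP) Pz)) => h.
  eexists; apply: cdiff_ext za0 _ h => w hw; rewrite /v; case: eqVneq => // wa.
  by move: hw; rewrite wa cabsC ltxx.
have cv z : cabs (z - a) < d -> ccont v z.
  move=> hz; have [->|za] := eqVneq z a; last by have [? /cdiff_cont] := dv z hz za.
  move=> e e0; have M1 : 0 < `|M| + 1 by rewrite ltr_wpDl.
  exists (Num.min d (e / (`|M| + 1))); split; first by rewrite lt_min d0 divr_gt0.
  move=> w; rewrite lt_min va subr0 => /andP[w1 w2]; apply: le_trans (bound w w1) _.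
  by rewrite mulrC -ler_pdivlMr // ltW.
have hv : hol v a d by exact: removable aa cv dv.
exists (dquot v a (derive1 v a)); split; first exact: hol_dquot.
move=> w wa hw; rewrite dquot_neq // va subr0 /v (negPf wa).
by rewrite mulrAC divff ?mul1r // subr_eq0.
Qed.

(** The local extensions are glued by giving [Psi] at [a] the value at [a] of the extension around
    [a]; two extensions agree wherever both are defined, by continuity. *)
Lemma entire_quotient A P : centire A -> centire P ->
  (forall a, exists d : R, exists M : R, 0 < d /\
     forall w, w != a -> cabs (w - a) < d -> P w != 0 /\ cabs (A w) <= M * cabs (P w)) ->
  exists Psi, centire Psi /\ forall z, A z = Psi z * P z.
Proof.
move=> hA hP loc.
have /choice[dq hdq] : forall a, exists dq : R * (C -> C), [/\ 0 < dq.1, hol dq.2 a dq.1 &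
    forall w, w != a -> cabs (w - a) < dq.1 -> P w != 0 /\ dq.2 w = A w / P w].
  move=> a; have [d [M [d0 hAP]]] := loc a.
  have [q [hq qE]] := removable_quotient hA hP d0 hAP.
  by exists (d, q); split=> //= w wa hw; split; [case: (hAP w wa hw)|exact: qE].
pose Psi a := (dq a).2 a.
have cq a : ccont (dq a).2 a.
  by have [d0 hq _] := hdq a; apply: hol_cont hq _; rewrite subrr cabs0.
have PsiE a w : w != a -> cabs (w - a) < (dq a).1 -> Psi w = (dq a).2 w.
  move=> wa hw; have [d0 hq qE] := hdq a; have [Pw ->] := qE w wa hw.
  have [d'0 hq' qE'] := hdq w.
  apply: (@ccont_eq (dq w).2 (fun v => A v / P v) w (dq w).1) => //.
    apply: ccontM; first exact: entire_cont.
    by apply: ccontV => //; exact: entire_cont.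
  by move=> v vw hv; case: (qE' v vw hv).
exists Psi; split=> a; have [d0 hq qE] := hdq a.
  have [|d hd] := hq a; first by rewrite subrr cabs0.
  exists d; apply: cdiff_ext d0 _ hd => w hw.
  by have [->//|wa] := eqVneq w a; rewrite (PsiE a).
apply: (@ccont_eq A (fun w => (dq a).2 w * P w) a (dq a).1) => //.
- exact: entire_cont.
- by apply: ccontM => //; exact: entire_cont.
- by move=> w wa hw; have [Pw ->] := qE w wa hw; rewrite divfK.
Qed.

(** The reason why a Blaschke factor has modulus 1 on the circle. *)
Lemma conj_circle (al w : C) (r : R) : 0 < r -> cabs w = r ->
  cabs (creal (r ^+ 2) - (al^*%C : C) * w) = r * cabs (w - al).
Proof.
move=> r0 hw; apply/eqP; rewrite -(@eqrXn2 _ 2) ?cabs_ge0 ?mulr_ge0 ?cabs_ge0 ?(ltW r0) //.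
rewrite exprMn; move: (congr1 (fun x => x ^+ 2) hw); rewrite !sqr_cabs.
case: al => p q; case: w {hw} => x y /= <-; apply/eqP; ring.
Qed.

(* Multiplying by the inverse Blaschke factor of a zero in |w - c| < rho / 2 keeps the
   modulus on |w - c| = rho and at least doubles it at c; so only finitely many steps occur. *)
Lemma remove_zeros Psi c (rho : R) : centire Psi -> Psi c != 0 -> 0 < rho ->
  exists E, [/\ centire E, forall w, cabs (w - c) = rho -> cabs (E w) = cabs (Psi w),
    cabs (Psi c) <= cabs (E c) & forall w, cabs (w - c) < rho / 2 -> E w != 0].
Proof.
move=> hPsi Pc rho0.
have [M [M0 hM]] : exists M : R, 0 <= M /\ forall w, cabs (w - c) <= rho -> cabs (Psi w) <= M.
  by apply: bounded_on_disc => [|w _]; [exact: ltW|exact: entire_cont].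
have {}hM w : cabs (w - c) = rho -> cabs (Psi w) <= M by move=> h; apply: hM; rewrite h.
have pc : 0 < cabs (Psi c) by rewrite cabs_gt0.
have [n hn] : exists n, M / 2 ^+ n < cabs (Psi c).
  have [|n hn] := @exp_half_small R M (cabs (Psi c) / 2) M0; first by lra.
  by exists n; lra.
elim: n Psi hPsi Pc hM pc hn => [|n IH] Psi hPsi Pc hM pc hn.
  have h : cabs (Psi c) <= M.
    apply: (@hol_maxp _ Psi c (rho + 1) (entire_hol hPsi) rho M rho0 _ hM); first by lra.
    by rewrite subrr cabs0 ltW.
  by move: hn; rewrite expr0 divr1; lra.
have [|] := pselect (forall w, cabs (w - c) < rho / 2 -> Psi w != 0).
  by move=> h; exists Psi; split.
move=> /existsNP[a /not_implyP[ha /negP/negPn/eqP Pa]].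
pose q := dquot Psi a (derive1 Psi a).
have PE w : Psi w = q w * (w - a) by rewrite (dquotE Psi a (derive1 Psi a) w) Pa add0r.
pose F w : C := creal (rho ^+ 2) - ((a - c)^*%C : C) * (w - c).
pose E w := q w * (F w * creal rho^-1).
have hE : centire E.
  apply: entireM; first exact: entire_dquot.
  move=> z; eexists; apply: cdiffM (cdiff_cst _ _); apply: cdiffB (cdiff_cst _ _) _.
  by apply: cdiffM (cdiff_cst _ _) _; exact: cdiffB (cdiff_id _) (cdiff_cst _ _).
have crho : cabs (creal rho^-1 : C) = rho^-1.
  by rewrite cabs_creal gtr0_norm // invr_gt0.
have Ecirc w : cabs (w - c) = rho -> cabs (E w) = cabs (Psi w).
  move=> hw; rewrite PE !cabsM crho /F (conj_circle (a - c) rho0 hw).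
  have -> : w - c - (a - c) = w - a by ring.
  by congr (_ * _); rewrite mulrAC divff ?mul1r // lt0r_neq0.
have Ec : 2 * cabs (Psi c) <= cabs (E c).
  rewrite PE !cabsM crho /F subrr mulr0 subr0 cabs_creal gtr0_norm ?exprn_gt0 //.
  have -> : rho ^+ 2 * rho^-1 = rho by rewrite expr2 mulfK // lt0r_neq0.
  by have := cabs_ge0 (q c); rewrite cabsC; nra.
have [||||E' [hE' E'circ E'c E'0]] := IH E hE.
- by rewrite -cabs_gt0; lra.
- by move=> w hw; rewrite Ecirc // hM.
- by lra.
- move: hn; rewrite exprS invfM; lra.
by exists E'; split=> // [w hw|]; [rewrite E'circ // Ecirc|lra].
Qed.

End Entire.

(** * Linear dependence of ramified systems *)

Section Core.
Variable R : realType.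
Local Notation C := (cplx R).

Lemma fin_lower_bound (I : finType) (d : I -> R) : (forall i, 0 < d i) ->
  exists e : R, 0 < e /\ forall i, e <= d i.
Proof.
move=> d0; pose s := 1 + \sum_i (d i)^-1.
have h (Q : pred I) : 0 <= \sum_(i | Q i) (d i)^-1.
  by apply: sumr_ge0 => i _; rewrite invr_ge0 ltW.
have s0 : 0 < s by have := h predT; rewrite /s; lra.
exists s^-1; split=> [|i]; first by rewrite invr_gt0.
rewrite -[d i]invrK lef_pV2 ?posrE ?invr_gt0 // /s (bigD1 i) //=.
by have := h (fun j => j != i); lra.
Qed.

(** The weight vanishes on the boundary of the disc, so a near maximum dominates a whole disc around
    it: within half of the distance to the boundary the weight drops by at most [2 ^+ m], and
    near-maximality costs one more factor 2. A near maximum is taken because [G], the set where the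
    estimate will be applied, is dense and not closed. *)
Lemma weighted_near_max (I : finType) (T : I -> C -> C) (G : C -> Prop) p0 i0 (r : R) m :
  (forall i, centire (T i)) ->
  (forall p, exists dl : R, 0 < dl /\ forall w, w != p -> cabs (w - p) < dl -> G w) ->
  G p0 -> T i0 p0 != 0 -> 0 < r ->
  exists z j rho, [/\ 0 < rho, r - cabs (z - p0) = 2 * rho, G z,
    cabs (T i0 p0) * r ^+ m < 2 * (cabs (T j z) * (2 * rho) ^+ m) &
    forall i w, cabs (w - z) < rho -> cabs (T i w) <= 2 ^+ m.+1 * cabs (T j z)].
Proof.
move=> hT dense Gp0 T0 r0.
pose F i z := cabs (T i z) * (r - cabs (z - p0)) ^+ m.
pose S : set R := fun x => exists z i, [/\ cabs (z - p0) < r, G z & x = F i z].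
have Sp0 : S (F i0 p0) by exists p0, i0; rewrite subrr cabs0.
have /choice[Mf hMf] : forall i, exists M : R, 0 <= M /\
    forall w, cabs (w - p0) <= r -> cabs (T i w) <= M.
  by move=> i; apply: bounded_on_disc => [|w _]; [exact: ltW|exact: entire_cont].
have supS : has_sup S.
  split; first by exists (F i0 p0).
  exists (\sum_i Mf i * r ^+ m) => x [z [i [hz _ ->]]].
  have [M0 hM] := hMf i; have z0 := cabs_ge0 (z - p0).
  have rz : 0 <= r - cabs (z - p0) by rewrite subr_ge0 ltW.
  apply: (@le_trans _ _ (Mf i * r ^+ m)).
    apply: ler_pM; rewrite ?cabs_ge0 ?exprn_ge0 ?hM ?(ltW hz) //.
    by rewrite lerXn2r ?nnegrE ?(ltW r0) // gerBl.
  rewrite (bigD1 i) //= lerDl; apply: sumr_ge0 => i' _.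
  by rewrite mulr_ge0 ?exprn_ge0 ?(ltW r0) //; case: (hMf i').
have FS x : S x -> x <= sup S by move=> Sx; apply: ub_le_sup => //; case: supS.
have F0E : F i0 p0 = cabs (T i0 p0) * r ^+ m by rewrite /F subrr cabs0 subr0.
have sup0 : 0 < sup S.
  by apply: lt_le_trans (FS _ Sp0); rewrite F0E mulr_gt0 ?exprn_gt0 ?cabs_gt0.
have sup2 : 0 < sup S / 2 by rewrite divr_gt0.
have [x [z [j [hz Gz xF]]] xS] := sup_adherent sup2 supS.
have {x xF xS}Fz : sup S < 2 * F j z.
  by rewrite -ltr_pdivrMl // mulrC -xF; apply: le_lt_trans xS; rewrite {2}[sup S]splitr addrK.
have [rho rhoE] : exists rho, r - cabs (z - p0) = 2 * rho.
  by exists ((r - cabs (z - p0)) / 2); field.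
have rho0 : 0 < rho by rewrite -(pmulr_rgt0 _ (ltr0Sn R 1)) -rhoE subr_gt0.
exists z, j, rho; split=> // [|i w hw].
  by rewrite -F0E -rhoE; exact: le_lt_trans (FS _ Sp0) Fz.
(* The supremum controls only points of [G]; continuity extends the bound to [w]. *)
apply: (@ccont_limit _ (T i) w _ (entire_cont w (hT i))) => dl dl0.
have [d2 [d20 h2]] := dense w.
have [|w' [w'w]] := @exists_near R w (Num.min dl (Num.min d2 (rho - cabs (w - z)))).
  by rewrite !lt_min dl0 d20 subr_gt0.
rewrite !lt_min => /and3P[hw1 hw2 hw3]; exists w'; split=> //.
have w'z : cabs (w' - z) < rho.
  by apply: le_lt_trans (cabs_triangle w' z w) _; rewrite -ltrBrDr.
have w'p : rho <= r - cabs (w' - p0).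
  clear - w'z rhoE; have := cabs_triangle w' p0 z; lra.
have Fw : F i w' <= sup S.
  apply: FS; exists w', i; split=> //; last exact: h2.
  by rewrite -subr_gt0; exact: lt_le_trans w'p.
have rk0 : 0 < rho ^+ m by rewrite exprn_gt0.
rewrite -(ler_pM2r rk0); apply: le_trans (_ : F i w' <= _).
  rewrite /F ler_wpM2l ?cabs_ge0 // lerXn2r ?nnegrE ?(ltW rho0) //.
  exact: le_trans (ltW rho0) w'p.
apply: le_trans (ltW (le_lt_trans Fw Fz)) _.
by rewrite /F rhoE exprMn exprS le_eqVlt; apply/orP; left; apply/eqP; ring.
Qed.

(* h is a d-th root of Psi, freed of its zeros near z. *)
Lemma zero_free_root (I : finType) (g : I -> C -> C) (Psi : C -> C) j z (rho K : R) d :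
  (0 < d)%N -> centire Psi -> (forall i, centire (g i)) -> Psi z != 0 -> 0 < rho -> 1 <= K ->
  (forall i w, cabs (w - z) < rho ->
    cabs (Psi w * g i w ^+ d) <= K * cabs (Psi z * g j z ^+ d)) ->
  exists h, [/\ hol h z (rho / 4), forall w, cabs (w - z) < rho / 4 -> h w != 0 &
    forall i w, cabs (w - z) < rho / 4 -> cabs (h w * g i w) <= K * cabs (h z * g j z)].
Proof.
move=> d0 hPsi hg Psiz rho0 K1 bd.
have K0 : 0 <= K by exact: le_trans ler01 K1.
have rho1 : 0 < rho / 2 by rewrite divr_gt0.
have [E [hE Ecirc Ez Enz]] := remove_zeros hPsi Psiz rho1.
have r4 : rho / 2 / 2 = rho / 4 by field.
rewrite r4 in Enz.
have rho2 : 0 < rho / 4 by rewrite divr_gt0.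
have [h [hh hd]] := hol_root d0 (entire_hol hE) Enz.
have zz : cabs (z - z) < rho / 4 by rewrite subrr cabs0.
exists h; split=> // [w hw|i w hw].
  by have := Enz w hw; rewrite -hd //; apply: contraNneq => ->; rewrite expr0n (gtn_eqF d0).
rewrite -(@ler_pXn2r _ d d0) ?nnegrE ?mulr_ge0 ?cabs_ge0 //.
rewrite -cabsX exprMn hd //.
apply: (@le_trans _ _ (K * cabs (Psi z * g j z ^+ d))).
  have h1 : rho / 4 < rho / 2 by clear - rho0; lra.
  have h2 : rho / 2 < rho by clear - rho0; lra.
  apply: (@hol_maxp _ (fun w => E w * g i w ^+ d) z rho _ (rho / 2)) => //.
  - by apply: entire_hol; apply: entireM => //; exact: entireX.
  - by move=> v hv; rewrite cabsM Ecirc // -cabsM; apply: bd; rewrite hv.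
  - exact: ltW (lt_trans hw h1).
apply: (@le_trans _ _ (K * cabs (h z * g j z) ^+ d)).
  rewrite ler_wpM2l // -cabsX exprMn hd // !cabsM.
  by rewrite ler_wpM2r ?cabs_ge0.
by rewrite exprMn ler_wpM2r ?exprn_ge0 ?cabs_ge0 // -{1}[K]expr1 ler_weXn2l.
Qed.

(** Cartan's theorem on ramified hyperplanes for the [k + 1] hyperplanes in general position of
    [P^(k-1)] given by the coordinates and their sum. Its condition that the sum of the
    [1 - (k - 1) / l_i] exceed [k] is the present inequality. *)
Lemma ramified_system (k : nat) (l : 'I_k.+1 -> nat) (g : 'I_k.+1 -> C -> C) :
  (1 < k)%N -> (forall i, (0 < l i)%N) ->
  (k.-1%:R * \sum_i ((l i)%:R)^-1 < 1 :> rat) ->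
  (forall i, centire (g i)) -> (forall z, \sum_i g i z = 0) ->
  (forall z, exists i, g i z != 0) ->
  (forall i a, g i a = 0 -> forall m, (m < l i)%N -> derive1n m (g i) a = 0) ->
  exists al : 'I_k -> C, (exists i, al i != 0) /\
    forall z, \sum_(i < k) al i * g (lift ord_max i) z = 0.
Proof.
move=> k1 l0 hl hg g0 gz ram; apply: contrapT => indep.
pose b := (\prod_i l i)%N.
pose a i := (\prod_(j | j != i) l j)%N.
have b0 : (0 < b)%N by apply: prodn_gt0.
have ab i : (a i * l i = b)%N by rewrite /b (bigD1 i) //= mulnC.
have kab : (k.-1 * (\sum_i a i) < b)%N.
  have bN : 0 < b%:R :> rat by rewrite ltr0n.
  rewrite -(ltr_nat rat) natrM natr_sum.
  have -> : \sum_i (a i)%:R = b%:R * \sum_i ((l i)%:R)^-1 :> rat.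
    rewrite mulr_sumr; apply: eq_bigr => i _; rewrite -(ab i) natrM mulfK //.
    by rewrite pnatr_eq0 -lt0n.
  by rewrite mulrCA -[ltRHS]mulr1 ltr_pM2l.
pose e i := (b - k.-1 * a i)%N.
pose d := (b - k.-1 * (\sum_i a i))%N.
pose kap := (b * (\sum_(m < k) m))%N.
have d0 : (0 < d)%N by rewrite subn_gt0.
have kap0 : (0 < kap)%N.
  by rewrite muln_gt0 b0 (bigD1 (Ordinal k1)) //= lt0n addn_eq0.
pose W := wronskian (fun i => g (lift ord_max i)).
pose P z := \prod_i g i z ^+ e i.
have hW : centire W.
  by apply: hol_entire => r; apply: wronskian_hol => i; exact: entire_hol.
have hP : centire P by apply: entire_prod => i; exact: entireX.
have [zW Wn] : exists z, W z != 0.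
  apply: entire_wronskian => [i|al al0 i]; first exact: hg.
  by apply/eqP/negPn/negP => ali; apply: indep; exists al; split=> //; exists i.
(* A vanishing [g i] is itself a relation; if [i] is the last index, the relation is that the first
   [k] functions have sum 0. *)
have gn i : exists z, g i z != 0.
  apply: contrapT => gi0; have {}gi0 z : g i z = 0.
    by apply/eqP/negPn/negP => h; apply: gi0; exists z.
  apply: indep; have k0 : (0 < k)%N by exact: ltnW.
  case: (unliftP ord_max i) => [j ij|im].
    exists (fun j' => (j' == j)%:R); split; first by exists j; rewrite eqxx oner_eq0.
    move=> z; rewrite (bigD1 j) //= -ij gi0 mulr0 add0r big1 // => j' /negPf ->.
    by rewrite mul0r.
  exists (fun=> 1); split; first by exists (Ordinal k0); rewrite oner_eq0.
  move=> z; rewrite -[RHS](g0 z) (bigD1_ord ord_max) //= -im gi0 add0r.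
  by apply: eq_bigr => j _; rewrite mul1r.
have iso p : exists dl : R, 0 < dl /\ forall w, w != p -> cabs (w - p) < dl ->
    forall i, g i w != 0.
  have /choice[df hdf] := fun i => isolated_zeros p (hg i) (gn i).
  have [|dl [dl0 hdl]] := @fin_lower_bound _ df; first by move=> i; case: (hdf i).
  exists dl; split=> // w wp hw i; have [_ h] := hdf i; apply: h => //.
  exact: lt_le_trans hw (hdl i).
(* No orders of zeros are counted: [wronskian_bound] with [h = 1] on a disc of fixed radius shows
   that [W ^+ b / P] is bounded near each [p], because some [g j] does not vanish at [p]. *)
have [Psi [hPsi PsiE]] : exists Psi, centire Psi /\ forall z, W z ^+ b = Psi z * P z.
  apply: entire_quotient => //; first exact: entireX.
  move=> p; have [j gj] := gz p; have pj : 0 < cabs (g j p) by rewrite cabs_gt0.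
  have [d1 [d10 h1]] := ccont_neq0 (entire_cont p (hg j)) gj.
  have [d2 [d20 h2]] := iso p.
  have /choice[Mf hMf] : forall i, exists M : R, 0 <= M /\
      forall w, cabs (w - p) <= 1 -> cabs (g i w) <= M.
    by move=> i; apply: bounded_on_disc => // w _; exact: entire_cont.
  pose M1 := \sum_i Mf i.
  have M10 : 0 <= M1 by apply: sumr_ge0 => i _; case: (hMf i).
  have M1f i w : cabs (w - p) <= 1 -> cabs (g i w) <= M1.
    move=> hw; have [_ h] := hMf i; apply: le_trans (h w hw) _.
    by rewrite /M1 (bigD1 i) //= lerDl; apply: sumr_ge0 => i' _; case: (hMf i').
  (* Chosen so that [M1 <= K * |g j p| / 2 <= K * |g j w|] for [w] near [p]; the 1 ensures
     [1 <= K]. *)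
  pose K := 1 + 2 * M1 / cabs (g j p).
  have K1 : 1 <= K by rewrite /K lerDl divr_ge0 ?mulr_ge0 // ltW.
  have [Kc [Kc0 hKc]] := wronskian_bound l0 b0 ab kab K1.
  pose rho := Num.min 1 (Num.min d1 d2) / 2.
  have [rho0 r1 r2 r3] : [/\ 0 < rho, rho <= 1 / 2, rho <= d1 / 2 & rho <= d2 / 2].
    by rewrite /rho; split; rewrite ?divr_gt0 ?ler_pM2r ?lt_min ?ltr01 ?d10 ?ge_min ?lexx ?orbT ?invr_gt0.
  clearbody rho.
  exists rho, (Kc / (rho ^+ kap * (cabs (g j p) / 2) ^+ d)); split=> // w wp hw.
  have gw i : g i w != 0 by apply: h2 => //; lra.
  split; first by rewrite /P; apply/prodf_neq0 => i _; rewrite expf_neq0.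
  have gjw : cabs (g j p) / 2 <= cabs (g j w) by apply: h1; lra.
  have := hKc g (fun=> 1) w rho j rho0 (@hol_cst _ _ _ _) _ (fun i => entire_hol (hg i))
     (fun z _ => g0 z) _ gw (fun i q _ => ram i q).
  move=> H; have {}H := H (fun _ _ => oner_neq0 _) _.
  have {}H : rho ^+ kap * cabs (W w) ^+ b * cabs (g j w) ^+ d <= Kc * \prod_i cabs (g i w) ^+ e i.
    apply: H => i v hv; rewrite !mul1r.
    apply: (@le_trans _ _ M1).
      by apply: M1f; have := cabs_triangle v p w; lra.
    apply: le_trans (_ : K * (cabs (g j p) / 2) <= _).
      rewrite /K mulrDl mul1r.
      have -> : 2 * M1 / cabs (g j p) * (cabs (g j p) / 2) = M1.
        by field; rewrite lt0r_neq0.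
      by rewrite lerDr; lra.
    by rewrite ler_wpM2l //; lra.
  have -> : cabs (P w) = \prod_i cabs (g i w) ^+ e i.
    by rewrite /P cabs_prod; apply: eq_bigr => i _; rewrite cabsX.
  rewrite cabsX mulrAC ler_pdivlMr ?mulr_gt0 ?exprn_gt0 ?divr_gt0 //.
  apply: le_trans H; rewrite mulrC -!mulrA.
  apply: ler_wpM2l; first by rewrite exprn_ge0 // ltW.
  rewrite mulrC; apply: ler_wpM2l; first by rewrite exprn_ge0 ?cabs_ge0.
  by rewrite lerXn2r ?nnegrE ?divr_ge0 ?cabs_ge0.
have [p0 [Wp0 gp0]] : exists p0, W p0 != 0 /\ forall i, g i p0 != 0.
  have [d1 [d10 h1]] := isolated_zeros 0 hW (ex_intro _ zW Wn).
  have [d2 [d20 h2]] := iso 0.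
  have [|w [w0]] := @exists_near R 0 (Num.min d1 d2); first by rewrite lt_min d10.
  by rewrite lt_min => /andP[w1 w2]; exists w; split; [exact: h1|exact: h2].
have Psi0 : Psi p0 != 0.
  by apply: contraNneq Wp0 => h; have := PsiE p0; rewrite h mul0r => /eqP; rewrite expf_eq0 b0.
pose Th i z := Psi z * g i z ^+ d.
have hTh i : centire (Th i) by apply: entireM => //; exact: entireX.
have Th0 : Th ord0 p0 != 0 by rewrite mulf_neq0 // expf_neq0.
have th0 : 0 < cabs (Th ord0 p0) by rewrite cabs_gt0.
(* The factor with which [weighted_near_max] controls the neighbouring values. *)
have K1 : 1 <= 2 ^+ kap.+1 :> R by rewrite exprn_ege1 // ler1n.
have [Kc [Kc0 hKc]] := wronskian_bound l0 b0 ab kab K1.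
have [X XE] : exists X, X = 2 * (8 ^+ kap * Kc) by eexists.
have X0 : 0 <= X by rewrite XE mulr_ge0 // mulr_ge0 // exprn_ge0.
(* Then [|Th ord0 p0| * r] exceeds [X], and [r <= r ^+ kap] because [1 <= r] and [0 < kap]. *)
have [r rE] : exists r, r = 1 + X / cabs (Th ord0 p0) by eexists.
have r1 : 1 <= r by rewrite rE lerDl divr_ge0 // ltW.
have [z [j [rho [rho0 rhoE gzz Fz bd]]]] :=
  weighted_near_max kap hTh iso gp0 Th0 (lt_le_trans ltr01 r1).
have Psiz : Psi z != 0.
  apply: contraTneq Fz => Pz; rewrite /Th Pz mul0r cabs0 mul0r mulr0 -leNgt.
  by rewrite mulr_ge0 ?cabs_ge0 // exprn_ge0 // (le_trans ler01 r1).
have [h [hh hnz hK]] := zero_free_root d0 hPsi hg Psiz rho0 K1 bd.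
have rho4 : 0 < rho / 4 by rewrite divr_gt0.
have H := hKc g h z (rho / 4) j rho4 hh hnz (fun i => entire_hol (hg i))
  (fun w _ => g0 w) hK gzz (fun i q _ => ram i q).
have Pz : 0 < \prod_i cabs (g i z) ^+ e i.
  by apply: prodr_gt0 => i _; rewrite exprn_gt0 // cabs_gt0.
have PE : cabs (P z) = \prod_i cabs (g i z) ^+ e i.
  by rewrite /P cabs_prod; apply: eq_bigr => i _; rewrite cabsX.
(* Since [W ^+ b = Psi * P], the product over the [g i] cancels from both sides. *)
have {}H : (rho / 4) ^+ kap * cabs (Th j z) <= Kc.
  rewrite -(ler_pM2r Pz); apply: le_trans H.
  rewrite -(cabsX (wronskian _ z)) PsiE cabsM PE /Th cabsM cabsX.
  by rewrite le_eqVlt; apply/orP; left; apply/eqP; rewrite -!mulrA; congr (_ * (_ * _)); rewrite mulrC.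
have {}H : cabs (Th j z) * (2 * rho) ^+ kap <= 8 ^+ kap * Kc.
  apply: le_trans (ler_wpM2l _ H); last by rewrite exprn_ge0.
  have -> : 2 * rho = 8 * (rho / 4) by field.
  by rewrite exprMn mulrC mulrA lexx.
have : cabs (Th ord0 p0) * r ^+ kap < X.
  by apply: lt_le_trans Fz _; rewrite XE ler_wpM2l.
apply/negP; rewrite -leNgt; apply: (@le_trans _ _ (cabs (Th ord0 p0) * r)).
  by rewrite rE mulrDr mulr1 mulrCA divff ?mulr1 ?lt0r_neq0 // lerDr ltW.
by rewrite ler_wpM2l ?cabs_ge0 // -{1}[r]expr1 ler_weXn2l.
Qed.

End Core.

(** * Common zeros of forms *)

Local Open Scope classical_set_scope.

Lemma linear_dependence (F : fieldType) (V : lmodType F) (I J : finType)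
    (v : I -> V) (w : J -> V) (a : I -> J -> F) :
  (#|J| < #|I|)%N -> (forall i, v i = \sum_j a i j *: w j) ->
  exists c : I -> F, (exists i, c i != 0) /\ \sum_i c i *: v i = 0.
Proof.
move=> IJ va.
pose A : 'M[F]_(#|I|, #|J|) := \matrix_(i, j) a (enum_val i) (enum_val j).
have /rowV0Pn[u /sub_kermxP uA u0] : kermx A != 0.
  by rewrite kermx_eq0 -row_leq_rank -ltnNge (leq_ltn_trans (rank_leq_col A)).
exists (fun i => u 0 (enum_rank i)); split.
  apply: contrapT => h; case/negP: u0; apply/eqP/rowP => k; rewrite mxE.
  apply/eqP/negPn/negP => uk; apply: h; exists (enum_val k).
  by rewrite enum_valK.
transitivity (\sum_j (\sum_i u 0 (enum_rank i) * a i j) *: w j).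
  under [RHS]eq_bigr do rewrite scaler_suml.
  rewrite exchange_big /=; apply: eq_bigr => i _; rewrite va scaler_sumr.
  by apply: eq_bigr => j _; rewrite scalerA.
rewrite big1 // => j _; suff -> : \sum_i u 0 (enum_rank i) * a i j = 0.
  exact: scale0r.
have := congr1 (fun B : 'rV_ _ => B 0 (enum_rank j)) uA.
rewrite !mxE; apply: etrans; rewrite (reindex (@enum_val I predT)) /=; last first.
  by apply: onW_bij; exact: enum_val_bij.
by apply: eq_bigr => i _; rewrite mxE enum_valK enum_rankK.
Qed.

(** Stated as not being covered by countably many finite lists, the form in which the
    Nullstellensatz uses it: one list for each bound on the degree. *)
Definition uncountable (T : eqType) := forall s : nat -> seq T, exists x, forall k, x \notin s k.

(** Complements of finite sets are open and dense, so the theorem of Baire applies. *)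
Lemma real_uncountable (R : realType) : uncountable R.
Proof.
move=> s.
have od (t : seq R) : open [set x : R | x \notin t] /\ dense [set x : R | x \notin t].
  elim: t => [|a t [ot dt]].
    have -> : [set x : R | x \notin [::]] = setT by apply/seteqP.
    split; [exact: openT|move=> O [y Oy] _; by exists y].
  have -> : [set x : R | x \notin a :: t] = [set~ a] `&` [set x | x \notin t].
    apply/seteqP; split=> x /=; rewrite inE negb_or; first by move=> /andP[/eqP].
    by move=> [/eqP -> ->].
  have oa : open [set~ a].
    by rewrite openC; exact/accessible_closed_set1/hausdorff_accessible/Rhausdorff.
  split; first exact: openI.
  by apply: denseI => //; exact: dense_set1C.
have := @Baire R R (fun k => [set x : R | x \notin s k]) (fun k => od (s k)).
move=> /(_ setT) [||x [_ h]]; [by exists 0|exact: openT|].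
by exists x => k; apply: h.
Qed.

Lemma complex_uncountable (R : realType) : uncountable R[i].
Proof.
move=> s; have [x hx] := real_uncountable (fun k => [seq complex.Re z | z <- s k]).
by exists x%:C%C => k; apply: contra (hx k) => /(map_f (@complex.Re R)).
Qed.

Lemma lagrange_neq0 (F : fieldType) (I : finType) (c la : I -> F) (i0 : I) :
  injective c -> la i0 != 0 ->
  \sum_i la i *: \prod_(j | j != i) ('X - (c j)%:P) != 0.
Proof.
move=> cI; apply: contraNneq => p0; have := congr1 (horner^~ (c i0)) p0.
rewrite horner_sum horner0 (bigD1 i0) //= [X in _ + X]big1 ?addr0 => [|i ii0].
  rewrite hornerZ horner_prod => /eqP; rewrite mulf_eq0 => /orP[//|].
  rewrite prodf_seq_eq0 => /hasP[j _ /andP[ji]].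
  by rewrite !hornerE subr_eq0 => /eqP /cI ij; rewrite ij eqxx in ji.
rewrite hornerZ horner_prod (bigD1 i0) //=; last by rewrite eq_sym.
by rewrite hornerXsubC subrr mul0r mulr0.
Qed.

Lemma bounded_uniq_seq (T : eqType) (S : set T) (D : nat) :
  (forall t : seq T, uniq t -> {in t, forall x, S x} -> (size t <= D)%N) ->
  exists t : seq T, forall x, S x -> x \in t.
Proof.
move=> h; suff [t [ut [tS [tD|//]]]] : exists t : seq T, uniq t /\
    {in t, forall x, S x} /\ ((size t > D)%N \/ forall x, S x -> x \in t).
  by exists t => x; have := h t ut tS; rewrite leqNgt tD.
  by exists t.
suff : forall k, exists t : seq T, uniq t /\ {in t, forall x, S x} /\
    ((size t >= k)%N \/ forall x, S x -> x \in t) by apply.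
elim=> [|k [t [ut [tS [tk|tk]]]]]; first by exists [::]; split=> //; split=> //; left.
- have [tx|/existsNP[x /not_implyP[Sx /negP xt]]] := pselect (forall x, S x -> x \in t).
    by exists t; split=> //; split=> //; right.
  exists (x :: t); split; first by rewrite /= xt.
  split; last by left.
  by move=> y; rewrite inE => /orP[/eqP ->|/tS].
- by exists t; split=> //; split=> //; right.
Qed.

(** * Nullstellensatz over an uncountable field, and its homogeneous form *)

Section Nullstellensatz.
Variables (C : closedFieldType) (n : nat).
Local Notation Pol := (mpoly n C).
Local Notation Xi i := (mpolyX C (mnm1 i)).
Local Notation K c := (@mpolyC n C c).

Definition is_ideal (A : set Pol) : Prop :=
  [/\ A 0, forall p q, A p -> A q -> A (p + q) & forall p q, A q -> A (p * q)].

Lemma exists_maximal_ideal (A0 : set Pol) : is_ideal A0 -> ~ A0 1 ->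
  exists A, [/\ is_ideal A, A0 `<=` A, ~ A 1 &
    forall p, ~ A p -> exists u, A (1 - u * p)].
Proof.
move=> iA0 n1.
pose P (A : set Pol) := A = set0 \/ [/\ is_ideal A, A0 `<=` A & ~ A 1].
have [G GP Gt|A [PA Amax]] := @Zorn_bigcup Pol P.
  have [[X [GX X0]]|h] := pselect (exists X, G X /\ X <> set0); last first.
    left; apply/seteqP; split=> // x [X GX Xx]; apply: h; exists X; split=> // X0.
    by move: Xx; rewrite X0.
  have good Y y : G Y -> Y y -> [/\ is_ideal Y, A0 `<=` Y & ~ Y 1].
    by move=> GY Yy; have [Y0|//] := GP _ GY; move: Yy; rewrite Y0.
  right; have [x Xx] : X !=set0 by apply/set0P/eqP.
  have [[Xz _ _] XA _] := good _ _ GX Xx.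
  split; first split.
  - by exists X.
  - move=> p q [Y GY Yp] [Z GZ Zq].
    have [[_ YD _] _ _] := good _ _ GY Yp; have [[_ ZD _] _ _] := good _ _ GZ Zq.
    have [YZ|ZY] := Gt _ _ GY GZ; first by exists Z => //; apply: ZD => //; exact: YZ.
    by exists Y => //; apply: YD => //; exact: ZY.
  - move=> p q [Y GY Yq]; exists Y => //.
    by have [[_ _ YM] _ _] := good _ _ GY Yq; exact: YM.
  - by move=> p /XA Xp; exists X.
  - by move=> [Y GY Y1]; have [_ _] := good _ _ GY Y1.
have {PA}[AE|[iA A0A A1]] := PA.
  have /Amax : A `<` A0.
    by rewrite AE; split=> // h; case: iA0 => /h.
  by case; right; split.
exists A; split=> // p Ap.
pose B := [set q | exists m u, A m /\ q = m + u * p].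
have [Az AD AM] := iA.
have iB : is_ideal B.
  split.
  - by exists 0, 0; rewrite mul0r addr0.
  - move=> _ _ [m [u [Am ->]]] [m' [u' [Am' ->]]]; exists (m + m'), (u + u').
    by split; [exact: AD|rewrite mulrDl addrACA].
  - move=> r _ [m [u [Am ->]]]; exists (r * m), (r * u).
    by split; [exact: AM|rewrite mulrDr mulrA].
have AB : A `<` B.
  split=> [m Am|BA]; first by exists m, 0; rewrite mul0r addr0.
  by apply: Ap; apply: BA; exists 0, 1; rewrite mul1r add0r.
have : B 1.
  apply: contrapT => B1; apply: (Amax B AB); right; split=> //.
  by apply: subset_trans A0A _; case: AB.
by move=> [m [u [Am ->]]]; exists u; rewrite addrK.
Qed.

Lemma maximal_prime (A : set Pol) : is_ideal A ->
  (forall p, ~ A p -> exists u, A (1 - u * p)) ->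
  forall p q, A (p * q) -> A p \/ A q.
Proof.
move=> [_ AD AM] Amax p q Apq; have [|/Amax[u Au]] := pselect (A p); first by left.
right; have -> : q = q * (1 - u * p) + u * (p * q) by ring.
by apply: AD; exact: AM.
Qed.

(* Otherwise every [x - c] has an inverse modulo [A]. Uncountably many of these inverses have
   bounded degree, so they satisfy a linear relation; clearing denominators gives a nonzero
   polynomial [p] with [p(x)] in [A], and [p] splits into linear factors. *)
Lemma maximal_ideal_coordinate (A : set Pol) (x : Pol) : uncountable C -> is_ideal A -> ~ A 1 ->
  (forall p, ~ A p -> exists u, A (1 - u * p)) ->
  exists c, A (x - K c).
Proof.
move=> uncC iA A1 Amax; have [Az AD AM] := iA.
have prime := maximal_prime iA Amax.
apply: contrapT => noc.
have /choice[u hu] : forall c, exists u, A (1 - u * (x - K c)).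
  by move=> c; apply: Amax => h; apply: noc; exists c.
pose S k : set C := [set y | (msize (u y) <= k)%N].
have [k hk] : exists k, forall D, exists t : seq C,
    [/\ uniq t, {in t, forall y, S k y} & (D < size t)%N].
  apply: contrapT => h.
  have : forall k, exists t : seq C, forall y, S k y -> y \in t.
    move=> k; apply: contrapT => h'; apply: h; exists k => D; apply: contrapT => h2.
    apply: h'; apply: (@bounded_uniq_seq _ _ D) => t ut tS.
    by rewrite leqNgt; apply/negP => tD; apply: h2; exists t.
  move=> /choice[s hs]; have [y hy] := uncC s.
  by have := hs (msize (u y)) y (leqnn _); rewrite (negPf (hy _)).
have [t [ut tS tD]] := hk #|{: bmultinom n k}|.
pose c (i : 'I_(size t)) : C := t`_i.
have cI : injective c.
  move=> i j /eqP; rewrite nth_uniq // => /eqP ij; exact: val_inj.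
have [||la [[i0 la0] laE]] := @linear_dependence C Pol 'I_(size t) (bmultinom n k)
    (fun i => u (c i)) (fun m => mpolyX C m) (fun i m => mcoeff m (u (c i))).
- by rewrite card_ord.
- by move=> i; apply: mpolywE; apply: tS; exact: mem_nth.
pose p : {poly C} := \sum_i la i *: \prod_(j | j != i) ('X - (c j)%:P).
have p0 : p != 0 by exact: lagrange_neq0 cI la0.
have AZ (a : C) q : A q -> A (a *: q) by rewrite -mul_mpolyC; exact: AM.
have eX (a : C) : horner_alg x ('X - a%:P) = x - K a.
  by rewrite rmorphB /= horner_algX horner_algC -mul_mpolyC mulr1.
have Aep : A (horner_alg x p).
  (* The two sides differ by [\prod_j (x - K (c j))] times the linear relation between the
     inverses. *)
  have -> : horner_alg x p = \sum_i la i *: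
      (\prod_(j | j != i) (x - K (c j)) * (1 - u (c i) * (x - K (c i)))).
    transitivity (\sum_i la i *: \prod_(j | j != i) (x - K (c j))).
      rewrite /p rmorph_sum /=; apply: eq_bigr => i _.
      rewrite linearZ /= rmorph_prod mulr_algl; congr (_ *: _).
      by apply: eq_bigr => j _; exact: eX.
    apply/eqP; rewrite -subr_eq0 -sumrB; apply/eqP.
    transitivity ((\prod_j (x - K (c j))) * \sum_i la i *: u (c i)).
      rewrite mulr_sumr; apply: eq_bigr => i _; rewrite -scalerBr -scalerAr.
      by rewrite [in RHS](bigD1 i) //=; congr (_ *: _); ring.
    by rewrite laE mulr0.
  apply: (big_ind A) => // i _; apply: AZ; exact: AM.
have [r pr] := @closed_field_poly_normal C p.
have Ar : A (\prod_(z <- r) (x - K z)).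
  have -> : \prod_(z <- r) (x - K z) = (lead_coef p)^-1 *: horner_alg x p.
    rewrite {2}pr linearZ /= mulr_algl scalerA mulVf ?lead_coef_eq0 // scale1r.
    by rewrite rmorph_prod; apply: eq_bigr => z _; exact/esym/eX.
  exact: AZ.
elim: r Ar {pr} => [|z r IH]; first by rewrite big_nil.
by rewrite big_cons => /prime[Axz|//]; apply: noc; exists z.
Qed.

(** If the ideal were proper, a maximal ideal above it would contain [Xi i - K (v i)] for a point
    [v], hence [q - K (meval v q)] for all [q]. Some [F i] does not vanish at [v], so a nonzero
    constant would lie in the ideal. *)
Lemma weak_nullstellensatz (r : nat) (F : 'I_r -> Pol) : uncountable C ->
  (forall v : 'I_n -> C, exists i, meval v (F i) != 0) ->
  exists h : 'I_r -> Pol, 1 = \sum_i h i * F i.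
Proof.
move=> uncC nz; apply: contrapT => h1.
pose A0 := [set p | exists h : 'I_r -> Pol, p = \sum_i h i * F i].
have iA0 : is_ideal A0.
  split.
  - by exists (fun=> 0); rewrite big1 // => i _; rewrite mul0r.
  - move=> _ _ [g ->] [h ->]; exists (fun i => g i + h i).
    by rewrite -big_split; apply: eq_bigr => i _; rewrite mulrDl.
  - move=> q _ [g ->]; exists (fun i => q * g i).
    by rewrite mulr_sumr; apply: eq_bigr => i _; rewrite mulrA.
have [A [iA A0A A1 Amax]] := exists_maximal_ideal iA0 h1.
have [Az AD AM] := iA.
have AN q : A q -> A (- q) by rewrite -mulN1r; exact: AM.
have /choice[v hv] := fun i => maximal_ideal_coordinate (Xi i) uncC iA A1 Amax.
pose E (q : Pol) := A (q - K (meval v q)).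
have mulE (p q : Pol) : E p -> E q -> E (p * q).
  move=> Ep Eq; rewrite /E mevalM mpolyCM.
  have -> : p * q - K (meval v p) * K (meval v q) =
      p * (q - K (meval v q)) + K (meval v q) * (p - K (meval v p)) by ring.
  by apply: AD; exact: AM.
have E1 : E 1 by rewrite /E meval1 subrr.
have EC (q : Pol) : E q.
  rewrite [q]mpolyE; apply: (big_ind E) => [|p p' Ep Ep'|m _].
  - by rewrite /E meval0 subrr.
  - by rewrite /E mevalD mpolyCD opprD addrACA; exact: AD.
  - rewrite -mul_mpolyC; apply: (mulE); first by rewrite /E mevalC subrr.
    rewrite mpolyXE_id; elim/big_rec: _ => [|i p _ Ep]; [exact: E1|apply: (mulE _ _ _ Ep)].
    elim: (m i) => [|k IH]; first by rewrite expr0.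
    by rewrite exprS; apply: mulE => //; rewrite /E mevalXU.
have [i vi] := nz v; apply: A1.
have AFi : A (F i).
  apply: A0A; exists (fun j => (j == i)%:R); rewrite (bigD1 i) //= eqxx mul1r.
  by rewrite big1 ?addr0 // => j /negPf ->; rewrite mul0r.
have -> : 1 = K (meval v (F i))^-1 * (F i - (F i - K (meval v (F i)))).
  by rewrite opprB addrC subrK -mpolyCM mulVf.
by apply: AM; apply: AD => //; exact: AN (EC (F i)).
Qed.

(** If [p] vanished everywhere, [p - 1] would have no zero, hence be invertible and constant; so [p]
    would be a constant with value 0. *)
Lemma nonzero_value (p : Pol) : uncountable C -> p != 0 -> exists v : 'I_n -> C, meval v p != 0.
Proof.
move=> uncC p0; apply: contrapT => h.
have pz v : meval v p = 0.
  by apply/eqP/negPn/negP => hv; apply: h; exists v.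
have [v|g gE] := @weak_nullstellensatz 1 (fun=> p - 1) uncC.
  by exists ord0; rewrite mevalB pz meval1 sub0r oppr_eq0 oner_neq0.
rewrite big_ord1 in gE.
have g0 : g ord0 != 0 by apply: contra_eq_neq gE => ->; rewrite mul0r oner_neq0.
have q0 : p - 1 != 0 by apply: contra_eq_neq gE => ->; rewrite mulr0 oner_neq0.
have := msizeM g0 q0; rewrite -gE msize1 => /esym s1.
have : msize (p - 1) = 1%N.
  have : (0 < msize (g ord0))%N by rewrite lt0n msize_poly_eq0.
  have : (0 < msize (p - 1))%N by rewrite lt0n msize_poly_eq0.
  move: s1; case: (msize (g ord0)) => // a; case: (msize (p - 1)) => // b.
  by rewrite addSn addnS /= => -[/eqP]; rewrite addn_eq0 => /andP[_ /eqP ->].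
move=> /eqP /msize_poly1P[c _ pc].
have {}pc : p = K (c + 1) by rewrite mpolyCD -pc subrK.
by move: p0; have := pz (fun=> 0); rewrite pc mevalC => ->; rewrite mpolyC0 eqxx.
Qed.

(* The components of degree greater than [M] are dropped. *)
Definition homogenize (t : 'I_n) (M : nat) (p : Pol) : Pol :=
  \sum_(e < M.+1) Xi t ^+ (M - e) * pihomog mdeg e p.

Lemma homogenizeD t M p q : homogenize t M (p + q) = homogenize t M p + homogenize t M q.
Proof. by rewrite -big_split; apply: eq_bigr => e _; rewrite pihomogD mulrDr. Qed.

Lemma homogenizeZ t M c p : homogenize t M (c *: p) = c *: homogenize t M p.
Proof. by rewrite scaler_sumr; apply: eq_bigr => e _; rewrite linearZ /= scalerAr. Qed.

Lemma homogenize_sum t M (I : Type) (s : seq I) (F : I -> Pol) :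
  homogenize t M (\sum_(i <- s) F i) = \sum_(i <- s) homogenize t M (F i).
Proof.
apply: (big_morph _ (homogenizeD t M)); rewrite /homogenize big1 // => e _.
by rewrite pihomog0 mulr0.
Qed.

Lemma homogenize_form t M d (p : Pol) : p \is ishomog1 d mdeg -> (d <= M)%N ->
  homogenize t M p = Xi t ^+ (M - d) * p.
Proof.
move=> hp dM; rewrite /homogenize (bigD1 (Ordinal (dM : (d < M.+1)%N))) //=.
rewrite pihomog_dE // big1 ?addr0 // => e; rewrite -val_eqE /= eq_sym => ed.
by rewrite (pihomog_ne0 ed hp) mulr0.
Qed.

Lemma homogenize_homog t M p : homogenize t M p \is ishomog1 M mdeg.
Proof.
apply: rpred_sum => e _; have eM : (e <= M)%N by rewrite -ltnS.
have := @dhomogM n C mdeg (M - e) (Xi t ^+ (M - e)) e (pihomog mdeg e p).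
rewrite subnK //; apply; last exact: pihomogP.
have := @dhomogMn n C mdeg 1 (Xi t) (M - e); rewrite mul1n; apply.
by rewrite dhomogX; apply/eqP; exact: mdeg1.
Qed.

(** The bound on [msize h] ensures that no component of the product exceeds degree [M] and is
    dropped. *)
Lemma homogenizeM t M d (h p : Pol) : p \is ishomog1 d mdeg ->
  (msize h + d <= M)%N ->
  homogenize t M (h * p) = homogenize t (M - d) h * p.
Proof.
move=> hp hM; rewrite [h]mpolyE mulr_suml !homogenize_sum mulr_suml.
rewrite big_seq [RHS]big_seq; apply: eq_bigr => m mh.
have mM : (mdeg m + d <= M)%N.
  by apply: leq_trans hM; rewrite leq_add2r ltnW // msize_mdeg_lt.
rewrite -scalerAl !homogenizeZ -scalerAl; congr (_ *: _).
have mX : mpolyX C m \is ishomog1 (mdeg m) mdeg by rewrite dhomogX.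
rewrite (homogenize_form t (dhomogM mX hp)) // (homogenize_form t mX); last first.
  by rewrite leq_subRL ?(leq_trans _ mM) ?leq_addl // addnC.
by rewrite mulrA -subnDA (addnC d).
Qed.

(** Homogenization pads with powers of [Xi t] and so cannot distinguish [Xi t] from 1; this removes
    the auxiliary generator [Xi t - 1]. *)
Lemma homogenize_shift t M (h : Pol) : (msize h < M)%N ->
  homogenize t M (h * (Xi t - 1)) = 0.
Proof.
move=> hM; rewrite mulrBr mulr1 [h]mpolyE mulr_suml -scaleN1r homogenizeD homogenizeZ.
rewrite scaleN1r; apply/eqP; rewrite subr_eq0; apply/eqP.
rewrite !homogenize_sum big_seq [RHS]big_seq; apply: eq_bigr => m mh.
have mM : (mdeg m < M)%N by apply: ltn_trans hM; exact: msize_mdeg_lt.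
rewrite -scalerAl !homogenizeZ; congr (_ *: _).
have mX : mpolyX C m \is ishomog1 (mdeg m) mdeg by rewrite dhomogX.
have tX : Xi t \is ishomog1 1 mdeg by rewrite dhomogX; apply/eqP; exact: mdeg1.
rewrite (homogenize_form t (dhomogM mX tX)) ?addn1 // (homogenize_form t mX) ?(ltnW mM) //.
by rewrite (mulrC (mpolyX C m)) mulrA -exprSr subnSK.
Qed.

(** Adding [Xi t - 1] to the forms excludes the common zeros with vanishing coordinate [t]. The
    Nullstellensatz writes 1 as a combination, and homogenizing in degree [M] turns 1 into
    [Xi t ^+ M]. *)
Lemma power_in_ideal (r d : nat) (P : 'I_r -> Pol) (t : 'I_n) : uncountable C ->
  (forall i, P i \is ishomog1 d mdeg) ->
  (forall v : 'I_n -> C, v t != 0 -> exists i, meval v (P i) != 0) ->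
  exists M0, forall M, (M0 <= M)%N -> exists g : 'I_r -> Pol,
    (forall i, g i \is ishomog1 (M - d) mdeg) /\ Xi t ^+ M = \sum_i g i * P i.
Proof.
move=> uncC hP nz.
pose F (j : 'I_r.+1) := if unlift ord_max j is Some i then P i else Xi t - 1.
have [v|h hE] := @weak_nullstellensatz r.+1 F uncC.
  have [vt|vt] := eqVneq (v t) 0.
    exists ord_max; rewrite /F unlift_none mevalB mevalXU vt meval1 sub0r.
    by rewrite oppr_eq0 oner_neq0.
  by have [i Pi] := nz v vt; exists (lift ord_max i); rewrite /F liftK.
exists (\sum_j msize (h j) + d).+1 => M hM.
have hj j : (msize (h j) + d < M)%N.
  apply: leq_trans hM; rewrite ltnS leq_add2r (bigD1 j) //=; exact: leq_addr.
exists (fun i => homogenize t (M - d) (h (lift ord_max i))); split.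
  by move=> i; exact: homogenize_homog.
have one : (1 : Pol) \is ishomog1 0 mdeg by exact: dhomog1.
have := homogenize_form t one (leq0n M); rewrite subn0 mulr1 => <-.
rewrite hE homogenize_sum (bigD1_ord ord_max) //= /F unlift_none.
rewrite homogenize_shift ?add0r; last by apply: leq_trans (hj ord_max); rewrite ltnS leq_addr.
by apply: eq_bigr => i _; rewrite liftK (homogenizeM _ (hP i)) // ltnW.
Qed.

End Nullstellensatz.

(** * Dimension count for common zeros of few forms *)

Section Dimension.
Variables (C : closedFieldType) (n r : nat) (P : 'I_r -> mpoly n C) (M : nat).
Local Notation Pol := (mpoly n C).
Local Notation Xi i := (mpolyX C (mnm1 i)).

Definition gen (ga : 'I_n -> nat) (be : 'I_r -> nat) : Pol :=
  \prod_t Xi t ^+ ga t * \prod_i P i ^+ be i.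

(** For each [e] only [M ^ n * e.+1 ^ r] generators occur; the induction retains this bound while
    products by [P i] are formed. *)
Inductive spanned (e : nat) : Pol -> Prop :=
| spanned0 : spanned e 0
| spannedD p q : spanned e p -> spanned e q -> spanned e (p + q)
| spanned_gen c ga be : (forall t, ga t < M)%N -> (forall i, be i <= e)%N ->
    spanned e (c *: gen ga be).

Lemma spannedZ e c p : spanned e p -> spanned e (c *: p).
Proof.
elim=> [|p1 p2 _ h1 _ h2|a ga be hg hb]; first by rewrite scaler0; constructor.
  by rewrite scalerDr; constructor.
by rewrite scalerA; constructor.
Qed.

Lemma spanned_sum e (I : Type) (s : seq I) (Q : pred I) (F : I -> Pol) :
  (forall i, Q i -> spanned e (F i)) -> spanned e (\sum_(i <- s | Q i) F i).
Proof. by move=> h; elim/big_ind: _ => //; constructor. Qed.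

Lemma spannedM e p i : spanned e p -> spanned e.+1 (p * P i).
Proof.
elim=> [|p1 p2 _ h1 _ h2|a ga be hg hb]; first by rewrite mul0r; constructor.
  by rewrite mulrDl; constructor.
have -> : a *: gen ga be * P i = a *: gen ga (fun j => (be j + (j == i))%N).
  rewrite -scalerAl; congr (_ *: _); rewrite /gen -mulrA; congr (_ * _).
  rewrite (bigD1 i) //= [RHS](bigD1 i) //= eqxx addn1 exprSr -!mulrA.
  congr (_ * _); rewrite mulrC; congr (_ * _).
  by apply: eq_bigr => j /negPf ->; rewrite addn0.
constructor=> // j; case: eqP => _; last by rewrite addn0 ltnW // ltnS.
by rewrite addn1 ltnS.
Qed.

Lemma spanned_family e p : spanned e p ->
  exists a : {ffun 'I_n -> 'I_M} * {ffun 'I_r -> 'I_e.+1} -> C,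
    p = \sum_g a g *: gen (fun t => g.1 t) (fun i => g.2 i).
Proof.
elim=> [|p1 p2 _ [a1 ->] _ [a2 ->]|c ga be hg hb].
- by exists (fun=> 0); rewrite big1 // => g _; rewrite scale0r.
- exists (fun g => a1 g + a2 g); rewrite -big_split; apply: eq_bigr => g _.
  by rewrite scalerDl.
- pose g0 := ([ffun t => Ordinal (hg t)], [ffun i => Ordinal (hb i : (be i < e.+1)%N)]).
  exists (fun g => if g == g0 then c else 0); rewrite (bigD1 g0) //= eqxx big1 ?addr0.
    congr (_ *: (_ * _)); apply: eq_bigr => t _; by rewrite ffunE.
  by move=> g /negPf ->; rewrite scale0r.
Qed.

(** If some exponent reaches [M], replace [Xi t ^+ M] by its expression in the [P i]. The cofactor
    has degree lower by [d > 0], and one factor [P i] is gained, so induction on the degree also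
    bounds the exponents of the [P i]. *)
Lemma all_spanned d (g : 'I_n -> 'I_r -> Pol) : (0 < d <= M)%N ->
  (forall t i, g t i \is ishomog1 (M - d) mdeg) ->
  (forall t, Xi t ^+ M = \sum_i g t i * P i) ->
  forall e (m : multinom n), (mdeg m <= e)%N -> spanned e (mpolyX C m).
Proof.
move=> /andP[d0 dM] hg XE; elim=> [|e IH] m me.
all: have [mM|/existsNP[t /negP]] := pselect (forall t, m t < M)%N.
1,3: have -> : mpolyX C m = 1 *: gen m (fun=> 0%N).
1,3: by rewrite scale1r /gen [X in _ * X]big1 ?mulr1 // mpolyXE_id.
1,2: by constructor.
all: rewrite -leqNgt => tM; have tm : (m t <= mdeg m)%N.
1,3: by rewrite mdegE (bigD1 t) //= leq_addr.
  by have := leq_trans (leq_trans dM tM) (leq_trans tm me); rewrite leqNgt d0.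
pose m' := mnm_sub m (mnm_muln (mnm1 t) M).
have mE : mnm_add m' (mnm_muln (mnm1 t) M) = m.
  apply: submK; apply/mnm_lepP => s; rewrite mulmnE mnm1E.
  by case: eqP => [<-|_]; rewrite ?mul1n ?mul0n.
have dm : (mdeg m = mdeg m' + M)%N by rewrite -mE mdegD mdegMn mdeg1 mul1n.
rewrite -mE mpolyXD -mpolyXn XE mulr_sumr; apply: spanned_sum => i _.
rewrite mulrA; apply: spannedM; rewrite [g t i]mpolyE mulr_sumr big_seq.
apply: spanned_sum => mu hmu; rewrite -scalerAr -mpolyXD; apply: spannedZ; apply: IH.
rewrite mdegD; have -> : mdeg mu = (M - d)%N by apply: (dhomog_mf (hg t i)).
by rewrite -ltnS; apply: leq_trans me; rewrite dm addnBA // ltn_subrL d0 addn_gt0 (leq_trans d0 dM) orbT.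
Qed.

End Dimension.

(* If the only common zero is the origin, every monomial lies in the span of the products of a
   monomial from a fixed finite set with a monomial in [P]. At most a constant times [L ^ r] of
   these products are relevant below degree [L], too few for [L ^ n] independent monomials. *)
Lemma common_zero (C : closedFieldType) (n r d : nat) (P : 'I_r -> mpoly n C) :
  uncountable C -> (r < n)%N -> (0 < d)%N -> (forall i, P i \is ishomog1 d mdeg) ->
  exists x : 'I_n -> C, (exists t, x t != 0) /\ forall i, meval x (P i) = 0.
Proof.
move=> uncC rn d0 hP; apply: contrapT => nz.
have nzt t (v : 'I_n -> C) : v t != 0 -> exists i, meval v (P i) != 0.
  move=> vt; apply: contrapT => h; apply: nz; exists v; split; first by exists t.
  by move=> i; apply/eqP/negPn/negP => hi; apply: h; exists i.
have /choice[M0 hM0] := fun t => power_in_ideal uncC hP (nzt t).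
pose M := (d + \sum_t M0 t)%N.
have M0M t : (M0 t <= M)%N.
  by apply: leq_trans (leq_addl _ _); rewrite (bigD1 t) //= leq_addr.
have /choice[g hg] := fun t => hM0 t M (M0M t).
(* The generators number [M ^ n * (n * L).+1 ^ r], at most [M ^ n * (2 * n) ^ r * L ^ r]. This [L]
   makes the count smaller than [L ^ r.+1], hence than the [L ^ n] monomials with exponents below
   [L]. *)
pose L := (M ^ n * (2 * n) ^ r).+1.
pose m (i : {ffun 'I_n -> 'I_L}) := Multinom [tuple (i t : nat) | t < n].
have mI : injective m.
  move=> i j /mnmP ij; apply/ffunP => t; apply: val_inj.
  by have := ij t; rewrite !mnmE.
have mL i : (mdeg (m i) <= n * L)%N.
  rewrite mdegE; apply: (@leq_trans (\sum_(t < n) L)); last first.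
    by rewrite sum_nat_const card_ord.
  by apply: leq_sum => t _; rewrite mnmE ltnW.
have dM : (0 < d <= M)%N by rewrite d0 leq_addr.
have sp i : spanned P M (n * L) (mpolyX C (m i)).
  by apply: (all_spanned dM _ _ (mL i)) => t; case: (hg t).
have /choice[a ha] := fun i => spanned_family (sp i).
have [|c [[i0 ci0] cE]] := linear_dependence _ ha.
  rewrite card_prod !card_ffun !card_ord.
  have n0 : (0 < n)%N by exact: leq_ltn_trans rn.
  have h1 : ((n * L).+1 ^ r <= (2 * n) ^ r * L ^ r)%N.
    have nL : ((n * L).+1 <= 2 * n * L)%N.
      by rewrite -mulnA mul2n -addnn -addn1 leq_add2l muln_gt0 n0.
    by rewrite -expnMn; case: (r) => // r'; rewrite leq_exp2r.
  have h2 : (L ^ r.+1 <= L ^ n)%N by rewrite leq_pexp2l.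
  apply: leq_trans h2; rewrite expnS; apply: (@leq_ltn_trans (M ^ n * ((2 * n) ^ r * L ^ r))).
    by rewrite leq_mul2l h1 orbT.
  by rewrite mulnA ltn_pmul2r ?expn_gt0.
have := congr1 (mcoeff (m i0)) cE; rewrite mcoeff0 raddf_sum (bigD1 i0) //= big1.
  by rewrite addr0 mcoeffZ mcoeffX eqxx mulr1 => ci; rewrite ci eqxx in ci0.
move=> i ii0; rewrite mcoeffZ mcoeffX.
by case: eqP => [/mI ii|_]; [rewrite ii eqxx in ii0|rewrite mulr0].
Qed.

Local Close Scope classical_set_scope.

(** * Holomorphic curves *)

Section Curve.
Variables (R : realType) (N n : nat) (f : 'I_N.+1 -> cplx R -> cplx R).
Local Notation C := (cplx R).
Local Notation form P := (is_form_of_degree n P).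

Lemma entire_compose_form (P : coord_poly R N) : (forall i, entire (f i)) ->
  centire (compose_form P f).
Proof.
move=> hf; have cf i : centire (f i) by move=> z; exists (derive1 (f i) z); exact: derivable_cdiff (hf i z).
apply: hol_entire => r.
have -> : compose_form P f =
    fun z => \sum_(m <- msupp P) mcoeff m P * \prod_i f i z ^+ m i.
  by apply/funext => z; exact: mevalE.
apply: hol_sum => m; apply: holM; first exact: hol_cst.
by apply: entire_hol; apply: entire_prod => i; exact: entireX.
Qed.

Lemma intersects_scale (P : coord_poly R N) (c : C) m : (forall i, entire (f i)) ->
  c != 0 -> intersects_with_mult_at_least f P m ->
  intersects_with_mult_at_least f (c *: P) m.
Proof.
move=> hf c0 hP z; have cE : compose_form (c *: P) f = fun w => c * compose_form P f w.
  by apply/funext => w; exact: mevalZ.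
rewrite cE => /eqP; rewrite mulf_eq0 (negPf c0) => /eqP /hP Pz.
have z0 : cabs (z - z) < 1 by rewrite subrr cabs0 ltr01.
apply: (@order_mul _ (fun=> c) _ z 1) => //; first exact: hol_cst.
by apply: entire_hol; exact: entire_compose_form.
Qed.

(** A nonzero form takes a nonzero value at some [v], and its positive degree forces [v] away from
    the origin; so its zero set is a proper algebraic subset that would contain the curve. *)
Lemma nondegenerate_nonzero (P : coord_poly R N) : (0 < n)%N ->
  ~ algebraically_degenerate f -> form P ->
  (forall z, compose_form P f z = 0) -> (forall z, proj_space (fun i => f i z)) -> P = 0.
Proof.
move=> n0 nd hP Pf pf; apply: contrapT => /eqP P0; apply: nd.
exists (proj_zeros [set P]%classic); split.
- by exists [set P]%classic; split=> // _ ->; exact: homogE hP.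
- split=> [x []//|sub].
  have [v Pv] := @nonzero_value R[i] _ _ (@complex_uncountable R) P0.
  have [|_ /(_ P erefl) v0] := sub v; last by rewrite v0 eqxx in Pv.
  apply: contrapT => v0; case/negP: Pv; rewrite mevalE big_seq big1 // => m mP.
  have : (0 < mdeg m)%N by rewrite (dhomog_mf hP mP).
  rewrite lt0n mdegE sum_nat_eq0 negb_forall => /existsP[i /= mi].
  have vi : v i = 0 by apply/eqP/negPn/negP => vi; apply: v0; exists i.
  by rewrite (bigD1 i) //= vi expr0n (negPf mi) mul0r mulr0.
- by move=> z; split=> // _ ->; exact: Pf.
Qed.

(** Nondegeneracy turns the relation between the functions [G i] evaluated on the curve into a
    relation between the forms themselves. *)
Lemma ramified_forms_dependent (k : nat) (G : 'I_k.+1 -> coord_poly R N)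
    (l : 'I_k.+1 -> nat) :
  (0 < n)%N -> (1 < k)%N -> (forall i, 0 < l i)%N ->
  k.-1%:R * \sum_i ((l i)%:R)^-1 < 1 :> rat ->
  holomorphic_curve f -> ~ algebraically_degenerate f ->
  (forall i, form (G i)) -> \sum_i G i = 0 ->
  (forall z, exists i, compose_form (G i) f z != 0) ->
  (forall i, intersects_with_mult_at_least f (G i) (l i)) ->
  exists al : 'I_k -> C, (exists i, al i != 0) /\
    \sum_(i < k) al i *: G (lift ord_max i) = 0.
Proof.
move=> n0 k1 l0 hl [hf pf] nd hG G0 nz hm.
have [i|z|//|i a Ga m ml|al [al0 alE]] := @ramified_system R k l (fun i => compose_form (G i) f) k1 l0 hl.
- exact: entire_compose_form.
- transitivity (meval (fun i => f i z) (\sum_i G i)); first by rewrite raddf_sum.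
  by rewrite G0 meval0.
- exact: hm.
exists al; split=> //; apply: nondegenerate_nonzero => //.
  by apply: rpred_sum => i _; apply: rpredZ; exact: hG.
move=> z; rewrite -[RHS](alE z) /compose_form raddf_sum.
by apply: eq_bigr => i _; exact: mevalZ.
Qed.

End Curve.

(** * Linear relations between forms in general position *)

Section GeneralPosition.
Variables (R : realType) (N n q : nat) (Q : 'I_q -> coord_poly R N).
Hypotheses (n0 : (0 < n)%N) (Nq : (N < q)%N).
Hypotheses (hQ : forall j, hypersurface_form n (Q j)) (gp : general_position Q).
Local Notation C := (cplx R).

Lemma general_position_point (x : 'I_N.+1 -> C) (i : 'I_N.+1 -> 'I_q) :
  injective i -> proj_space x -> exists k, meval x (Q (i k)) != 0.
Proof.
move=> iI x0; apply: contrapT => h.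
have : (\bigcap_(k in [set: 'I_N.+1]) supp (Q (i k)))%classic x.
  move=> k _; split=> // _ ->; apply/eqP/negPn/negP => hk; apply: h; by exists k.
by rewrite gp.
Qed.

Lemma relation_support (c : 'I_q -> C) (j0 : 'I_q) : c j0 != 0 ->
  \sum_j c j *: Q j = 0 -> (N.+1 < #|[set j | c j != 0%R]|)%N.
Proof.
move=> cj0 cE; set A := [set j | c j != 0]; rewrite ltnNge; apply/negP => AN.
(* The support comes first, so a support of at most [N + 1] elements lies within the first [N + 1]
   entries, and entry 0 belongs to it. *)
pose s := enum A ++ enum (~: A).
have us : uniq s.
  rewrite cat_uniq !enum_uniq andbT /=; apply/hasPn => j.
  by rewrite !mem_enum inE.
have ss : size s = q by rewrite size_cat -!cardE cardsC card_ord.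
have ltN (i : 'I_N.+1) : (i < size s)%N by rewrite ss (leq_trans (ltn_ord i)).
pose e (i : 'I_N.+1) := nth j0 s i.
have eI : injective e.
  by move=> i j /eqP; rewrite nth_uniq // => /eqP /val_inj.
have eA j : j \in A -> exists i, j = e i.
  move=> jA; have js : (index j (enum A) < N.+1)%N.
    by apply: leq_trans AN; rewrite cardE index_mem mem_enum.
  exists (Ordinal js); rewrite /e /= nth_cat index_mem mem_enum jA nth_index //.
  by rewrite mem_enum.
have e0A : e ord0 \in A.
  rewrite /e /= nth_cat -cardE (_ : 0 < #|A|)%N; last first.
    by apply/card_gt0P; exists j0; rewrite inE.
  rewrite -mem_enum; apply: mem_nth; rewrite -cardE; apply/card_gt0P; exists j0.
  by rewrite inE.
(* At a common zero of the entries other than entry 0, the relation forces the form of entry 0 to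
   vanish too; these are [N + 1] forms with a common zero. *)
have [x [x0 xP]] := @common_zero R[i] N.+1 N n (fun i => Q (e (lift ord0 i)))
  (@complex_uncountable R) (ltnSn N) n0 (fun i => (hQ _).1).
have [i /negP[]] := general_position_point eI x0.
have [j ->|->] := unliftP ord0 i; first by rewrite xP.
have := congr1 (meval x) cE; rewrite raddf_sum meval0 (bigD1 (e ord0)) //= big1.
  rewrite addr0 mevalZ => /eqP; rewrite mulf_eq0 => /orP[|//].
  by move: e0A; rewrite inE => /negPf ->.
move=> j je; rewrite mevalZ; have [->|cj] := eqVneq (c j) 0; first by rewrite mul0r.
have [i' ji'] : exists i, j = e i by apply: eA; rewrite inE.
have [i2 i2E|i0E] := unliftP ord0 i'; first by rewrite ji' i2E xP mulr0.
by rewrite ji' i0E eqxx in je.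
Qed.

Lemma minimal_relation (c : 'I_q -> C) (j0 : 'I_q) : c j0 != 0 ->
  \sum_j c j *: Q j = 0 ->
  exists c : 'I_q -> C, [/\ exists j, c j != 0, \sum_j c j *: Q j = 0 &
    forall c' : 'I_q -> C, (exists j, c' j != 0) -> \sum_j c' j *: Q j = 0 ->
    (#|[set j | c j != 0%R]| <= #|[set j | c' j != 0%R]|)%N].
Proof.
move=> cj0 cE.
pose P m := `[< exists c : 'I_q -> C, [/\ exists j, c j != 0, \sum_j c j *: Q j = 0
  & #|[set j | c j != 0]| = m] >].
have exP : exists m, P m.
  by exists #|[set j | c j != 0]|; apply/asboolP; exists c; split=> //; exists j0.
case: (ex_minnP exP) => m /asboolP[c1 [c10 c1E c1m]] mmin.
exists c1; split=> // c' c'0 c'E; rewrite c1m; apply: mmin; apply/asboolP.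
by exists c'.
Qed.

End GeneralPosition.

Lemma enum_family (T : finType) (A : {set T}) k : #|A| = k ->
  exists e : 'I_k -> T, [/\ injective e, forall i, e i \in A &
    forall x, x \in A -> exists i, e i = x].
Proof.
move=> <-; exists enum_val; split=> [|i|x xA]; first exact: enum_val_inj.
  exact: enum_valP.
by exists (enum_rank_in xA x); rewrite enum_rankK_in.
Qed.

(** Both cases of the theorem use it: the indices [e i] select some of the multiplicities, and
    [k.-1] is at most [q - 1]. *)
Lemma sum_inv_lt (q k : nat) (l : 'I_q.+1 -> nat) (e : 'I_k.+1 -> 'I_q.+1) :
  (1 < q)%N -> (k <= q)%N -> injective e ->
  \sum_j ((l j)%:R)^-1 < (q%:R - 1)^-1 :> rat ->
  k.-1%:R * \sum_i ((l (e i))%:R)^-1 < 1 :> rat.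
Proof.
move=> q1 kq eI hl.
have q10 : 0 < q%:R - 1 :> rat by rewrite subr_gt0 ltr1n.
have s0 : \sum_i ((l (e i))%:R)^-1 <= \sum_j ((l j)%:R)^-1 :> rat.
  rewrite -(big_imset (fun j => ((l j)%:R)^-1) (in2W eI)) /=.
  rewrite [leRHS](bigID (mem [set e i | i in xpredT])) /= lerDl.
  by apply: sumr_ge0 => j _; rewrite invr_ge0.
have k1 : k.-1%:R <= q%:R - 1 :> rat.
  rewrite lerBrDr natr1 ler_nat; case: (k) kq => //= _; exact: ltnW.
apply: (@le_lt_trans _ _ ((q%:R - 1) * \sum_j ((l j)%:R)^-1)).
  by apply: ler_pM => //; apply: sumr_ge0 => i _; rewrite invr_ge0.
by rewrite mulrC -ltr_pdivlMr // mul1r.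
Qed.

Theorem theorem4 (R : realType) (N q n : nat)
    (hN : (1 <= N)%N) (hq : (N < q)%N) (hn : (1 < n)%N)
    (Q : 'I_q -> coord_poly R N)
    (hQ : forall j : 'I_q, hypersurface_form n (Q j))
    (hgp : general_position Q)
    (hsum : \sum_(j < q) Q j <> 0)
    (l : 'I_q.+1 -> nat) (hl : forall j : 'I_q.+1, (0 < l j)%N)
    (f : 'I_N.+1 -> cplx R -> cplx R) (hf : holomorphic_curve f)
    (hmult : forall j : 'I_q.+1,
       intersects_with_mult_at_least f (with_sum Q j) (l j))
    (hlt : \sum_(j < q.+1) ((l j)%:R)^-1 < (q%:R - 1)^-1 :> rat) :
  algebraically_degenerate f.
Proof.
have n0 : (0 < n)%N by exact: ltnW.
have q1 : (1 < q)%N by exact: leq_ltn_trans hq.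
have [ef pf] := hf.
apply: contrapT => nd.
have [[c0 [j0 cj0] c0E]|indep] := pselect (exists2 c : 'I_q -> cplx R,
    exists j, c j != 0 & \sum_j c j *: Q j = 0).
  have [c [[j cj] cE cmin]] := minimal_relation cj0 c0E.
  set A := [set j | c j != 0] in cmin.
  have AN : (N.+1 < #|A|)%N := relation_support n0 hq hQ hgp cj cE.
  have [k Ak] : exists k, #|A| = k.+1 by exists #|A|.-1; rewrite prednK // (ltn_trans _ AN).
  have [e [eI eA Ae]] := enum_family Ak.
  have ce i : c (e i) != 0 by have := eA i; rewrite inE.
  have kq : (k <= q)%N by apply: ltnW; have := max_card (mem A); rewrite card_ord Ak.
  (* The lift sends an index of [Q] to the corresponding index of [with_sum Q], which carries the
     multiplicity. *)
  have eI' : injective (fun i => lift ord_max (e i)) by move=> i i' /lift_inj /eI.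
  have k1 : (1 < k)%N by rewrite -ltnS -Ak; exact: leq_ltn_trans AN.
  (* The support has at least [N + 2] elements, so [N + 1] of its forms can be selected; by general
     position they already have no common zero on the curve. *)
  pose w (i : 'I_N.+1) : 'I_k.+1 := widen_ord (ltnW (leq_trans AN (eq_leq Ak))) i.
  have [||z|i|al [[i0 ali0] alE]] := @ramified_forms_dependent R N n f k
      (fun i => c (e i) *: Q (e i)) (fun i => l (lift ord_max (e i))) n0 k1
      (fun i => hl _) (sum_inv_lt q1 kq eI' hlt) hf nd.
  - by move=> i; apply: rpredZ; exact: (hQ _).1.
  - rewrite -[RHS]cE [RHS](bigID (mem A)) /= [X in _ + X]big1 ?addr0; last first.
      by move=> j'; rewrite inE negbK => /eqP ->; rewrite scale0r.
    rewrite [RHS](reindex e) /=; first by apply: eq_bigl => i; rewrite eA.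
    exists (fun j' => odflt ord0 [pick i | e i == j']) => [i _|j' /Ae[i <-]].
      by case: pickP => [i' /eqP /eI|/(_ i)]; rewrite ?eqxx.
    by case: pickP => [i' /eqP|/(_ i)]; rewrite ?eqxx.
  - have wI : injective (e \o w) by move=> i i' /eI /(congr1 val) ii; exact: val_inj.
    have [i Qi] := general_position_point hgp wI (pf z); exists (w i).
    by rewrite /compose_form mevalZ mulf_neq0.
  - by apply: intersects_scale => //; have := hmult (lift ord_max (e i)); rewrite /with_sum liftK.
  (* The new relation, indexed again by all the forms. Its support lies in [A] but omits
     [e ord_max], which contradicts minimality. *)
  pose c' j' := \sum_(i < k | e (lift ord_max i) == j') al i * c j'.
  have c'e i : c' (e (lift ord_max i)) = al i * c (e (lift ord_max i)).
    rewrite /c' (big_pred1 i) // => i'.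
    by rewrite /= (inj_eq eI) (inj_eq lift_inj).
  have : (#|A| <= #|[set j | c' j != 0%R]|)%N.
    apply: cmin.
      by exists (e (lift ord_max i0)); rewrite c'e mulf_neq0.
    transitivity (\sum_j' \sum_(i < k | e (lift ord_max i) == j')
        al i *: (c (e (lift ord_max i)) *: Q (e (lift ord_max i)))).
      apply: eq_bigr => j' _; rewrite scaler_suml; apply: eq_bigr => i /eqP ->.
      by rewrite scalerA.
    rewrite (exchange_big_dep predT) //= -[RHS]alE; apply: eq_bigr => i _.
    by rewrite (big_pred1 (e (lift ord_max i))) // => j'; rewrite eq_sym.
  rewrite leqNgt => /negP[]; apply: proper_card; apply/properP; split.
    apply/fintype.subsetP => j'; rewrite !inE /c'.
    by apply: contra_neq => cj'; rewrite big1 // => i _; rewrite cj' mulr0.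
  exists (e ord_max); first exact: eA.
  rewrite inE negbK /c' big_pred0 // => i.
  by rewrite (inj_eq eI) eq_sym; exact/negbTE/neq_lift.
(* The minus sign makes the total sum 0; multiplicities are unaffected by it. A relation among the
   first [q] forms then contradicts independence. *)
pose G (i : 'I_q.+1) := if unlift ord_max i is Some j then Q j else - \sum_j Q j.
have GQ j : G (lift ord_max j) = Q j by rewrite /G liftK.
have lI : injective (id : 'I_q.+1 -> 'I_q.+1) by [].
have [||z|i|al [al0 alE]] := @ramified_forms_dependent R N n f q G l n0 q1 hl
   (sum_inv_lt q1 (leqnn q) lI hlt) hf nd.
- move=> i; rewrite /G; case: unliftP => [j _|_]; first exact: (hQ j).1.
  by rewrite -scaleN1r; apply: rpredZ; apply: rpred_sum => j _; exact: (hQ j).1.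
- rewrite (bigD1_ord ord_max) //= {1}/G unlift_none.
  by under [X in _ + X]eq_bigr do rewrite GQ; rewrite addNr.
- have wI : injective (widen_ord hq) by move=> i i' /(congr1 val) ii; exact: val_inj.
  have [i Qi] := general_position_point hgp wI (pf z).
  by exists (lift ord_max (widen_ord hq i)); rewrite GQ.
- have := hmult i; rewrite /with_sum /G; case: unliftP => // _.
  by rewrite -scaleN1r; apply: intersects_scale => //; rewrite oppr_eq0 oner_neq0.
apply: indep; exists al => //; rewrite -[RHS]alE.
by apply: eq_bigr => i _; rewrite GQ.
Qed.
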